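(* Assume $\mathbf Q$ is $(\varepsilon,q)$-separated in $R$, let $\mathbf b\in\mathrm{Comp}_{p,n}$, and put $e_{\mathbf b}=\widehat\Theta_{\mathbf b}(z_{\mathbf b}^{-1})\,v_{\mathbf b}T_{\mathbf b}\in\mathcal H_{r,n}$ and $\widehat{\mathcal H}_{d,\mathbf b}=\{\widehat\Theta_{\mathbf b}(h)e_{\mathbf b}:h\in\mathcal H_{d,\mathbf b}\}$. Then: (a) $e_{\mathbf b}$ is an idempotent of $\mathcal H_{r,n}$ and $v_{\mathbf b}\mathcal H_{r,n}=e_{\mathbf b}\mathcal H_{r,n}$; (b) $\widehat{\mathcal H}_{d,\mathbf b}$ is a subalgebra of $\mathcal H_{r,n}$ with identity element $e_{\mathbf b}$; (c) the map $\mathcal H_{d,\mathbf b}\to\widehat{\mathcal H}_{d,\mathbf b}$, $h\mapsto\widehat\Theta_{\mathbf b}(h)e_{\mathbf b}$, is an algebra isomorphism.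
   Context: Fix integers $p>1$, $d\ge1$, $n\ge3$, $r=pd$; $R$ a commutative ring with a primitive $p$th root of unity $\varepsilon$; $q,Q_1,\dots,Q_d\in R$ invertible, $\mathbf Q=(Q_1,\dots,Q_d)$, $(\varepsilon,q)$-separated meaning $\prod_{1\le i,j\le d}\prod_{-n<k<n}\prod_{1\le t<p}(Q_i-\varepsilon^tq^kQ_j)$ is invertible in $R$. For a tuple $\mathbf Q'$ of $s$ units, $\mathcal H_{s,m}(\mathbf Q')$ is the Ariki–Koike algebra with parameters $q,\mathbf Q'$ (generators $T_0,\dots,T_{m-1}$, relations $\prod_i(T_0-Q'_i)=0$, $(T_i-q)(T_i+1)=0$, $T_0T_1T_0T_1=T_1T_0T_1T_0$, type A braid relations), with Jucys–Murphy elements $L_1=T_0$, $L_{k+1}=q^{-1}T_kL_kT_k$, elements $T_w$, and basis $\{L_1^{a_1}\cdots L_m^{a_m}T_w:0\le a_j<s,w\in\mathfrak S_m\}$. $\mathcal H_{r,n}=\mathcal H_{r,n}(\varepsilon Q_1,\dots,\varepsilon Q_d,\dots,\varepsilon^pQ_1,\dots,\varepsilon^pQ_d)$. In it, $L^{(s)}_k=\prod_{i=1}^d(L_k-\varepsilon^sQ_i)$; $L^{(i,j)}_{l,m}=\prod_{k=l}^m\prod_{s\in I_{ij}}L^{(s)}_k$ with $I_{ij}=\{i,\dots,j\}$ ($i\le j$) or $\{1,\dots,j\}\cup\{i,\dots,p\}$ ($i>j$), superscripts mod $p$, $L^{(s)}_{l,m}=L^{(s,s)}_{l,m}$, empty products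 $1$; $w_{a,b}=(s_{a+b-1}\cdots s_1)^b$, $w^{\langle k\rangle}_{a,b}=(s_{a+b+k-1}\cdots s_{k+1})^b$, $T_{a,b}=T_{w_{a,b}}$. $\mathrm{Comp}_{p,n}$: compositions of $n$ into $p$ nonnegative parts; $\mathbf b_i^j=b_i+\dots+b_j$ ($i\le j$), $0$ otherwise. $v_{\mathbf b}=L^{(1,p-1)}_{1,b_p}T_{b_p,\mathbf b_1^{p-1}}\cdots L^{(1,1)}_{1,b_2}T_{b_2,\mathbf b_1^1}\cdot L^{(2)}_{1,\mathbf b_1^1}\cdots L^{(p)}_{1,\mathbf b_1^{p-1}}$; $Y_t=L^{(t+1,t+p-1)}_{1,b_t}T_{b_t,n-b_t}$; $w_{\mathbf b}=w^{\langle\mathbf b_1^{p-2}\rangle}_{b_{p-1},\mathbf b_p^p}\cdots w^{\langle\mathbf b_1^1\rangle}_{b_2,\mathbf b_3^p}w_{b_1,\mathbf b_2^p}$, $T_{\mathbf b}=T_{w_{\mathbf b}}$. $\mathcal H_{d,\mathbf b}=\mathcal H_{d,b_1}(\varepsilon\mathbf Q)\otimes\cdots\otimes\mathcal H_{d,b_p}(\varepsilon^p\mathbf Q)$. The $R$-linear map $\widehat\Theta_{\mathbf b}:\mathcal H_{d,\mathbf b}\to\mathcal H_{r,n}$ sends the basis element $\bigotimes_t(L_1^{a_{t,1}}\cdots L_{b_t}^{a_{t,b_t}}T_{x_t})$ to $\prod_t\prod_jL^{a_{t,j}}_{\mathbf b_{t+1}^p+j}\cdot T_{x''_1}\cdots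 T_{x''_p}$, where $x''_t=w_{\mathbf b}^{-1}x'_tw_{\mathbf b}$ and $x'_t$ is $x_t$ with each $s_i$ replaced by $s_{i+\mathbf b_1^{t-1}}$. Known: $h\cdot x=\widehat\Theta_{\mathbf b}(h)x$ defines a faithful left $\mathcal H_{d,\mathbf b}$-action on $V_{\mathbf b}=v_{\mathbf b}\mathcal H_{r,n}$ identifying $\mathcal H_{d,\mathbf b}\cong\mathrm{End}_{\mathcal H_{r,n}}(V_{\mathbf b})$. $z_{\mathbf b}$ is the unique element of $\mathcal H_{d,\mathbf b}$ with $\widehat\Theta_{\mathbf b}(z_{\mathbf b})v_{\mathbf b}=Y_p\cdots Y_1v_{\mathbf b}$; it is central and invertible in $\mathcal H_{d,\mathbf b}$. *)

(* Defs.v *)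
From HB Require Import structures.
From mathcomp Require Import all_boot all_order all_fingroup all_algebra.
From Stdlib Require Import ClassicalEpsilon.
Unset Printing Implicit Defensive.
Import GRing.Theory.
Local Open Scope ring_scope.

(* s_i in S_m, for 1 <= i < m; the identity otherwise (never used). *)
Definition sgen (m i : nat) : 'S_m :=
  match m return 'S_m with
  | 0 => 1%g
  | m'.+1 => if (0 < i)%N && (i < m'.+1)%N
             then tperm (inord i.-1 : 'I_m'.+1) (inord i)
             else 1%g
  end.

Definition wprod (m : nat) (s : seq nat) : 'S_m :=
  foldr (fun i acc => (sgen m i * acc)%g) 1%g s.

Definition is_reduced (m : nat) (w : 'S_m) (s : seq nat) : Prop :=
  wprod m s = w /\ forall s', wprod m s' = w -> (size s <= size s')%N.

Definition redword (m : nat) (w : 'S_m) : seq nat :=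
  epsilon (inhabits [::]) (is_reduced m w).

Definition Tw (A : pzRingType) (T : nat -> A) (m : nat) (w : 'S_m) : A :=
  \prod_(i <- redword m w) T i.
Arguments Tw {A} T {m} w.

Section AK.
Variables (R : comUnitRingType) (A : algType R).

Definition AK_rel (q : R) (Qs : seq R) (m : nat) (T : nat -> A) : Prop :=
  [/\ (0 < m)%N -> \prod_(Qi <- Qs) (T 0%N - Qi%:A) = 0,
      forall i, (0 < i < m)%N -> (T i - q%:A) * (T i + 1) = 0,
      (1 < m)%N -> T 0%N * T 1%N * T 0%N * T 1%N = T 1%N * T 0%N * T 1%N * T 0%N,
      forall i, (0 < i)%N -> (i.+1 < m)%N ->
        T i * T i.+1 * T i = T i.+1 * T i * T i.+1
    & forall i j, (i < m)%N -> (j < m)%N -> (i.+1 < j)%N -> T i * T j = T j * T i].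

(* Jucys--Murphy elements: JM q T k = L_{k+1}; L_1 = T_0, L_{k+1} = q^-1 T_k L_k T_k *)
Fixpoint JM (q : R) (T : nat -> A) (k : nat) : A :=
  match k with
  | 0 => T 0%N
  | k'.+1 => q^-1 *: (T k * JM q T k' * T k)
  end.

Definition Ljm (q : R) (T : nat -> A) (k : nat) : A := JM q T k.-1.

Definition AK_bas (q : R) (s m : nat) (T : nat -> A)
    (x : ({ffun 'I_m -> 'I_s} * 'S_m)%type) : A :=
  (\prod_(j < m) Ljm q T j.+1 ^+ x.1 j) * Tw T x.2.

Definition is_basis (I : finType) (f : I -> A) : Prop :=
  forall y : A, exists! c : {ffun I -> R}, y = \sum_i c i *: f i.

(* (A, T) is (a copy of) the Ariki--Koike algebra H_{s,m}(Qs), s = size Qs: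
   the relations hold and the standard elements form an R-basis (in
   particular the T_i generate A). *)
Definition is_AK (q : R) (Qs : seq R) (m : nat) (T : nat -> A) : Prop :=
  AK_rel q Qs m T /\ is_basis _ (AK_bas q (size Qs) m T).

End AK.
Arguments AK_rel {R A}.
Arguments JM {R A}.
Arguments Ljm {R A}.
Arguments AK_bas {R A}.
Arguments is_basis {R A I}.
Arguments is_AK {R A}.

Definition modp1 (p x : nat) : nat := ((x + p).-1 %% p).+1.

Definition Iset (p i j : nat) : seq nat :=
  let i' := modp1 p i in let j' := modp1 p j in
  if (i' <= j')%N then iota i' (j' - i').+1
  else iota 1 j' ++ iota i' (p - i').+1.

(* composition b = (b_1,...,b_p) given as a sequence; b_t is 1-based *)
Definition bt (b : seq nat) (t : nat) : nat := nth 0%N b t.-1.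
Definition bsum (b : seq nat) (i j : nat) : nat := (\sum_(i <= t < j.+1) bt b t)%N.

Definition wk_word (k a b : nat) : seq nat :=
  flatten (nseq b (rev (iota k.+1 (a + b).-1))).
Definition wk (m k a b : nat) : 'S_m := wprod m (wk_word k a b).
Definition wab (m a b : nat) : 'S_m := wk m 0 a b.

Definition wb (p n : nat) (b : seq nat) : 'S_n :=
  (\prod_(t <- rev (iota 1 p.-1)) wk n (bsum b 1 t.-1) (bt b t) (bsum b t.+1 p))%g.

Section Hrn.
Variables (R : comUnitRingType) (A : algType R).
Variables (p d n : nat) (eps q : R) (Q : seq R) (b : seq nat) (T : nat -> A).

Definition Qr : seq R := flatten [seq [seq eps ^+ k * Qi | Qi <- Q] | k <- iota 1 p].

Definition Lk (k : nat) : A := Ljm q T k.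

Definition Ls (s k : nat) : A := \prod_(Qi <- Q) (Lk k - (eps ^+ s * Qi)%:A).

Definition Lij (i j l m : nat) : A :=
  \prod_(l <= k < m.+1) \prod_(s <- Iset p i j) Ls s k.

Definition Tab (a c : nat) : A := Tw T (wab n a c).

Definition vb : A :=
  (\prod_(t <- rev (iota 2 p.-1)) (Lij 1 t.-1 1 (bt b t) * Tab (bt b t) (bsum b 1 t.-1)))
  * \prod_(t <- iota 2 p.-1) Lij t t 1 (bsum b 1 t.-1).

Definition Yt (t : nat) : A := Lij t.+1 (t + p).-1 1 (bt b t) * Tab (bt b t) (n - bt b t).

Definition Yprod : A := \prod_(t <- rev (iota 1 p)) Yt t.

Definition Tb : A := Tw T (wb p n b).

End Hrn.
Arguments Qr {R}.
Arguments Lk {R A}.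
Arguments Ls {R A}.
Arguments Lij {R A}.
Arguments Tab {R A}.
Arguments vb {R A}.
Arguments Yt {R A}.
Arguments Yprod {R A}.
Arguments Tb {R A}.

(* index set of the standard basis of H_{d,b}: for each factor t (0-based
   t : 'I_p, i.e. factor t+1) a pair (exponents, permutation of S_{b_{t+1}}) *)
Definition bo (p : nat) (b : seq nat) (t : 'I_p) : nat := nth 0%N b t.
Arguments bo {p}.
Definition Hdb_index (p d : nat) (b : seq nat) : finType :=
  {dffun forall t : 'I_p, ({ffun 'I_(bo b t) -> 'I_d} * 'S_(bo b t))%type}.

Section Hdb.
Variables (R : comUnitRingType) (B : algType R).
Variables (p d : nat) (eps q : R) (Q : seq R) (b : seq nat) (G : nat -> nat -> B).
(* G t i = generator T_i of the t-th tensor factor H_{d,b_t}(eps^t Q), t = 1..p *)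

Definition Hdb_bas (x : Hdb_index p d b) : B :=
  \prod_(t < p) AK_bas q d (bo b t) (G t.+1) (x t).

(* (B, G) is (a copy of) H_{d,b} = H_{d,b_1}(eps Q) (x) ... (x) H_{d,b_p}(eps^p Q):
   each factor's relations hold, generators of distinct factors commute,
   and the products of standard basis elements of the factors form an R-basis. *)
Definition is_Hdb : Prop :=
  [/\ forall t, (0 < t <= p)%N -> AK_rel q [seq eps ^+ t * Qi | Qi <- Q] (bt b t) (G t),
      forall t t' i j, (0 < t <= p)%N -> (0 < t' <= p)%N -> t != t' ->
        (i < bt b t)%N -> (j < bt b t')%N -> G t i * G t' j = G t' j * G t i
    & is_basis Hdb_bas].

End Hdb.
Arguments Hdb_bas {R B}.
Arguments is_Hdb {R B}.

Section Theta.
Variables (R : comUnitRingType) (A B : algType R).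
Variables (p d n : nat) (q : R) (b : seq nat) (T : nat -> A) (G : nat -> nat -> B).

Definition xshift (t : 'I_p) (x : 'S_(bo b t)) : 'S_n :=
  wprod n [seq (i + bsum b 1 t)%N | i <- redword (bo b t) x].

Definition xconj (t : 'I_p) (x : 'S_(bo b t)) : 'S_n :=
  ((wb p n b)^-1 * xshift t x * wb p n b)%g.

Definition Theta_bas (x : Hdb_index p d b) : A :=
  (\prod_(t < p) \prod_(j < bo b t) Ljm q T (bsum b t.+2 p + j.+1) ^+ (x t).1 j)
  * \prod_(t < p) Tw T (xconj t (x t).2).

End Theta.
Arguments xshift p n b t x : clear implicits.
Arguments xconj p n b t x : clear implicits.
Arguments Theta_bas {R A}.

(* Main.v *)
Require Import Defs.
From HB Require Import structures.
From mathcomp Require Import all_boot all_order all_fingroup all_algebra.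
From mathcomp Require Import zify.
From Stdlib Require Import ClassicalEpsilon.
Import GRing.Theory.
Local Open Scope ring_scope.
Set Implicit Arguments.
Unset Strict Implicit.
Unset Printing Implicit Defensive.

(** Write L_k for the Jucys-Murphy elements.  The key point is a two-block
    vanishing: if f(L_1) g(L_1) = 0 then
    f(L_1)..f(L_c) T_y g(L_1)..g(L_a) = 0 for every y in S_(a+c) of length
    less than a c, because such a y sends some strand of the first block into
    the second; stripping descents reduces to a y fixing the first strand, which
    commutes with L_1.  Hence L_x f(L_1)..f(L_c) T_(c,a) g(L_1)..g(L_a) is
    f(L_1)..f(L_c) T_(c,a) g(L_1)..g(L_a) L_(w x): all correction terms vanish.
    Since v_b is a product of such two-block elements, this makes v_b intertwine
    the generators of the two embeddings of H_(d,b), so Theta_b defines an action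
    on v_b H, and it gives v_b T_b = Y_p .. Y_1, so that v_b T_b v_b =
    Theta_b(z_b) v_b.  The action is faithful because Theta_b(h) v_b = v_b h',
    and v_b L^a T_x = L^l T_(w x) + lower terms with l and w x determining (a, x);
    here terms T_u with u outside the coset w S_b count as lower, which is
    compatible with the reduction of overflowing powers of L_k since that only
    multiplies u by elements of the stabiliser of a block.  The theorem is then a
    formal computation with e = Theta_b(z_b^-1) v_b T_b. *)

(** Two obstacles shape the development. The missing roots come from the factors of [v_b] further to
    the right, which commute with all generators on the strands of the first [t] blocks. So the
    two-block statements are relative to such a central [z], and intertwining is proved by induction
    on [t] for [vt t * zt t] instead of [vt t]. Second, [Theta] is given only linearly on a basis,
    and [is_Hdb] offers relations and a basis but no universal property. Multiplicativity on [v_b]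
    is obtained by straightening in the product algebra [B * A], where the graph of
    [h |-> Theta h * v] is stable under the paired generators. Cosets enter the order on leading
    terms because the corrections from moving [T_w] past Jucys-Murphy elements have exponents
    controlled only by the bound [p d]; it is their permutations that keep them away from leading
    terms. *)

Local Notation comm := GRing.comm.

(** * Symmetric groups *)

(** Strands are numbered from 0, so [s_i] exchanges the positions [i - 1] and [i]. Acting on all
    naturals avoids ordinals and leaves case analyses to [lia]; for [i = 0] the map is the
    identity. *)
Definition sw (i x : nat) : nat :=
  (if x == i.-1 then i else if x == i then i.-1 else x)%N.

Ltac sw_lia := rewrite /sw; repeat match goal with
  |- context [if (?a == ?b) then _ else _] =>
    lazymatch constr:((a, b)) with
    | context [if _ then _ else _] => fail
    | _ => case: (@eqP _ a b) => ?
    end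
  end; lia.

Section SymmetricGroup.
Local Open Scope nat_scope.

Lemma swK i : 0 < i -> involutive (sw i).
Proof. by move=> ? x; sw_lia. Qed.

Lemma sw_out i x : x != i.-1 -> x != i -> sw i x = x.
Proof. by rewrite /sw => /negbTE -> /negbTE ->. Qed.

Lemma sw_pred i : sw i i.-1 = i.
Proof. by rewrite /sw eqxx. Qed.

Lemma sw_self i : 0 < i -> sw i i = i.-1.
Proof. by move=> ?; sw_lia. Qed.

Lemma sw_comm i j x : 0 < i -> i.+1 < j -> sw j (sw i x) = sw i (sw j x).
Proof.
move=> h1 h2; have [-> | n1] := eqVneq x i.-1.
  by rewrite sw_pred !(@sw_out j) ?sw_pred //; lia.
have [-> | n2] := eqVneq x i; first by rewrite sw_self // !(@sw_out j) ?sw_self //; lia.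
rewrite (@sw_out i x) // (@sw_out i (sw j x)) //; move: n1 n2; sw_lia.
Qed.

Lemma sw_braid i x : 0 < i ->
  sw i (sw i.+1 (sw i x)) = sw i.+1 (sw i (sw i.+1 x)).
Proof.
case: i => // i _; have e1 : sw i.+1 i = i.+1 by sw_lia.
have e2 : sw i.+1 i.+1 = i by sw_lia.
have e3 : sw i.+1 i.+2 = i.+2 by sw_lia.
have e4 : sw i.+2 i = i by sw_lia.
have e5 : sw i.+2 i.+1 = i.+2 by sw_lia.
have e6 : sw i.+2 i.+2 = i.+1 by sw_lia.
have [->|n1] := eqVneq x i; first by rewrite ?(e1, e2, e3, e4, e5, e6).
have [->|n2] := eqVneq x i.+1; first by rewrite ?(e1, e2, e3, e4, e5, e6).
have [->|n3] := eqVneq x i.+2; first by rewrite ?(e1, e2, e3, e4, e5, e6).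
by rewrite !sw_out.
Qed.

Lemma sgenE m i (j : 'I_m) : 0 < i < m -> sgen m i j = sw i j :> nat.
Proof.
case: m j => [|m] j h; first by lia.
rewrite /= h permE /= -!(inj_eq val_inj) /= !inordK; try lia.
by rewrite /sw; case: eqP => _; [|case: eqP => _]; rewrite ?inordK //; lia.
Qed.

Section Pn.
Variable m : nat.
Implicit Types u w : 'S_m.

(** Extension by the identity beyond [m]. Products act from left to right ([pnM]), so a factor
    [sgen m i] on the left changes arguments, and left descents of [w] are read off its values at
    [i - 1] and [i]. *)
Definition pn w (x : nat) : nat :=
  if insub x is Some i then nat_of_ord (w i) else x.

Lemma pnE w (i : 'I_m) : pn w i = w i.
Proof. by rewrite /pn valK. Qed.

Lemma pn_lt w x : (pn w x < m) = (x < m).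
Proof. by rewrite /pn; case: insubP => [i -> _|/negbTE ->//]; rewrite ltn_ord. Qed.

Lemma pn_ge w x : m <= x -> pn w x = x.
Proof. by move=> h; rewrite /pn insubF // ltnNge h. Qed.

Lemma pn_inj w : injective (pn w).
Proof.
move=> x y; rewrite /pn; case: insubP => [i _ <-|hx]; case: insubP => [j _ <-|hy].
- by move/val_inj/perm_inj=> ->.
- by move=> e; move: (ltn_ord (w i)); rewrite e (negbTE hy).
- by move=> e; move: (ltn_ord (w j)); rewrite -e (negbTE hx).
- by [].
Qed.

Lemma pn1 x : pn 1 x = x.
Proof. by rewrite /pn; case: insubP => // i _ <-; rewrite perm1. Qed.

Lemma pnM u w x : pn (u * w)%g x = pn w (pn u x).
Proof.
case: (ltnP x m) => hx; last by rewrite !pn_ge.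
by rewrite -[x]/(nat_of_ord (Ordinal hx)) !pnE permM.
Qed.

Lemma pn_ext u w : (forall x, x < m -> pn u x = pn w x) -> u = w.
Proof. by move=> h; apply/permP => i; apply: val_inj; rewrite /= -!pnE h. Qed.

Lemma pnK w : cancel (pn w) (pn w^-1%g).
Proof. by move=> x; rewrite -pnM mulgV pn1. Qed.

Lemma pnKV w : cancel (pn w^-1%g) (pn w).
Proof. by move=> x; rewrite -pnM mulVg pn1. Qed.

Lemma pn_sgen i x : 0 < i < m -> pn (sgen m i) x = sw i x.
Proof.
move=> h; rewrite /pn; case: insubP => [j hj <-|hx]; first exact: sgenE.
by sw_lia.
Qed.

Lemma sgen_out i : ~~ (0 < i < m) -> sgen m i = 1%g.
Proof. by case: m => [//|m'] /= /negbTE ->. Qed.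

Lemma sgenK i : (sgen m i * sgen m i)%g = 1%g.
Proof.
case: m => [|m'] /=; first by rewrite mulg1.
by case: ifP => _; rewrite ?tperm2 ?mulg1.
Qed.

Lemma sgenKl i w : (sgen m i * (sgen m i * w))%g = w.
Proof. by rewrite mulgA sgenK mul1g. Qed.

Lemma sgenV i : (sgen m i)^-1%g = sgen m i.
Proof. by apply: (mulgI (sgen m i)); rewrite mulgV sgenK. Qed.

Definition invs w : {set 'I_m * 'I_m} :=
  [set z : 'I_m * 'I_m | (z.1 < z.2) && (w z.2 < w z.1)].
Definition len w := #|invs w|.

(** Transport of pairs along [s_i] matches the inversions of [w] with those of [s_i w], except for
    the pair [(i-1, i)]: it is the only one whose order [s_i] reverses. *)
Lemma len_sgen w i : 0 < i < m -> pn w i.-1 < pn w i ->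
  len (sgen m i * w)%g = (len w).+1.
Proof.
move=> hi hlt.
have h1 : i.-1 < m by lia.
have h2 : i < m by lia.
pose x0 := Ordinal h1; pose y0 := Ordinal h2.
pose s := sgen m i; pose f (z : 'I_m * 'I_m) := (s z.1, s z.2).
have sK : involutive s by move=> x; rewrite -permM sgenK perm1.
have fK : involutive f by case=> x y; rewrite /f /= !sK.
have hs (x : 'I_m) : s x = sw i x :> nat by rewrite -pnE pn_sgen.
have w0 : w x0 < w y0 by rewrite -!pnE.
rewrite {1}/len; have -> : len w = #|f @^-1: invs w|.
  by rewrite card_preimset //; apply: inv_inj.
have -> : invs (s * w)%g = (x0, y0) |: f @^-1: invs w.
  apply/setP => -[x y]; rewrite !inE /= !permM xpair_eqE.
  case: (altP (x =P x0)) => [->|nx]; case: (altP (y =P y0)) => [->|ny] /=.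
  - have -> : s y0 = x0 by apply: val_inj; rewrite /= hs /=; sw_lia.
    have -> : s x0 = y0 by apply: val_inj; rewrite /= hs /=; sw_lia.
    by rewrite w0 /=; lia.
  - apply: andb_id2r => _; rewrite !hs; move: ny; rewrite -(inj_eq val_inj) /= => ?.
    by sw_lia.
  - apply: andb_id2r => _; rewrite !hs; move: nx; rewrite -(inj_eq val_inj) /= => ?.
    by sw_lia.
  case: (altP (x =P y0)) => [->|nx']; case: (altP (y =P x0)) => [->|ny'] /=.
  - have -> : s y0 = x0 by apply: val_inj; rewrite /= hs /=; sw_lia.
    have -> : s x0 = y0 by apply: val_inj; rewrite /= hs /=; sw_lia.
    by rewrite /=; lia.
  1-3: apply: andb_id2r => _; rewrite !hs; move: nx ny; rewrite -!(inj_eq val_inj) /= => nx ny;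
    try (move: nx'; rewrite -!(inj_eq val_inj) /= => nx');
    try (move: ny'; rewrite -!(inj_eq val_inj) /= => ny');
    by sw_lia.
rewrite cardsU1 !inE /=.
have -> : s y0 = x0 by apply: val_inj; rewrite /= hs /=; sw_lia.
have -> : s x0 = y0 by apply: val_inj; rewrite /= hs /=; sw_lia.
by have -> : (y0 < x0) = false by rewrite /=; lia.
Qed.

Lemma pn_sgenM i w x : 0 < i < m -> pn (sgen m i * w)%g x = pn w (sw i x).
Proof. by move=> h; rewrite pnM pn_sgen. Qed.

Lemma len_sgen_gt w i : 0 < i < m -> pn w i < pn w i.-1 ->
  len w = (len (sgen m i * w)%g).+1.
Proof.
move=> h hlt; rewrite -(@len_sgen (sgen m i * w)%g i) ?sgenKl //.
by rewrite !pn_sgenM // sw_pred sw_self //; lia.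
Qed.

Lemma len1 : len 1%g = 0.
Proof.
by apply/eqP; rewrite cards_eq0; apply/eqP/setP => -[x y]; rewrite !inE /= !perm1; lia.
Qed.

(** Without descents [w] is increasing, so each value is bounded by its argument from below and from
    above. *)
Lemma descent w : w != 1%g -> exists2 i, 0 < i < m & pn w i < pn w i.-1.
Proof.
move=> w1; case: (pickP (fun i : 'I_m => (0 < i) && (pn w i < pn w i.-1))) => [i /andP[a b]|h].
  by exists i => //; rewrite a ltn_ord.
case/eqP: w1; apply: pn_ext => x hx; rewrite pn1.
have mono i : 0 < i < m -> pn w i.-1 < pn w i.
  case/andP=> i0 im; have := h (Ordinal im); rewrite /= i0 /= => /negbT.
  rewrite -leqNgt leq_eqVlt => /orP[/eqP/pn_inj|//]; lia.
have ge k : k < m -> k <= pn w k.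
  elim: k => // k IH hk; have := mono k.+1 hk; have := IH (ltnW hk); rewrite /=; lia.
have le k : k < m -> pn w (m.-1 - k) <= m.-1 - k.
  elim: k => [|k IH] hk.
    have := pn_lt w (m.-1 - 0); lia.
  have h1 := IH (ltnW hk).
  have := mono (m.-1 - k); have -> : (m.-1 - k).-1 = m.-1 - k.+1 by lia.
  lia.
have := ge x hx; have := le (m.-1 - x); have -> : m.-1 - (m.-1 - x) = x by lia.
lia.
Qed.

Lemma lenV w : len w^-1%g = len w.
Proof.
pose f (z : 'I_m * 'I_m) := (w z.2, w z.1).
have fI : injective f by case=> a b [c d] [] /perm_inj -> /perm_inj ->.
rewrite /len -(card_imset (mem (invs w)) fI); apply: eq_card => -[x y].
apply/idP/imsetP => [|[[a b] h [-> ->]]].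
  rewrite !inE /= => /andP[h1 h2]; exists (w^-1%g y, w^-1%g x); last by rewrite /f /= !permKV.
  by rewrite !inE /= !permKV h1 h2.
by move: h; rewrite !inE /= !permK => /andP[-> ->].
Qed.

Lemma leq_len_sgen w i : len (sgen m i * w)%g <= (len w).+1.
Proof.
case: (boolP (0 < i < m)) => hi; last by rewrite sgen_out // mul1g.
case: (ltngtP (pn w i.-1) (pn w i)) => h; first by rewrite len_sgen.
  by rewrite (len_sgen_gt hi h); lia.
by move/pn_inj: h; lia.
Qed.

Lemma wprod_cat s t : wprod m (s ++ t) = (wprod m s * wprod m t)%g.
Proof. by elim: s => [|i s IH] /=; rewrite ?mul1g // IH mulgA. Qed.

Lemma leq_len_wprod s : len (wprod m s) <= size s.
Proof.
elim: s => [|i s IH] /=; first by rewrite len1.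
by apply: leq_trans (leq_len_sgen _ _) _.
Qed.

Definition vword s := all (fun i => 0 < i < m) s.
(** Reducedness measured by counting inversions, which can be checked letter by letter
    ([rword_cons]). [is_reduced_rword] and [rword_is_reduced] tie it to the minimality by which
    [redword] is chosen. *)
Definition rword s := vword s && (size s == len (wprod m s)).

Lemma rword_vword s : rword s -> vword s.
Proof. by case/andP. Qed.

Lemma rword_cons i s :
  rword (i :: s) = [&& 0 < i < m, rword s & pn (wprod m s) i.-1 < pn (wprod m s) i].
Proof.
rewrite /rword /=; case: (boolP (0 < i < m)) => //= hi; case: (vword s) => //=.
case: (ltngtP (pn (wprod m s) i.-1) (pn (wprod m s) i)) => h.
- by rewrite len_sgen // eqSS andbT.
- rewrite andbF; have := len_sgen_gt hi h; have := leq_len_wprod s; lia.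
- by move/pn_inj: h; lia.
Qed.

Lemma ex_rword w : exists2 s, rword s & wprod m s = w.
Proof.
elim: {w}_.+1 {-2}w (ltnSn (len w)) => // k IH w hk.
case: (eqVneq w 1%g) => [->|/descent[i hi hd]].
  by exists [::] => //; rewrite /rword /= len1.
have hl := len_sgen_gt hi hd.
have /IH [s rs es] : len (sgen m i * w)%g < k by lia.
exists (i :: s); last by rewrite /= es sgenKl.
by rewrite rword_cons hi rs es /= !pn_sgenM // sw_pred sw_self //; lia.
Qed.

Lemma wprod_vword s : wprod m [seq i <- s | 0 < i < m] = wprod m s.
Proof.
by elim: s => //= i s IH; case: ifPn => hi /=; rewrite IH // sgen_out // mul1g.
Qed.

Lemma is_reduced_rword w s : is_reduced m w s -> rword s /\ wprod m s = w.
Proof.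
case=> ws hs; split=> //; have [s' /andP[vs' /eqP rs'] es'] := ex_rword w.
rewrite /rword ws -es' -rs' eqn_leq hs //= rs' es' -ws leq_len_wprod andbT.
(* Letters outside [0 < i < m] denote the identity, so a word of minimal length contains none. *)
have := hs _ (etrans (wprod_vword s) ws); rewrite size_filter.
by rewrite /vword all_count eqn_leq count_size => ->.
Qed.

Lemma rword_is_reduced s : rword s -> is_reduced m (wprod m s) s.
Proof.
by case/andP=> _ /eqP hs; split=> // s' e; rewrite hs -e leq_len_wprod.
Qed.

Lemma redwordP w : rword (redword m w) /\ wprod m (redword m w) = w.
Proof.
apply: is_reduced_rword; apply: (epsilon_spec (inhabits [::]) (is_reduced m w)).
by have [s rs ew] := ex_rword w; subst w; exists s; apply: rword_is_reduced.
Qed.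

Lemma rword_rcons s i :
  0 < i < m -> rword s -> pn (wprod m s)^-1%g i.-1 < pn (wprod m s)^-1%g i ->
  rword (rcons s i).
Proof.
move=> hi /andP[vs /eqP es] h; rewrite /rword /vword all_rcons hi [all _ _]vs /=.
rewrite -cats1 wprod_cat /= mulg1 size_cat /= addn1 es -(lenV (_ * _)%g).
by rewrite invMg sgenV len_sgen // lenV.
Qed.

End Pn.

End SymmetricGroup.

Definition tprod (A : pzRingType) (T : nat -> A) (s : seq nat) : A :=
  \prod_(i <- s) T i.

(** * Matsumoto's theorem and products of adding length *)

Section Matsumoto.
Variables (A : pzRingType) (T : nat -> A) (m : nat).
Hypothesis braid : forall i, (0 < i)%N -> (i.+1 < m)%N ->
  T i * T i.+1 * T i = T i.+1 * T i * T i.+1.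
Hypothesis comm : forall i j, (0 < i)%N -> (j < m)%N -> (i.+1 < j)%N -> T i * T j = T j * T i.

Lemma tprod_cons i s : tprod T (i :: s) = T i * tprod T s.
Proof. by rewrite /tprod big_cons. Qed.

Lemma tprod_cat s t : tprod T (s ++ t) = tprod T s * tprod T t.
Proof. by rewrite /tprod big_cat. Qed.

(** Induction on the length. If the first letters differ, both are left descents of the same [w], so
    [w] has reduced words beginning with either side of the commutation or braid relation between
    them; the induction hypothesis applies to both tails. *)
Lemma matsumoto s s' : rword m s -> rword m s' -> wprod m s = wprod m s' ->
  tprod T s = tprod T s'.
Proof.
elim: {s}_.+1 {-2}s (ltnSn (size s)) s' => // k IH.
have IH2 s s' : (size s < k)%N -> rword m s -> rword m s' ->
    wprod m s = wprod m s' -> tprod T s = tprod T s' by move=> h1 h2 h3; exact: IH.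
move=> s hs s' rs rs' e.
have: size s = size s'.
  by case/andP: rs => _ /eqP ->; case/andP: rs' => _ /eqP ->; rewrite e.
case: s hs rs e => [|i s] hs rs e; case: s' rs' e => [|j s'] // rs' e.
move=> [] hss.
have [ij|nij] := eqVneq i j.
  subst j; rewrite !tprod_cons; congr (_ * _); move: rs rs'; rewrite !rword_cons.
  move=> /and3P[_ r1 _] /and3P[_ r2 _]; apply: IH2 => //.
  by move: e => /= /mulgI.
wlog lij : i j s s' hs hss rs rs' e nij / (i < j)%N => [hw|].
  case: (ltngtP i j) => h; [exact: hw| |by rewrite h eqxx in nij].
  symmetry; apply: (hw j i s' s) => //; last by rewrite eq_sym.
  by rewrite /= -hss.
clear nij; have := rs; have := rs'; rewrite !rword_cons.
move=> /and3P[hj rs1' dj] /and3P[hi rs1 di].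
have [w ew] : exists w, w = wprod m (i :: s) by exists (wprod m (i :: s)).
have es : wprod m s = (sgen m i * w)%g by rewrite ew /= sgenKl.
have es' : wprod m s' = (sgen m j * w)%g by rewrite ew e /= sgenKl.
move: di dj; rewrite es es' !pn_sgenM // !sw_pred !sw_self; try lia.
move=> di dj.
have [ij2|ij1] := ltnP i.+1 j.
  have [s2 r2 e2] := ex_rword (sgen m j * (sgen m i * w))%g.
  have cw : (sgen m i * (sgen m j * w) = sgen m j * (sgen m i * w))%g.
    by apply: pn_ext => x _; rewrite !pn_sgenM // sw_comm //; lia.
  have hj2 : sw i j = j /\ sw i j.-1 = j.-1 by split; sw_lia.
  have hi2 : sw j i = i /\ sw j i.-1 = i.-1 by split; sw_lia.
  have rj : rword m (j :: s2).
    rewrite rword_cons hj r2 e2 /= !pn_sgenM // sw_pred sw_self; last by lia.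
    by case: hj2 => -> ->.
  have ri : rword m (i :: s2).
    rewrite rword_cons hi r2 e2 /= -cw !pn_sgenM // sw_pred sw_self; last by lia.
    by case: hi2 => -> ->.
  rewrite tprod_cons (IH2 s (j :: s2)) //; last by rewrite /= e2 sgenKl es.
  rewrite (tprod_cons j s') (IH2 s' (i :: s2)) -?hss //; last by rewrite /= e2 -cw sgenKl es'.
  by rewrite !tprod_cons !mulrA comm //; lia.
have ? : j = i.+1 by lia.
subst j.
have [s3 r3 e3] := ex_rword (sgen m i * (sgen m i.+1 * (sgen m i * w)))%g.
have bw : (sgen m i * (sgen m i.+1 * (sgen m i * w)) =
           sgen m i.+1 * (sgen m i * (sgen m i.+1 * w)))%g.
  by apply: pn_ext => x _; rewrite !pn_sgenM // sw_braid //; lia.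
move: dj di => /= dj di.
have q1 : sw i i.+1 = i.+1 by sw_lia.
have q2 : sw i.+1 i.-1 = i.-1 by sw_lia.
have q3 : sw i i = i.-1 by sw_lia.
have q4 : sw i i.-1 = i by sw_lia.
have q5 : sw i.+1 i = i.+1 by sw_lia.
have q6 : sw i.+1 i.+1 = i by sw_lia.
have rij : rword m [:: i, i.+1 & s3].
  rewrite !rword_cons hi hj r3 /= e3 bw sgenKl !pn_sgenM //=.
  rewrite ?(q1,q2,q3,q4,q5,q6).
  by rewrite di (ltn_trans dj di).
have rji : rword m [:: i.+1, i & s3].
  rewrite !rword_cons hi hj r3 /= e3 sgenKl !pn_sgenM //=.
  by rewrite ?(q1,q2,q3,q4,q5,q6) dj (ltn_trans dj di).
rewrite tprod_cons (IH2 s [:: i.+1, i & s3]) //; last by rewrite /= e3 !sgenKl es.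
rewrite (tprod_cons i.+1 s') (IH2 s' [:: i, i.+1 & s3]) -?hss //; last first.
  by rewrite /= e3 bw !sgenKl es'.
by rewrite !tprod_cons !mulrA braid //; lia.
Qed.

Lemma Tw_word s : rword m s -> Tw T (wprod m s) = tprod T s.
Proof. by move=> rs; have [r1 e1] := redwordP (wprod m s); apply: matsumoto. Qed.

Lemma Tw1 : Tw T (1%g : 'S_m) = 1.
Proof.
have -> : 1%g = wprod m [::] by [].
by rewrite Tw_word /tprod ?big_nil // /rword /= len1.
Qed.

Lemma TwS i (w : 'S_m) : (0 < i < m)%N -> (pn w i.-1 < pn w i)%N ->
  Tw T (sgen m i * w)%g = T i * Tw T w.
Proof.
have [s rs <-] := ex_rword w => hi h.
by rewrite -[(_ * _)%g]/(wprod m (i :: s)) !Tw_word ?tprod_cons // rword_cons hi rs.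
Qed.

Lemma TwSr i (w : 'S_m) : (0 < i < m)%N -> (pn w^-1%g i.-1 < pn w^-1%g i)%N ->
  Tw T (w * sgen m i)%g = Tw T w * T i.
Proof.
have [s rs <-] := ex_rword w => hi h.
have -> : (wprod m s * sgen m i)%g = wprod m (rcons s i).
  by rewrite -cats1 wprod_cat /= mulg1.
by rewrite !Tw_word ?rword_rcons // -cats1 tprod_cat /tprod big_seq1.
Qed.

(* The inversions of [u] must not be undone by [v]; then the lengths add up. *)
Lemma TwM (u v : 'S_m) :
  (forall x y, (x < y < m)%N -> (pn u y < pn u x)%N ->
     (pn v (pn u y) < pn v (pn u x))%N) ->
  Tw T (u * v)%g = Tw T u * Tw T v.
Proof.
elim: {u}_.+1 {-2}u (ltnSn (len u)) v => // k IH u hk v h.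
have [->|n1] := eqVneq u 1%g; first by rewrite mul1g Tw1 mul1r.
(* A right descent of [u]: the last letter of a reduced word of [u] is handed over to [v], and the
   hypothesis for the corresponding inversion says that [v] becomes longer. *)
have [i hi hd] : exists2 i, (0 < i < m)%N & (pn u^-1%g i < pn u^-1%g i.-1)%N.
  by apply: descent; rewrite eq_invg1.
pose u' := (u * sgen m i)%g.
have eu : u = (u' * sgen m i)%g by rewrite /u' -mulgA sgenK mulg1.
have pu' x : pn u' x = sw i (pn u x) by rewrite /u' pnM pn_sgen.
have u'V x : pn u'^-1%g x = pn u^-1%g (sw i x) by rewrite /u' invMg sgenV pn_sgenM.
have lu : len u = (len u').+1 by rewrite -lenV (len_sgen_gt hi hd) /u' -(lenV (u * _)%g) invMg sgenV.
have Tu : Tw T u = Tw T u' * T i.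
  by rewrite {1}eu TwSr // !u'V sw_pred sw_self //; lia.
have vi : (pn v i.-1 < pn v i)%N.
  have := h (pn u^-1%g i) (pn u^-1%g i.-1); rewrite !pnKV; apply; last by lia.
  by rewrite hd pn_lt; lia.
rewrite {1}eu -mulgA IH; last 2 first.
- by move: hk; rewrite lu; lia.
- move=> x y xy; rewrite !pu' !pn_sgenM // !swK; try lia.
  move=> hlt; apply: h => //.
  have [e|e] := eqVneq (pn u y) i; last first.
    by move: hlt e; sw_lia.
  move: hlt; rewrite e sw_self; last by lia.
  have nx : pn u x != i by rewrite -e; apply/eqP => /pn_inj; lia.
  have nx2 : pn u x != i.-1.
    apply/eqP => e2; move: hd; have -> : pn u^-1%g i = y by rewrite -e pnK.
    by rewrite -e2 pnK; lia.
  by move: nx nx2; sw_lia.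
by rewrite Tu -mulrA TwS.
Qed.
End Matsumoto.

(** * Affine Hecke relations *)

Section Comm.
Variables (R : comUnitRingType) (A : algType R).
Implicit Types x y z : A.

Lemma commrZ x y (a : R) : comm x y -> comm x (a *: y).
Proof. by rewrite /comm => e; rewrite -scalerAr -scalerAl e. Qed.

Lemma commr_scal x (a : R) : comm x a%:A.
Proof. exact/commrZ/commr1. Qed.

Lemma commr_prod_seq (I : eqType) (s : seq I) (F : I -> A) x :
  (forall i, i \in s -> comm x (F i)) -> comm x (\prod_(i <- s) F i).
Proof.
move=> h; rewrite big_seq; elim/big_ind: _ => //; first exact: commr1.
by move=> a b; apply: commrM.
Qed.

Definition ev (rs : seq R) x : A := \prod_(r <- rs) (x - r%:A).

Lemma ev_cons r rs x : ev (r :: rs) x = (x - r%:A) * ev rs x.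
Proof. by rewrite /ev big_cons. Qed.

Lemma ev_cat rs1 rs2 x : ev (rs1 ++ rs2) x = ev rs1 x * ev rs2 x.
Proof. by rewrite /ev big_cat. Qed.

Lemma ev_intertw rs x x' y : x * y = y * x' -> ev rs x * y = y * ev rs x'.
Proof.
move=> h; elim: rs => [|r rs IH]; first by rewrite /ev !big_nil mul1r mulr1.
rewrite !ev_cons -mulrA IH !mulrA; congr (_ * _).
by rewrite mulrBl mulrBr h (commr_scal y r).
Qed.

Lemma comm_ev rs x y : comm y x -> comm y (ev rs x).
Proof. by move=> h; symmetry; apply: ev_intertw. Qed.

Lemma ev_perm rs1 rs2 x : perm_eq rs1 rs2 -> ev rs1 x = ev rs2 x.
Proof.
have cx (a b : R) : comm (x - a%:A) (x - b%:A).
  by apply: commrB; [apply/commr_sym/commrB | apply: commr_scal]; rewrite // /comm; apply: commr_scal.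
have cf rs r : (x - r%:A) * ev rs x = ev rs x * (x - r%:A).
  by apply: commr_prod_seq => i _; apply: cx.
elim: rs1 rs2 => [|r rs1 IH] rs2 hp.
  by move: hp; rewrite perm_sym => /perm_nilP ->.
have hr : r \in rs2 by rewrite -(perm_mem hp) mem_head.
case/splitPr: hr hp => s1 s2 hp.
rewrite ev_cat !ev_cons mulrA -cf -mulrA -ev_cat; congr (_ * _); apply: IH.
by rewrite -(perm_cons r) (perm_trans hp) // (perm_catCA s1 [:: r] s2).
Qed.
End Comm.

Section Affine.
Variables (R : comUnitRingType) (A : algType R) (q : R).
(** [AK_rel] without the order relation for [T 0]. These relations also hold for shifted copies on
    other strands and componentwise in a product of algebras, where the order relation is available
    only on a submodule or after a further factor. *)
Definition affine (m : nat) (T : nat -> A) : Prop :=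
  [/\ forall i, (0 < i < m)%N -> (T i - q%:A) * (T i + 1) = 0,
      (1 < m)%N -> T 0%N * T 1%N * T 0%N * T 1%N = T 1%N * T 0%N * T 1%N * T 0%N,
      forall i, (0 < i)%N -> (i.+1 < m)%N ->
        T i * T i.+1 * T i = T i.+1 * T i * T i.+1
    & forall i j, (i < m)%N -> (j < m)%N -> (i.+1 < j)%N -> T i * T j = T j * T i].

Variables (m : nat) (T : nat -> A).
Hypothesis hT : affine m T.
Local Notation J := (JM q T).

Lemma affine_sub m' : (m' <= m)%N -> affine m' T.
Proof. by case: hT => h1 h2 h3 h4 h; split; intros; auto; (apply: h1 || apply: h2 || apply: h3 || apply: h4); lia. Qed.

Lemma Tbraid i : (0 < i)%N -> (i.+1 < m)%N ->
  T i * T i.+1 * T i = T i.+1 * T i * T i.+1.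
Proof. by case: hT => _ _ h _; apply: h. Qed.

Lemma Tcomm i j : (i < m)%N -> (j < m)%N -> (i.+1 < j)%N -> T i * T j = T j * T i.
Proof. by case: hT => _ _ _; apply. Qed.

Lemma Tcomm' i j : (0 < i)%N -> (j < m)%N -> (i.+1 < j)%N -> T i * T j = T j * T i.
Proof. by move=> *; apply: Tcomm => //; lia. Qed.

Lemma Tquad i : (0 < i < m)%N -> T i * T i = (q - 1) *: T i + q%:A.
Proof.
case: hT => h _ _ _ /h; rewrite mulrDr mulr1 mulrBl mulr_algl => e.
apply/eqP; rewrite -subr_eq0 -e; apply/eqP.
by rewrite scalerBl scale1r !opprD !opprK !addrA.
Qed.

Lemma JS k : J k.+1 = q^-1 *: (T k.+1 * J k * T k.+1).
Proof. by []. Qed.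

Lemma TJlt i k : (k.+1 < i < m)%N -> comm (T i) (J k).
Proof.
elim: k => [|k IH] h; first by apply/commr_sym/Tcomm; lia.
rewrite JS; apply/commrZ/commrM; last by apply/commr_sym/Tcomm; lia.
apply: commrM; first by apply/commr_sym/Tcomm; lia.
by apply: IH; lia.
Qed.

Lemma T0J k : (k < m)%N -> comm (T 0%N) (J k).
Proof.
case: k => [|k hk]; first by [].
elim: k hk => [|k IH] hk.
  rewrite JS; apply/commrZ; rewrite /comm /= !mulrA.
  by case: hT => _ h _ _; rewrite h.
rewrite JS; apply/commrZ/commrM; last by apply: Tcomm; lia.
by apply: commrM; [apply: Tcomm; lia | apply: IH; lia].
Qed.

(** Only the top index needs an argument: two Jucys-Murphy steps are unfolded, and a braid relation
    on each side carries [T i] across, since [T i.+1] commutes with [J i.-1]. *)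
Lemma TJgt i k : (0 < i < k)%N -> (k < m)%N -> comm (T i) (J k).
Proof.
elim: k => [|k IH] h hk; first by lia.
rewrite JS; apply: commrZ.
have [lik|] := ltnP i k.
  apply: commrM; last by apply: Tcomm; lia.
  by apply: commrM; [apply: Tcomm; lia | apply: IH; lia].
move=> lki; have eik : i = k by lia.
subst k; clear IH lki.
case: i h hk => // i h hk; rewrite JS /= -scalerAr -scalerAl; apply: commrZ.
rewrite /comm !mulrA Tbraid //.
have c1 : T i.+2 * J i = J i * T i.+2 by apply: TJlt; lia.
have b : T i.+2 * T i.+1 * T i.+2 = T i.+1 * T i.+2 * T i.+1 by rewrite Tbraid.
rewrite -(mulrA _ (T i.+2) (J i)) c1 mulrA.
by rewrite -(mulrA _ (T i.+2) (T i.+1)) -(mulrA _ (_ * _) (T i.+2)) b !mulrA.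
Qed.

Lemma TJ_comm i k : (i < m)%N -> (k < m)%N -> k != i -> k != i.-1 -> comm (T i) (J k).
Proof.
case: i => [|i] hi hk n1 n2; first exact: T0J.
by have [?|?] := ltnP k i.+1; [apply: TJlt | apply: TJgt]; move: n1 n2; rewrite /=; lia.
Qed.

Definition central_upto k (y : A) := forall i, (i < k)%N -> comm y (T i).
(* the elements of the subalgebra generated by [T_0, ..., T_{k-1}], through their bicommutant *)
Definition in_gens k (x : A) := forall y, central_upto k y -> comm y x.

Lemma in_gensT k i : (i < k)%N -> in_gens k (T i).
Proof. by move=> h y; apply. Qed.

Lemma in_gensM k x y : in_gens k x -> in_gens k y -> in_gens k (x * y).
Proof. by move=> hx hy z hz; apply: commrM; [apply: hx | apply: hy]. Qed.

Lemma in_gensW k l x : (k <= l)%N -> in_gens k x -> in_gens l x.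
Proof. by move=> kl hx y hy; apply: hx => i hi; apply: hy; lia. Qed.

Lemma in_gens_prod k (I : eqType) (s : seq I) (F : I -> A) :
  (forall i, i \in s -> in_gens k (F i)) -> in_gens k (\prod_(i <- s) F i).
Proof. by move=> h y hy; apply: commr_prod_seq => i /h; apply. Qed.

Lemma in_gensJ k i : (i < k)%N -> in_gens k (J i).
Proof.
elim: i => [|i IH] h; first exact: in_gensT.
have h1 : in_gens k (T i.+1) by apply: in_gensT.
have h2 : in_gens k (J i) by apply: IH; lia.
by move=> y hy; rewrite JS; apply/commrZ/commrM; [apply: commrM|]; auto.
Qed.

Lemma in_gens_ev k rs x : in_gens k x -> in_gens k (ev rs x).
Proof. by move=> hx y hy; apply/comm_ev/hx. Qed.

Lemma central_J k : (k < m)%N -> central_upto k (J k).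
Proof.
move=> hk [|i] hi; first by apply/commr_sym/T0J.
by apply/commr_sym/TJgt; lia.
Qed.

(** The later of the two commutes with all generators that build the earlier one. *)
Lemma JJ j k : (j < m)%N -> (k < m)%N -> comm (J j) (J k).
Proof.
move=> hj hk; case: (ltngtP j k) => [h|h|->//].
  by apply/commr_sym; apply: (in_gensJ h); apply: central_J.
by apply: (in_gensJ h); apply: central_J.
Qed.

Definition Fm (rs : seq R) (k : nat) : A := \prod_(0 <= j < k) ev rs (J j).

Lemma FmE rs k : Fm rs k = \prod_(0 <= j < k) ev rs (J j).
Proof. by []. Qed.

Lemma FmS rs k : Fm rs k.+1 = Fm rs k * ev rs (J k).
Proof. by rewrite /Fm big_nat_recr. Qed.

Lemma Fm0 rs : Fm rs 0 = 1.
Proof. by rewrite /Fm big_nil. Qed.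

Lemma comm_Fm rs k x : (forall j, (j < k)%N -> comm x (J j)) -> comm x (Fm rs k).
Proof.
move=> h; apply: commr_prod_seq => j; rewrite mem_index_iota => /andP[_ hj].
by apply/comm_ev/h.
Qed.

Lemma comm_FmJ rs k j : (k <= m)%N -> (j < m)%N -> comm (J j) (Fm rs k).
Proof. by move=> hk hj; apply: comm_Fm => i hi; apply: JJ => //; lia. Qed.

Lemma comm_FmFm rs rs' k k' : (k <= m)%N -> (k' <= m)%N -> comm (Fm rs k) (Fm rs' k').
Proof. by move=> hk hk'; apply: comm_Fm => j hj; apply/commr_sym/comm_FmJ; lia. Qed.

Lemma in_gensFm rs k : in_gens k (Fm rs k).
Proof.
apply: in_gens_prod => j; rewrite mem_index_iota => /andP[_ hj].
by apply: in_gens_ev; apply: in_gensJ.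
Qed.

Lemma Fm_cat rs1 rs2 k : (k <= m)%N -> Fm (rs1 ++ rs2) k = Fm rs1 k * Fm rs2 k.
Proof.
elim: k => [|k IH] hk; first by rewrite !Fm0 mulr1.
rewrite !FmS IH ?ev_cat; last by lia.
rewrite -!mulrA; congr (_ * _); rewrite !mulrA; congr (_ * _).
by apply: comm_ev; apply/commr_sym/comm_FmJ; lia.
Qed.

(** Isolates the factor at the first strand, the place where an order relation for [T 0] can be
    applied. *)
Lemma Fm_recl rs k : (0 < k)%N -> (k <= m)%N ->
  exists2 r, Fm rs k = r * ev rs (T 0%N) & comm (T 0%N) r.
Proof.
move=> k0 km; have c0 : comm (T 0%N) (\prod_(1 <= j < k) ev rs (J j)).
  apply: commr_prod_seq => j; rewrite mem_index_iota => hj.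
  by apply/comm_ev/T0J; lia.
exists (\prod_(1 <= j < k) ev rs (J j)) => //; rewrite /Fm big_ltn //.
exact/commr_sym/comm_ev/commr_sym.
Qed.

(** * The standard elements [T_w] *)

Lemma affTwS i (w : 'S_m) : (0 < i < m)%N -> (pn w i.-1 < pn w i)%N ->
  Tw T (sgen m i * w)%g = T i * Tw T w.
Proof. exact: (TwS Tbraid Tcomm'). Qed.

Lemma affTwSr i (w : 'S_m) : (0 < i < m)%N -> (pn w^-1%g i.-1 < pn w^-1%g i)%N ->
  Tw T (w * sgen m i)%g = Tw T w * T i.
Proof. exact: (TwSr Tbraid Tcomm'). Qed.

Lemma affTw_word s : rword m s -> Tw T (wprod m s) = tprod T s.
Proof. exact: (Tw_word Tbraid Tcomm'). Qed.

Lemma affTwM (u v : 'S_m) :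
  (forall x y, (x < y < m)%N -> (pn u y < pn u x)%N ->
     (pn v (pn u y) < pn v (pn u x))%N) ->
  Tw T (u * v)%g = Tw T u * Tw T v.
Proof. exact: (TwM Tbraid Tcomm'). Qed.

Lemma affTw1 : Tw T (1%g : 'S_m) = 1.
Proof. exact: (Tw1 Tbraid Tcomm'). Qed.

Lemma TTw i (w : 'S_m) : (0 < i < m)%N ->
  T i * Tw T w = Tw T (sgen m i * w)%g \/
  T i * Tw T w = q *: Tw T (sgen m i * w)%g + (q - 1) *: Tw T w.
Proof.
move=> hi; case: (ltngtP (pn w i.-1) (pn w i)) => h; last by move/pn_inj: h; lia.
  by left; rewrite affTwS.
right; have e : Tw T w = T i * Tw T (sgen m i * w)%g.
  by rewrite -affTwS ?sgenKl // !pn_sgenM // sw_pred sw_self //; lia.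
by rewrite {1}e mulrA Tquad // mulrDl mulr_algl -scalerAl -e addrC.
Qed.

Lemma TwT i (w : 'S_m) : (0 < i < m)%N ->
  Tw T w * T i = Tw T (w * sgen m i)%g \/
  Tw T w * T i = q *: Tw T (w * sgen m i)%g + (q - 1) *: Tw T w.
Proof.
move=> hi; case: (ltngtP (pn w^-1%g i.-1) (pn w^-1%g i)) => h; last by move/pn_inj: h; lia.
  by left; rewrite affTwSr.
right; have e : Tw T w = Tw T (w * sgen m i)%g * T i.
  rewrite -affTwSr //; first by rewrite -mulgA sgenK mulg1.
  by rewrite invMg sgenV !pn_sgenM // sw_pred sw_self //; lia.
by rewrite {1}e -mulrA Tquad // mulrDr mulr_algr -scalerAr -e addrC.
Qed.

Hypothesis hq : q \is a GRing.unit.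

Lemma TJself i : (0 < i < m)%N -> T i * J i = J i.-1 * T i + (q - 1) *: J i.
Proof.
case: i => // i hi; rewrite JS /= -scalerAr !mulrA Tquad // !mulrDl scalerDr addrC.
congr (_ + _); first by rewrite mulr_algl -scalerAl scalerA mulVr // scale1r.
by rewrite -!scalerAl !scalerA mulrC.
Qed.

Lemma TJpred i : (0 < i < m)%N -> T i * J i.-1 = J i * T i - (q - 1) *: J i.
Proof.
case: i => // i hi; rewrite JS /= -scalerAl -!mulrA Tquad // !mulrDr scalerDr.
apply/eqP; rewrite eq_sym subr_eq addrC; apply/eqP; congr (_ + _).
  by rewrite mulr_algr -!scalerAr !scalerA mulVr // scale1r.
by rewrite -!scalerAr !scalerA mulrC.
Qed.

Lemma comm_T_evJ2 rs i : (0 < i < m)%N -> comm (T i) (ev rs (J i.-1) * ev rs (J i)).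
Proof.
move=> hi; have cJ : comm (J i.-1) (J i) by apply: JJ; lia.
elim: rs => [|r rs IH]; first by rewrite /ev !big_nil mulr1; apply: commr1.
have -> : ev (r :: rs) (J i.-1) * ev (r :: rs) (J i) =
    ((J i.-1 - r%:A) * (J i - r%:A)) * (ev rs (J i.-1) * ev rs (J i)).
  rewrite !ev_cons -!mulrA; congr (_ * _); rewrite !mulrA; congr (_ * _).
  symmetry; apply: comm_ev; apply/commr_sym/commrB; [exact: cJ | exact: commr_scal].
(* For each root the pair of factors is a polynomial in the sum and the product of [J i.-1] and
   [J i], and [T i] commutes with both. *)
apply: commrM => //; have -> : (J i.-1 - r%:A) * (J i - r%:A) =
    J i.-1 * J i - r *: (J i.-1 + J i) + r%:A * r%:A.
  rewrite mulrBr !mulrBl !mulr_algl mulr_algr scalerDr opprB opprD.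
  by rewrite -!addrA; congr (_ + _); rewrite [RHS]addrCA; congr (_ + _); apply: addrC.
apply: commrD; last by apply: commrM; apply: commr_scal.
apply: commrB.
  rewrite /comm mulrA TJpred // mulrBl -mulrA TJself // mulrDr -scalerAl -scalerAr.
  by rewrite addrK mulrA -cJ.
by apply: commrZ; rewrite /comm mulrDr TJself // TJpred // mulrDl addrA addrAC subrK addrC.
Qed.

(** For [0 < i < k] the product is symmetric in the two Jucys-Murphy elements that [T i] exchanges;
    for [i = k] it contains only one of them, whence the exclusion. *)
Lemma comm_TFm rs i k : (i < m)%N -> (k <= m)%N -> i != k -> comm (T i) (Fm rs k).
Proof.
move=> hi hk; elim: k hk => [|k IH] hk hik; first by rewrite Fm0; apply: commr1.
have [eik|nik] := eqVneq i k; last first.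
  rewrite FmS; apply: commrM; first by apply: IH => //; lia.
  by apply/comm_ev/TJ_comm => //; move: hik nik; lia.
subst k; case: i hi hk hik IH => [|i] hi hk hik IH.
  by apply: comm_Fm => j; case: j.
rewrite FmS FmS -mulrA; apply: commrM; last exact: (@comm_T_evJ2 _ i.+1).
by apply: comm_Fm => j hj; apply: TJ_comm; rewrite /=; lia.
Qed.

End Affine.

(** * Spanning by standard elements *)

(** Span of a predicate rather than of a family: correction terms are tracked by the shape of their
    members, without naming an index set. *)
Inductive lspan (R : comUnitRingType) (V : lmodType R) (P : V -> Prop) : V -> Prop :=
| span0 : lspan P 0
| span_cons (a : R) x y : P x -> lspan P y -> lspan P (a *: x + y).

Section Span.
Variables (R : comUnitRingType).
Implicit Types V W : lmodType R.

Lemma span_in V (P : V -> Prop) x : P x -> lspan P x.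
Proof. by move=> h; rewrite -[x]addr0 -[x]scale1r; apply: span_cons => //; apply: span0. Qed.

Lemma spanD V (P : V -> Prop) x y : lspan P x -> lspan P y -> lspan P (x + y).
Proof.
by move=> + hy; elim=> [|a u z hu _ IH]; rewrite ?add0r // -addrA; apply: span_cons.
Qed.

Lemma span_map V W (P : V -> Prop) (P' : W -> Prop) (f : V -> W) z :
  (forall a x y, f (a *: x + y) = a *: f x + f y) ->
  (forall x, P x -> lspan P' (f x)) -> lspan P z -> lspan P' (f z).
Proof.
move=> fl h; have f0 : f 0 = 0.
  by apply: (addrI (f 0)); have := fl 1 0 0; rewrite !scale1r !addr0.
elim=> [|a x y hx _ IH]; first by rewrite f0; apply: span0.
rewrite fl; apply: spanD => //; elim: (h x hx) => [|b u v hu _ IH2].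
  by rewrite scaler0; apply: span0.
by rewrite scalerDr scalerA; apply: span_cons.
Qed.

Lemma spanZ V (P : V -> Prop) (a : R) x : lspan P x -> lspan P (a *: x).
Proof.
apply: span_map => [b u v|u hu]; first by rewrite scalerDr !scalerA mulrC.
by rewrite -[_ *: _]addr0; apply: span_cons => //; apply: span0.
Qed.

Lemma spanB V (P : V -> Prop) x y : lspan P x -> lspan P y -> lspan P (x - y).
Proof. by move=> hx hy; apply: spanD => //; rewrite -scaleN1r; apply: spanZ. Qed.

Lemma span_sum V (P : V -> Prop) (I : Type) (s : seq I) (F : I -> V) :
  (forall i, lspan P (F i)) -> lspan P (\sum_(i <- s) F i).
Proof. by move=> h; elim/big_ind: _ => //; [apply: span0 | apply: spanD]. Qed.

Lemma span_mono V (P P' : V -> Prop) x :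
  (forall y, P y -> P' y) -> lspan P x -> lspan P' x.
Proof. by move=> h; apply: (@span_map _ _ _ _ id) => // y /h /span_in. Qed.

Lemma span_mul (A : algType R) (P P' : A -> Prop) (c d z : A) :
  (forall x, P x -> lspan P' (c * x * d)) -> lspan P z -> lspan P' (c * z * d).
Proof.
apply: (span_map (f := fun z => c * z * d)) => a x y.
by rewrite mulrDr mulrDl -scalerAr -scalerAl.
Qed.

Lemma span_mull (A : algType R) (P P' : A -> Prop) (c z : A) :
  (forall x, P x -> lspan P' (c * x)) -> lspan P z -> lspan P' (c * z).
Proof.
move=> h hz; rewrite -[c * z]mulr1; apply: span_mul hz => x hx.
by rewrite mulr1; apply: h.
Qed.

Lemma span_mulr (A : algType R) (P P' : A -> Prop) (d z : A) :
  (forall x, P x -> lspan P' (x * d)) -> lspan P z -> lspan P' (z * d).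
Proof.
move=> h hz; rewrite -[z]mul1r; apply: span_mul hz => x hx.
by rewrite mul1r; apply: h.
Qed.
End Span.

(** * Monomials in the Jucys-Murphy elements and straightening *)

Section Mon.
Variables (R : comUnitRingType) (A : algType R) (q : R).
Hypothesis hq : q \is a GRing.unit.
Variables (m : nat) (T : nat -> A).
Hypothesis hT : affine q m T.
Local Notation J := (JM q T).

Section TwoVariables.
Variables (t X Y : A).
Hypothesis hX : t * X = Y * t - (q - 1) *: Y.
Hypothesis hY : t * Y = X * t + (q - 1) *: Y.
Hypothesis hXY : comm X Y.

Let box M z := exists a b, [/\ (a < M)%N, (b < M)%N & z = X ^+ a * Y ^+ b].

Lemma boxW M N z : (M <= N)%N -> lspan (box M) z -> lspan (box N) z.
Proof.
move=> h; apply: span_mono => _ [a [b [ha hb ->]]]; exists a, b; split=> //; lia.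
Qed.

Lemma box_mul M a b z : lspan (box M) z ->
  lspan (box (M + maxn a b)) (z * (X ^+ a * Y ^+ b)).
Proof.
apply: span_mulr => _ [c [e [hc he ->]]]; apply: span_in; exists (c + a)%N, (e + b)%N.
split; [lia | lia |]; rewrite !exprD !mulrA; congr (_ * _); rewrite -!mulrA.
by congr (_ * _); apply/commr_sym/commrX/commr_sym/commrX/commr_sym.
Qed.

Lemma tXn k : exists2 z, lspan (box k.+1) z & t * X ^+ k = Y ^+ k * t + z.
Proof.
have key : exists2 z, lspan (fun z => exists a b, [/\ (a < k)%N, (b <= k)%N & z = X ^+ a * Y ^+ b]) z
    & t * X ^+ k = Y ^+ k * t + z.
  elim: k => [|k [z hz e]]; first by exists 0; rewrite ?expr0 ?mul1r ?mulr1 ?addr0 //; apply: span0.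
  exists (- (q - 1) *: Y ^+ k.+1 + z * X).
    apply: span_cons; first by exists 0%N, k.+1; rewrite expr0 mul1r.
    apply: span_mulr hz => _ [a [b [ha hb ->]]]; apply: span_in; exists a.+1, b.
    split; [lia | lia |]; rewrite exprSr -!mulrA; congr (_ * _).
    exact/commr_sym/commrX.
  rewrite exprSr mulrA e mulrDl -(mulrA _ t) hX mulrBr mulrA -exprSr -scalerAr -exprSr.
  by rewrite scaleNr addrA.
case: key => z hz e; exists z => //; apply: span_mono hz => _ [a [b [ha hb ->]]].
by exists a, b; split => //; lia.
Qed.

Lemma tYn k : exists2 z, lspan (box k.+1) z & t * Y ^+ k = X ^+ k * t + z.
Proof.
elim: k => [|k [z hz e]]; first by exists 0; rewrite ?expr0 ?mul1r ?mulr1 ?addr0 //; apply: span0.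
exists ((q - 1) *: (X ^+ k * Y) + z * Y).
  apply: span_cons; first by exists k, 1%N; rewrite expr1; split=> //; lia.
  by have := box_mul 0 1 hz; rewrite expr0 expr1 mul1r addn1.
rewrite [Y ^+ k.+1]exprSr mulrA e mulrDl.
by rewrite -(mulrA _ t) hY mulrDr mulrA -exprSr -scalerAr addrA.
Qed.

(** [X ^+ k * Y ^+ k] commutes with [t], so the common part of the exponents is set aside and only a
    pure power of [X] or of [Y] has to pass. This keeps the correction within the bound. *)
Lemma tXY M a b : (a < M)%N -> (b < M)%N ->
  exists2 z, lspan (box M) z & t * (X ^+ a * Y ^+ b) = X ^+ b * Y ^+ a * t + z.
Proof.
have cXY k l : comm (X ^+ k) (Y ^+ l) by apply/commrX/commr_sym/commrX/commr_sym.
have cYX k l : comm (Y ^+ k) (X ^+ l) by apply/commr_sym.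
have ct k : comm t (X ^+ k * Y ^+ k).
  rewrite -exprMn_comm //; apply: commrX; rewrite /comm mulrA hX mulrBl -(mulrA _ t) hY.
  by rewrite mulrDr -scalerAr -scalerAl addrK mulrA -hXY.
move=> ha hb; have [hab|hab] := leqP b a.
  have [z hz e] := tXn (a - b); exists (z * (X ^+ b * Y ^+ b)).
    by apply: boxW (box_mul b b hz); lia.
  have {1}-> : a = (a - b + b)%N by lia.
  rewrite exprD -mulrA (mulrA t) e mulrDl; congr (_ + _).
  rewrite -mulrA ct mulrA; congr (_ * _); rewrite mulrA cYX -mulrA -exprD.
  by congr (_ * Y ^+ _); lia.
have [z hz e] := tYn (b - a); exists (z * (X ^+ a * Y ^+ a)).
  by apply: boxW (box_mul a a hz); lia.
have -> : X ^+ a * Y ^+ b = Y ^+ (b - a) * (X ^+ a * Y ^+ a).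
  rewrite mulrA cYX -mulrA -exprD; congr (_ * Y ^+ _); lia.
rewrite (mulrA t) e mulrDl; congr (_ + _).
rewrite -mulrA ct mulrA; congr (_ * _); rewrite mulrA -exprD.
by congr (X ^+ _ * _); lia.
Qed.
End TwoVariables.

Definition Mon (k : nat) (a : nat -> nat) : A := \prod_(0 <= j < k) J j ^+ a j.

Lemma MonE k a : Mon k a = \prod_(0 <= j < k) J j ^+ a j.
Proof. by []. Qed.

Lemma eq_Mon k a b : (forall j, (j < k)%N -> a j = b j) -> Mon k a = Mon k b.
Proof.
by move=> h; apply: eq_big_nat => j /andP[_ hj]; rewrite h.
Qed.

Lemma comm_Mon k a x : (forall j, (j < k)%N -> comm x (J j)) -> comm x (Mon k a).
Proof.
move=> h; apply: commr_prod_seq => j; rewrite mem_index_iota => /andP[_ hj].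
by apply/commrX/h.
Qed.

Lemma comm_JMon k a j : (k <= m)%N -> (j < m)%N -> comm (J j) (Mon k a).
Proof. by move=> hk hj; apply: comm_Mon => i hi; apply: (JJ hT); lia. Qed.

Lemma JMon k i a : (i < k)%N -> (k <= m)%N ->
  J i * Mon k a = Mon k (fun j => if j == i then (a j).+1 else a j).
Proof.
move=> hik hkm; rewrite /Mon (big_cat_nat (n := i)) //=; last by lia.
rewrite (big_ltn hik) [RHS](big_cat_nat (n := i)) //=; last by lia.
rewrite (big_ltn hik) eqxx exprS !mulrA; congr (_ * _ * _).
  have -> : J i * \prod_(0 <= j < i) J j ^+ a j = \prod_(0 <= j < i) J j ^+ a j * J i.
    by apply: (comm_JMon (k := i)); lia.
  congr (_ * _); apply: eq_big_nat => j /andP[_ hj].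
  by case: eqP => // ?; lia.
by apply: eq_big_nat => j /andP[hj _]; case: eqP => // ?; lia.
Qed.

(** As the bound [M] survives, moving [T i] past a monomial never leaves the exponent range of the
    standard basis. *)
Lemma TMon M i a : (0 < i < m)%N -> (forall j, (j < m)%N -> (a j < M)%N) ->
  exists2 z, lspan (fun z => exists2 b, (forall j, (j < m)%N -> (b j < M)%N) & z = Mon m b) z
    & T i * Mon m a = Mon m (a \o sw i) * T i + z.
Proof.
case: i => // i hi ha.
have split b : Mon m b = \prod_(0 <= j < i) J j ^+ b j * (J i ^+ b i * J i.+1 ^+ b i.+1) *
    \prod_(i.+2 <= j < m) J j ^+ b j.
  rewrite /Mon (big_cat_nat (n := i)) //=; last by lia.
  have h1 : (i < m)%N by lia.
  have h2 : (i.+1 < m)%N by lia.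
  by rewrite (big_ltn h1) (big_ltn h2) !mulrA.
have [z hz e] : exists2 z, lspan (fun z => exists x y, [/\ (x < M)%N, (y < M)%N & z = J i ^+ x * J i.+1 ^+ y]) z
    & T i.+1 * (J i ^+ a i * J i.+1 ^+ a i.+1) = J i ^+ a i.+1 * J i.+1 ^+ a i * T i.+1 + z.
  apply: tXY; first [exact: (TJpred hT hq hi) | exact: (TJself hT hq hi)
    | by apply: ha; lia | by apply: (JJ hT); lia].
exists (\prod_(0 <= j < i) J j ^+ a j * z * \prod_(i.+2 <= j < m) J j ^+ a j).
  apply: span_mul hz => _ [x [y [hx hy ->]]]; apply: span_in.
  exists (fun j => if j == i then x else if j == i.+1 then y else a j).
    by move=> j hj; case: eqP => // _; case: eqP => // _; apply: ha.
  rewrite split !eqxx; have -> : (i.+1 == i) = false by lia.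
  by congr (_ * _ * _); apply: eq_big_nat => j hj; rewrite !ifN //; lia.
rewrite split.
have c1 : T i.+1 * \prod_(0 <= j < i) J j ^+ a j = \prod_(0 <= j < i) J j ^+ a j * T i.+1.
  apply: commr_prod_seq => j; rewrite mem_index_iota => hj.
  by apply/commrX/(TJ_comm hT); rewrite /=; lia.
have c2 : T i.+1 * \prod_(i.+2 <= j < m) J j ^+ a j = \prod_(i.+2 <= j < m) J j ^+ a j * T i.+1.
  apply: commr_prod_seq => j; rewrite mem_index_iota => hj.
  by apply/commrX/(TJ_comm hT); rewrite /=; lia.
rewrite !mulrA c1 -!mulrA (mulrA (_ ^+ _)) (mulrA (T _)) e mulrDl mulrDr; congr (_ + _).
rewrite split /= -!mulrA c2 !mulrA; congr (_ * T _).
have -> : sw i.+1 i = i.+1 by sw_lia.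
have -> : sw i.+1 i.+1 = i by sw_lia.
congr (_ * _ * _ * _).
  by apply: eq_big_nat => j hj /=; rewrite sw_out //=; lia.
by apply: eq_big_nat => j hj /=; rewrite sw_out //=; lia.
Qed.

(* [u] ranges over a submodule on which the order relation for [T_0] holds. *)
Section OneBlock.
Variables (Qs : seq R) (V : A -> Prop).
Hypothesis VT : forall i u, (i < m)%N -> V u -> V (T i * u).
Hypothesis VZ : forall (a : R) u, V u -> V (a *: u).
Hypothesis VQ : forall u, (0 < m)%N -> V u -> ev Qs (T 0%N) * u = 0.

Lemma V_J k u : (k < m)%N -> V u -> V (J k * u).
Proof.
elim: k u => [|k IH] u hk hu; first exact: VT.
by rewrite JS -scalerAl -!mulrA; apply/VZ/VT => //; apply/IH/VT => //; lia.
Qed.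

Lemma V_prod (I : eqType) (s : seq I) (F : I -> A) u :
  (forall i u, i \in s -> V u -> V (F i * u)) -> V u -> V ((\prod_(i <- s) F i) * u).
Proof.
move=> + hu; elim: s => [|i s IH] h; first by rewrite big_nil mul1r.
rewrite big_cons -mulrA; apply: (h); first exact: mem_head.
by apply: IH => j v hj; apply: h; rewrite inE hj orbT.
Qed.

Lemma V_Tw (w : 'S_m) u : V u -> V (Tw T w * u).
Proof.
apply: V_prod => i v hi; apply: VT.
by have [/rword_vword/allP/(_ _ hi) ? _] := redwordP w; lia.
Qed.

Lemma V_Jexp k e u : (k < m)%N -> V u -> V (J k ^+ e * u).
Proof.
move=> hk hu; elim: e => [|e IH]; first by rewrite expr0 mul1r.
by rewrite exprS -mulrA; apply: V_J.
Qed.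

Lemma ev_expand (rs : seq R) (x : A) : exists2 z,
  lspan (fun z => exists2 k, (k < size rs)%N & z = x ^+ k) z & x ^+ size rs = ev rs x + z.
Proof.
elim: rs => [|r rs [z hz e]]; first by exists 0; rewrite ?expr0 /ev ?big_nil ?addr0 //; apply: span0.
exists (r *: x ^+ size rs + (x * z - r *: z)); last first.
  rewrite /= ev_cons exprS e mulrDr mulrBl mulr_algl scalerDr.
  by rewrite !addrA subrK -!addrA; congr (_ + _); rewrite addrCA addrN addr0.
apply: span_cons; first by exists (size rs).
apply: spanB.
  by apply: span_mull hz => _ [k hk ->]; apply: span_in; exists k.+1; rewrite ?exprS.
by apply: spanZ; apply: span_mono hz => _ [k hk ->]; exists k => //=; lia.
Qed.

(** Standard elements applied to a vector [u]. Keeping [u] general allows straightening in one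
    tensor factor while the others wait on the right; [u = 1] gives the algebra itself. *)
Definition std s u z := exists (a : nat -> nat) (w : 'S_m),
  (forall j, (j < m)%N -> (a j < s)%N) /\ z = Mon m a * Tw T w * u.

Lemma std_T i u y : (i < m)%N -> V u -> std (size Qs) u y -> lspan (std (size Qs) u) (T i * y).
Proof.
move=> hi hu [a [w [ha ->]]]; case: i hi => [|i] hi.
  have -> : T 0%N * (Mon m a * Tw T w * u) = (J 0 * Mon m a) * Tw T w * u by rewrite !mulrA.
  (* Only the first exponent grows. If it reaches [size Qs], the order relation on [V] trades that
     power for smaller ones. *)
  rewrite JMon //; set b := (fun _ => _).
  have [hb|hb] := ltnP (a 0%N).+1 (size Qs).
    apply: span_in; exists b, w; split=> // j hj; rewrite /b; case: eqP => [->//|_]; exact: ha.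
  have [z hz e] := ev_expand Qs (J 0).
  pose a' j := if j == 0%N then 0%N else a j.
  have b0 : Mon m b * Tw T w * u = J 0 ^+ size Qs * (Mon m a' * Tw T w * u).
    rewrite /Mon !(big_ltn hi) !mulrA; congr (_ * _ * _).
    rewrite /b /a' /= expr0 mulr1; congr (_ * _); last by apply: eq_big_nat => -[].
    by congr (_ ^+ _); have := ha 0%N hi; lia.
  have V1 : V (Mon m a' * Tw T w * u).
    rewrite -mulrA; apply: V_prod; last exact: V_Tw.
    by move=> j v; rewrite mem_index_iota => hj; apply: V_Jexp; lia.
  rewrite b0 e mulrDl VQ // add0r; apply: span_mulr hz => _ [k hk ->].
  apply: span_in; exists (fun j => if j == 0%N then k else a j), w; split.
    by move=> j hj; case: eqP => // _; apply: ha.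
  rewrite !mulrA; congr (_ * _ * _); rewrite /Mon !(big_ltn hi) /= !mulrA /a' /= expr0 mulr1.
  by congr (_ * _); apply: eq_big_nat => -[].
have [z hz e] := TMon (i := i.+1) hi ha.
rewrite !mulrA e !mulrDl; apply: spanD; last first.
  rewrite -mulrA; apply: span_mulr hz => _ [b hb ->]; apply: span_in.
  by exists b, w; rewrite mulrA.
have hsw : forall j, (j < m)%N -> ((a \o sw i.+1) j < size Qs)%N.
  by move=> j hj; apply: ha; move: hj hi; sw_lia.
rewrite -(mulrA _ (T _)); have [->|->] := TTw hT (i := i.+1) w hi.
  by apply: span_in; exists (a \o sw i.+1), (sgen m i.+1 * w)%g.
rewrite mulrDr mulrDl -!scalerAr -!scalerAl; apply: spanD; apply/spanZ/span_in.
  by exists (a \o sw i.+1), (sgen m i.+1 * w)%g.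
by exists (a \o sw i.+1), w.
Qed.

Lemma stdE s u z : (0 < s)%N -> std s u z -> exists x, z = AK_bas q s m T x * u.
Proof.
move=> s0 [a [w [ha ->]]].
exists ([ffun j : 'I_m => insubd (Ordinal s0) (a j)], w); congr (_ * _ * _).
rewrite /Mon big_mkord; apply: eq_bigr => j _.
by rewrite ffunE val_insubd ha.
Qed.

Lemma AK_std s u x : std s u (AK_bas q s m T x * u).
Proof.
exists (fun j => oapp (fun i : 'I_m => nat_of_ord (x.1 i)) 0%N (insub j)), x.2; split.
  by move=> j hj; rewrite insubT /=.
congr (_ * _ * _); rewrite /Mon big_mkord; apply: eq_bigr => j _.
by rewrite valK /=.
Qed.
End OneBlock.
End Mon.

(** * Block transpositions *)

Ltac if_lia := repeat match goal with
  |- context [if ?c then _ else _] =>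
    lazymatch c with
    | context [if _ then _ else _] => fail
    | _ => case: (boolP c) => ?
    end
  end; lia.

Section Words.
Local Open Scope nat_scope.

Definition wact (s : seq nat) (x : nat) : nat := foldl (fun x i => sw i x) x s.

Lemma wact_cat s t x : wact (s ++ t) x = wact t (wact s x).
Proof. by rewrite /wact foldl_cat. Qed.

Lemma pn_wprod m s x : vword m s -> pn (wprod m s) x = wact s x.
Proof.
elim: s x => [|i s IH] x /=; first by rewrite pn1.
by case/andP=> hi hs; rewrite pn_sgenM // IH.
Qed.

Lemma wact_run k a x : wact (rev (iota k.+1 a)) x =
  if x == k + a then k else if k <= x < k + a then x.+1 else x.
Proof.
elim: a x => [|a IH] x; first by rewrite /= addn0; case: eqP => [->//|_]; case: ifP => //; lia.
rewrite -[a.+1]addn1 iotaD rev_cat /= IH addn1.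
have [->|n1] := eqVneq x (k.+1 + a).
  rewrite sw_self; last by lia.
  have -> : (k.+1 + a).-1 = k + a by lia.
  by rewrite eqxx ifT //; lia.
have [->|n2] := eqVneq x (k + a).
  have -> : sw (k.+1 + a) (k + a) = k.+1 + a by sw_lia.
  by if_lia.
rewrite sw_out //.
by if_lia.
Qed.

(** A reduced word of length [a b] for the exchange of two adjacent blocks, in place of the power of
    a long cycle in [wk_word]; by [wkE] the permutations agree. *)
Definition cw (k a b : nat) : seq nat :=
  flatten [seq rev (iota (k + j).+1 a) | j <- iota 0 b].

Lemma cw0 k a : cw k a 0 = [::].
Proof. by []. Qed.

Lemma cwD k a b b' : cw k a (b + b') = cw k a b ++ cw (k + b) a b'.
Proof.
rewrite /cw iotaD map_cat flatten_cat add0n; congr (_ ++ flatten _).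
rewrite -(addn0 b) iotaDl addn0 -map_comp; apply: eq_map => j /=.
by rewrite addnA.
Qed.

Lemma cw1 k a : cw k a 1 = rev (iota k.+1 a).
Proof. by rewrite /cw /= addn0 cats0. Qed.

Lemma cwSr k a b : cw k a b.+1 = cw k a b ++ rev (iota (k + b).+1 a).
Proof. by rewrite -addn1 cwD cw1. Qed.

Lemma cwS k a b : cw k a b.+1 = rev (iota k.+1 a) ++ cw k.+1 a b.
Proof. by rewrite -add1n cwD cw1 addn1. Qed.

Lemma size_cw k a b : size (cw k a b) = b * a.
Proof.
by elim: b k => [|b IH] k; rewrite ?cw0 // cwS size_cat size_rev size_iota IH mulSn.
Qed.

Lemma mem_cw k a b i : i \in cw k a b -> k < i < k + a + b.
Proof.
elim: b k => [//|b IH] k; rewrite cwS mem_cat mem_rev mem_iota => /orP[|/IH]; lia.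
Qed.

Lemma vword_cw m k a b : k + a + b <= m -> vword m (cw k a b).
Proof. by move=> h; apply/allP => i /mem_cw; lia. Qed.

Lemma wact_cw k a b x : wact (cw k a b) x =
  if k <= x < k + a then x + b else if k + a <= x < k + a + b then x - a else x.
Proof.
elim: b k x => [|b IH] k x.
  by rewrite cw0 /= addn0; if_lia.
rewrite cwSr wact_cat IH wact_run.
by if_lia.
Qed.

Lemma vword_wk m k a b : k + a + b <= m -> vword m (wk_word k a b).
Proof.
move=> h; apply/allP => i /flattenP[s /nseqP[-> _]].
by rewrite mem_rev mem_iota; lia.
Qed.

Lemma wact_nseq k N j x : 0 < N -> j <= N ->
  wact (flatten (nseq j (rev (iota k.+1 N.-1)))) x =
  if k <= x < k + N then if x + j < k + N then x + j else x + j - N else x.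
Proof.
case: N => // N _; elim: j x => [|j IH] x hj.
  by rewrite /= addn0; if_lia.
rewrite /= wact_cat wact_run IH; last by lia.
have [->|n1] := eqVneq x (k + N).
  by do ![rewrite ifT; last by lia]; if_lia.
by if_lia.
Qed.

Lemma wkE m k a b : k + a + b <= m -> wk m k a b = wprod m (cw k a b).
Proof.
move=> h; apply: pn_ext => x _; rewrite !pn_wprod ?vword_wk ?vword_cw //.
have [->|b0] := posnP b; first by [].
rewrite wact_cw /wk_word wact_nseq; try lia.
by if_lia.
Qed.

Lemma rword_cw m k a b : k + a + b <= m -> rword m (cw k a b).
Proof.
elim: b k => [|b IH] k h; first by rewrite cw0 /rword /= len1.
rewrite cwS; have : a <= a by [].
elim: {1 3}a => [|a' IHa] ha; first by apply: IH; lia.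
rewrite -[a'.+1]addn1 iotaD rev_cat /= rword_cons.
have r1 := IHa (ltnW ha); rewrite r1 !pn_wprod ?(rword_vword r1) //.
rewrite !wact_cat !wact_run !wact_cw.
by apply/and3P; split; [lia|by []|]; if_lia.
Qed.

(** Every pair with one strand in each block is an inversion. *)
Lemma leq_len_cross n c a (y : 'S_n) : c + a <= n ->
  (forall i, i < c -> a <= pn y i) -> (forall i, c <= i < c + a -> pn y i < a) ->
  c * a <= len y.
Proof.
move=> h h1 h2.
have b1 (i : 'I_c) : i < n by have := ltn_ord i; lia.
have b2 (j : 'I_a) : c + j < n by have := ltn_ord j; lia.
pose f (z : 'I_c * 'I_a) := (Ordinal (b1 z.1), Ordinal (b2 z.2)).
have fI : injective f.
  by case=> i j [i' j'] [e1] /eqP; rewrite eqn_add2l => /eqP e2; congr (_, _); apply: val_inj.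
have <- : #|[set: 'I_c * 'I_a]| = c * a by rewrite cardsT card_prod !card_ord.
rewrite -(card_imset _ fI); apply: subset_leq_card; apply/subsetP => _ /imsetP[[i j] _ ->].
rewrite inE /= -!pnE /=; have := ltn_ord i; have := ltn_ord j => hj hi.
have := h1 i hi; have := h2 (c + j); lia.
Qed.

(** Otherwise the first block fills all [c] positions from [a] on, by counting the second block
    lands below [a], and all [c a] crossings occur. *)
Lemma overlap_of_len m c a (y : 'S_m) : m = c + a -> len y < c * a ->
  exists2 x, x < c & pn y x < a.
Proof.
move=> em hl; case: (pickP (fun i : 'I_c => pn y i < a)) => [i hi|hn].
  by exists i.
have h1 i : i < c -> a <= pn y i.
  by move=> hi; have := hn (Ordinal hi); rewrite /= ltnNge => /negbFE.
suff: c * a <= len y by lia.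
apply: leq_len_cross => //; first by rewrite -em.
move=> x0 hx0; rewrite ltnNge; apply/negP => hx.
have lt i : (if i < c then pn y i else pn y x0) < m by case: ifP => ?; rewrite pn_lt; lia.
pose g (i : 'I_c.+1) := (if i < c then pn y i else pn y x0) - a.
have gl i : g i < c by have := lt i; rewrite /g; case: ifP => ?; move: (ltn_ord i); lia.
have gI : injective (fun i => Ordinal (gl i)).
  move=> i j [] /eqP; rewrite /g; case: ifP => hi; case: ifP => hj.
  - have := h1 i hi; have := h1 j hj => ? ? /eqP e; have /pn_inj e2 : pn y i = pn y j by lia.
    exact: val_inj.
  - have := h1 i hi => ? /eqP e; have /pn_inj : pn y i = pn y x0 by lia.
    lia.
  - have := h1 j hj => ? /eqP e; have /pn_inj : pn y j = pn y x0 by lia.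
    lia.
  - by move=> _; apply/val_inj => /=; have := ltn_ord i; have := ltn_ord j; lia.
by have := leq_card _ gI; rewrite !card_ord; lia.
Qed.
End Words.

Lemma span_mul_eq0 (R : comUnitRingType) (A : algType R) (P : A -> Prop) (c d z : A) :
  (forall x, P x -> c * x * d = 0) -> lspan P z -> c * z * d = 0.
Proof.
move=> h; elim=> [|a x y hx _ IH]; first by rewrite mulr0 mul0r.
by rewrite mulrDr mulrDl IH -scalerAr -scalerAl h // scaler0 addr0.
Qed.

(** * Intertwining across two blocks *)

Section Affine.
Variables (R : comUnitRingType) (A : algType R) (q : R).
Hypothesis hq : q \is a GRing.unit.
Variables (m : nat) (T : nat -> A).
Hypothesis hT : affine q m T.
Local Notation J := (JM q T).
Local Notation Fm := (Fm q T).

Lemma Tw_fix0 (y : 'S_m) : (0 < m)%N -> pn y 0 = 0%N -> comm (T 0%N) (Tw T y).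
Proof.
move=> m0; elim: {y}_.+1 {-2}y (ltnSn (len y)) => // k IH y hk y0.
have [->|/descent[i hi hd]] := eqVneq y 1%g; first by rewrite (affTw1 hT); apply: commr1.
have i1 : i != 1%N by apply/eqP => e; move: hd; rewrite e /= y0.
rewrite -(sgenKl i y) (affTwS hT) //; last first.
  by rewrite !pn_sgenM // sw_pred sw_self //; lia.
apply: commrM; first by apply: (Tcomm hT); lia.
apply: IH; first by move: hk; rewrite (len_sgen_gt hi hd).
by rewrite pn_sgenM // sw_out //; lia.
Qed.

(** The corrections carry [J] on the right, because from there it passes through [Fm g a] and [z]
    and leaves an expression to which [vanish] applies. *)
Lemma TwJ (w : 'S_m) x : (x < m)%N -> exists2 z,
  lspan (fun z => exists (y : 'S_m) k, [/\ (len y < len w)%N, (k < m)%N & z = Tw T y * J k]) z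
  & Tw T w * J (pn w x) = J x * Tw T w + z.
Proof.
elim: {w}_.+1 {-2}w (ltnSn (len w)) x => // k IH w hk x hx.
have [->|/descent[i hi hd]] := eqVneq w 1%g.
  by exists 0; rewrite ?(affTw1 hT) ?pn1 ?mul1r ?mulr1 ?addr0 //; apply: span0.
pose w' := (sgen m i * w)%g; have ew : w = (sgen m i * w')%g by rewrite /w' sgenKl.
have hl : len w = (len w').+1 by apply: len_sgen_gt.
have hw' : (len w' < k)%N by lia.
have ET : Tw T w = T i * Tw T w'.
  by rewrite {1}ew (affTwS hT) // /w' !pn_sgenM // sw_pred sw_self //; lia.
have up z : lspan (fun z => exists (y : 'S_m) k, [/\ (len y < len w')%N, (k < m)%N & z = Tw T y * J k]) z ->
    lspan (fun z => exists (y : 'S_m) k, [/\ (len y < len w)%N, (k < m)%N & z = Tw T y * J k]) (T i * z).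
  apply: span_mull => _ [y [j [hy hj ->]]]; rewrite mulrA.
  have [->|->] := TTw hT y hi.
    by apply: span_in; exists (sgen m i * y)%g, j; split=> //; have := leq_len_sgen y i; lia.
  rewrite mulrDl -!scalerAl; apply: spanD; apply/spanZ/span_in.
    by exists (sgen m i * y)%g, j; split=> //; have := leq_len_sgen y i; lia.
  by exists y, j; split=> //; lia.
have hsx : (sw i x < m)%N by move: hi hx; sw_lia.
have [z1 hz1 e1] := IH w' hw' (sw i x) hsx.
have ex : pn w' (sw i x) = pn w x by rewrite /w' pn_sgenM // swK //; lia.
have [z2 hz2 e2] := IH w' hw' i (proj2 (andP hi)).
(* Moving [T i] creates a term with [J i] on the left; the induction hypothesis for [w'] at [i]
   turns it round. *)
have JTw' : lspan (fun z => exists (y : 'S_m) k, [/\ (len y < len w)%N, (k < m)%N & z = Tw T y * J k]) (J i * Tw T w').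
  have -> : J i * Tw T w' = Tw T w' * J (pn w' i) - z2 by rewrite e2 addrK.
  apply: spanB.
    by apply: span_in; exists w', (pn w' i); split; rewrite ?pn_lt //; lia.
  by apply: span_mono hz2 => _ [y [j [hy hj ->]]]; exists y, j; split=> //; lia.
have [c ec] : exists c : R, T i * J (sw i x) = J x * T i + c *: J i.
  have [->|n1] := eqVneq x i.-1; first by exists (q - 1); rewrite sw_pred (TJself hT hq).
  have [->|n2] := eqVneq x i.
    by exists (- (q - 1)); rewrite sw_self ?(TJpred hT hq) ?scaleNr //; lia.
  exists 0; rewrite scale0r addr0 sw_out //; apply: (TJ_comm hT) => //; lia.
exists (c *: (J i * Tw T w') + T i * z1).
  by apply: spanD; [apply: spanZ | apply: up].
rewrite ET -mulrA -ex e1 mulrDr (mulrA (T i)) ec mulrDl -mulrA -scalerAl.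
by rewrite addrA.
Qed.

Section TwoBlocks.
Variables (c a : nat) (f g : seq R) (z : A).
Hypothesis em : m = (c + a)%N.
Hypothesis zc : central_upto T m z.
Hypothesis fgz : (0 < m)%N -> ev f (T 0%N) * ev g (T 0%N) * z = 0.

(** The factor [z] completes the order relation: in the intertwining property of [v_b] it is the
    product of the later [bU], in the factorisation of [v_b T_b] it is 1. A left descent at [c] or a
    right descent at [a] is not absorbed by [Fm], so these two are left in place. *)
Lemma vanish (y : 'S_m) : (exists2 x, (x < c)%N & (pn y x < a)%N) ->
  Fm f c * Tw T y * (Fm g a * z) = 0.
Proof.
elim: {y}_.+1 {-2}y (ltnSn (len y)) => // k IH y hk [x hxc hxa].
case: (pickP (fun i : 'I_m => [&& 0 < i, nat_of_ord i != c & pn y i < pn y i.-1]%N)) => [i /and3P[i0 ic hd]|nl].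
  have hi : (0 < i < m)%N by rewrite i0 /=.
  rewrite -(sgenKl i y) (affTwS hT) //; last by rewrite !pn_sgenM // sw_pred sw_self.
  have cf : Fm f c * T i = T i * Fm f c by apply/commr_sym/(comm_TFm hT hq) => //; lia.
  rewrite (mulrA (Fm f c)) cf -2!mulrA (mulrA (Fm f c)) IH ?mulr0 //; first by move: hk; rewrite (len_sgen_gt hi hd).
  by exists (sw i x); [move: ic hxc; sw_lia | rewrite pn_sgenM // swK].
case: (pickP (fun i : 'I_m => [&& 0 < i, nat_of_ord i != a & pn y^-1%g i < pn y^-1%g i.-1]%N)) => [i /and3P[i0 ia hd]|nr].
  have hi : (0 < i < m)%N by rewrite i0 /=.
  have -> : y = (y * sgen m i * sgen m i)%g by rewrite -mulgA sgenK mulg1.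
  rewrite (affTwSr hT) //; last by rewrite invMg sgenV !pn_sgenM // sw_pred sw_self.
  have cg : T i * Fm g a = Fm g a * T i by apply: (comm_TFm hT hq) => //; lia.
  rewrite (mulrA (Fm f c)) -(mulrA _ (T i)) (mulrA (T i)) cg -(mulrA _ (T i)).
  rewrite -zc // (mulrA (Fm g a)) mulrA IH ?mul0r //.
    by move: hk; rewrite -lenV (len_sgen_gt hi hd) -(lenV (y * _)%g) invMg sgenV.
  by exists x => //; rewrite pnM pn_sgen //; move: ia hxa; sw_lia.
have m0 : (0 < m)%N by lia.
have inc_l j : (j < c)%N -> (pn y 0 <= pn y j)%N.
  elim: j => // j IHj hj; apply: (leq_trans (IHj (ltnW hj))).
  have hjm : (j.+1 < m)%N by lia.
  have := nl (Ordinal hjm); rewrite /=; lia.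
have inc_r j : (j < a)%N -> (pn y^-1%g 0 <= pn y^-1%g j)%N.
  elim: j => // j IHj hj; apply: (leq_trans (IHj (ltnW hj))).
  have hjm : (j.+1 < m)%N by lia.
  have := nr (Ordinal hjm); rewrite /=; lia.
(* With the overlap, monotonicity of [y] on the first block gives [pn y 0 < a]; monotonicity of the
   inverse below [a] then bounds its value at 0 by its value at [pn y 0], which is 0. *)
have y0 : pn y 0 = 0%N.
  have h1 : (pn y 0 < a)%N by have := inc_l x hxc; lia.
  have := inc_r _ h1; rewrite pnK leqn0 => /eqP e.
  by rewrite -[in LHS]e pnKV.
have [r1 -> _] := Fm_recl hT f (leq_ltn_trans (leq0n x) hxc) (leq_trans (leq_addr a c) (eq_leq (esym em))).
have [r2 -> c2] := Fm_recl hT g (leq_ltn_trans (leq0n _) hxa) (leq_trans (leq_addl c a) (eq_leq (esym em))).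
have cy : ev f (T 0%N) * Tw T y = Tw T y * ev f (T 0%N).
  by apply: ev_intertw; apply: Tw_fix0.
have cr : ev f (T 0%N) * r2 = r2 * ev f (T 0%N) by apply: ev_intertw.
rewrite -!mulrA (mulrA (ev f _)) cy -!mulrA (mulrA (ev f _)) cr -!mulrA.
by rewrite (mulrA (ev f _)) fgz // !mulr0.
Qed.

Lemma twoblocks_J x : (x < m)%N ->
  J x * (Fm f c * Tw T (wprod m (cw 0 c a)) * Fm g a * z) =
  Fm f c * Tw T (wprod m (cw 0 c a)) * Fm g a * z * J (wact (cw 0 c a) x).
Proof.
move=> hx; have rw : rword m (cw 0 c a) by apply: rword_cw; lia.
set w := wprod m _; have ew : len w = (c * a)%N.
  by case/andP: rw => _ /eqP <-; rewrite size_cw mulnC.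
have epn : wact (cw 0 c a) x = pn w x by rewrite pn_wprod // rword_vword.
rewrite epn; have hpx : (pn w x < m)%N by rewrite pn_lt.
have [y hy e] := TwJ w hx.
have cz : comm z (J (pn w x)) by apply: in_gensJ zc.
have cg : Fm g a * J (pn w x) = J (pn w x) * Fm g a by symmetry; apply: (comm_FmJ hT); lia.
rewrite !mulrA (comm_FmJ hT) //; last by lia.
rewrite -!mulrA cz (mulrA (Fm g a)) cg (mulrA (J x)).
have -> : J x * Tw T w = Tw T w * J (pn w x) - y by rewrite e addrK.
rewrite mulrBl mulrBr !mulrA; apply/eqP; rewrite subr_eq addrC -subr_eq subrr eq_sym.
rewrite -!mulrA (mulrA (Fm f c)); apply/eqP.
apply: span_mul_eq0 hy => _ [v [k [hv hk ->]]].
have -> : Fm f c * (Tw T v * J k) * (Fm g a * z) = Fm f c * Tw T v * (Fm g a * z) * J k.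
  rewrite -!mulrA; do 2!congr (_ * _); have -> : z * J k = J k * z by apply: in_gensJ zc.
  rewrite mulrA.
  by rewrite (comm_FmJ hT) ?mulrA //; lia.
by rewrite vanish ?mul0r //; apply: overlap_of_len => //; rewrite -ew.
Qed.

(** The block exchange [w] preserves the order inside each block, so [s_i w = w s_j] for a simple
    [s_j] and both products add lengths: no correction arises. The boundary [i = c] has to be
    excluded. *)
Lemma twoblocks_T i : (0 < i < m)%N -> i != c ->
  T i * (Fm f c * Tw T (wprod m (cw 0 c a)) * Fm g a * z) =
  Fm f c * Tw T (wprod m (cw 0 c a)) * Fm g a * z *
    T (if (i < c)%N then i + a else i - c)%N.
Proof.
move=> hi ic; have rw : rword m (cw 0 c a) by apply: rword_cw; lia.
set w := wprod m _; set i' := (if _ then _ else _).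
have pw x : pn w x = wact (cw 0 c a) x by rewrite pn_wprod // rword_vword.
have hi' : (0 < i' < m)%N by rewrite /i'; case: ifP; lia.
have ia : i' != a by rewrite /i'; case: ifP; lia.
rewrite -!mulrA (zc (proj2 (andP hi'))) (mulrA (Fm g a)) -(comm_TFm hT hq) //; try lia.
rewrite !mulrA (comm_TFm hT hq) //; try lia.
rewrite -(mulrA _ (T i)) -(mulrA _ _ (T i')); congr (_ * _ * _ * _).
have p1 : pn w i.-1 = i'.-1 by rewrite pw wact_cw /i'; if_lia.
have p2 : pn w i = i' by rewrite pw wact_cw /i'; if_lia.
rewrite -(affTwS hT) //; last by rewrite p1 p2; lia.
rewrite -(affTwSr hT) //; last first.
  by rewrite -p1 -p2 !pnK; lia.
congr (Tw T _); apply: pn_ext => x _.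
rewrite !pnM !pn_sgen //; have [->|n1] := eqVneq x i.-1.
  by rewrite sw_pred p1 p2 sw_pred.
have [->|n2] := eqVneq x i; first by rewrite sw_self ?p1 ?p2 ?sw_self //; lia.
rewrite !sw_out //; first by rewrite -p1; apply: contra_neq n1; apply: pn_inj.
by rewrite -p2; apply: contra_neq n2; apply: pn_inj.
Qed.
End TwoBlocks.
End Affine.

(** * The element [v_b] *)

Section Composition.
Local Open Scope nat_scope.
Variable (b : seq nat).
Local Notation Sb := (bsum b 1).

Lemma Sb0 : Sb 0 = 0.
Proof. by rewrite /bsum big_geq. Qed.

Lemma SbS t : Sb t.+1 = Sb t + bt b t.+1.
Proof. by rewrite /bsum big_nat_recr. Qed.

Lemma Sb_pred t : 0 < t -> Sb t = Sb t.-1 + bt b t.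
Proof. by case: t => // t _; rewrite SbS. Qed.

Lemma Sb_mono s t : s <= t -> Sb s <= Sb t.
Proof.
by move=> /subnK <-; elim: (t - s) => // k IH; rewrite addSn SbS; lia.
Qed.

Lemma Sb_sumn : Sb (size b) = sumn b.
Proof.
rewrite sumnE /bsum big_add1 /= [RHS](big_nth 0).
by apply: eq_big_nat => i _; rewrite /bt.
Qed.

Lemma bsum_tail t p : t <= p -> bsum b t.+1 p = Sb p - Sb t.
Proof.
move=> h; have -> : Sb p = Sb t + bsum b t.+1 p by rewrite /bsum (big_cat_nat (n := t.+1)).
by rewrite addKn.
Qed.
End Composition.

Lemma iota1S t : iota 1 t.+1 = iota 1 t ++ [:: t.+1].
Proof. by rewrite -[t.+1 in LHS]addn1 iotaD add1n. Qed.

Lemma prod_intertw (A : pzRingType) (F G : nat -> A) y k :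
  (forall j, (j < k)%N -> F j * y = y * G j) ->
  (\prod_(0 <= j < k) F j) * y = y * \prod_(0 <= j < k) G j.
Proof.
elim: k => [|k IH] h; first by rewrite !big_nil mul1r mulr1.
rewrite !big_nat_recr //= -mulrA h // mulrA IH ?mulrA // => j hj.
by apply: h; apply: ltnW.
Qed.

Section Setup.
Variables (R : comUnitRingType) (A : algType R).
Variables (p n : nat) (eps q : R) (Q : seq R) (b : seq nat) (T : nat -> A).
Hypothesis p1 : (1 < p)%N.
Hypothesis hb : size b = p.
Hypothesis hbn : sumn b = n.
Hypothesis hq : q \is a GRing.unit.
Hypothesis hA : AK_rel q (Qr p eps Q) n T.

Local Notation J := (JM q T).
Local Notation Fm := (Fm q T).
Local Notation Sb := (bsum b 1).

Lemma AK_affine : affine q n T.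
Proof. by case: hA => _ *; split. Qed.
Local Notation hT := AK_affine.

Lemma Sb_p : Sb p = n.
Proof. by rewrite -hb Sb_sumn. Qed.

Lemma Sb_n t : (t <= p)%N -> (Sb t <= n)%N.
Proof. by move=> h; rewrite -Sb_p; apply: Sb_mono. Qed.

Definition rt (s : nat) : seq R := [seq eps ^+ s * Qi | Qi <- Q].
Definition rts (l : seq nat) : seq R := flatten [seq rt s | s <- l].

Lemma rts_cat l1 l2 : rts (l1 ++ l2) = rts l1 ++ rts l2.
Proof. by rewrite /rts map_cat flatten_cat. Qed.

Lemma rts1 s : rts [:: s] = rt s.
Proof. by rewrite /rts /= cats0. Qed.

Lemma Lij1 i j k : Lij p eps q Q T i j 1 k = Fm (rts (Iset p i j)) k.
Proof.
rewrite /Lij big_add1 /=; apply: eq_big_nat => l _.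
rewrite /ev /rts big_flatten big_map; apply: eq_bigr => s _.
by rewrite /Ls /rt big_map.
Qed.

Lemma Iset_low t : (1 < t <= p)%N -> Iset p 1 t.-1 = iota 1 t.-1.
Proof.
move=> h; rewrite /Iset /Defs.modp1; have -> : ((1 + p).-1 = p)%N by lia.
rewrite modnn; have -> : ((t.-1 + p).-1 %% p = t.-2)%N.
  have -> : (t.-1 + p).-1 = (p + t.-2)%N by lia.
  by rewrite modnDl modn_small //; lia.
have -> : (t.-1 = t.-2.+1)%N by lia.
by rewrite /= subSS subn0.
Qed.

Lemma Iset1 t : (0 < t <= p)%N -> Iset p t t = [:: t].
Proof.
move=> h; rewrite /Iset /Defs.modp1 leqnn subnn.
have -> : (t + p).-1 = (p + t.-1)%N by lia.
by rewrite modnDl modn_small /=; [congr [:: _] |]; lia.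
Qed.

Lemma Iset_compl t : (0 < t <= p)%N ->
  Iset p t.+1 (t + p).-1 = iota 1 t.-1 ++ iota t.+1 (p - t).
Proof.
move=> h; rewrite /Iset /Defs.modp1.
have -> : (t.+1 + p).-1 = (p + t)%N by lia.
have -> : ((t + p).-1 + p).-1 = (p + (t + p).-2)%N by lia.
rewrite !modnDl; have [tp|tp] := ltnP t p.
  rewrite modn_small //.
  have [->|t1] := eqVneq t 1%N.
    rewrite (_ : (1 + p).-2 = p.-1)%N ?modn_small; try lia.
    by rewrite ifT; [rewrite cat0s; congr iota|]; lia.
  have -> : (t + p).-2 = (p + t.-2)%N by lia.
  rewrite modnDl modn_small; last by lia.
  by rewrite ifF; [congr (iota _ _ ++ iota _ _)|]; lia.
have -> : t = p by lia.
rewrite modnn subnn cats0.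
have -> : (p + p).-2 = (p + p.-2)%N by lia.
rewrite modnDl modn_small; last by lia.
by rewrite /= subSS subn0 (_ : p.-1 = p.-2.+1) //; lia.
Qed.

(* [bX t] and [bU t] are the factors L^(1,t-1)_(1,b_t) T_(b_t,b_1^(t-1)) and
   L^(t)_(1,b_1^(t-1)) of v_b. *)
Definition bX (t : nat) : A :=
  locked (Fm (rts (iota 1 t.-1)) (bt b t) * tprod T (cw 0 (bt b t) (Sb t.-1))).
Definition bU (t : nat) : A := Fm (rt t) (Sb t.-1).
Definition pX (t : nat) : A := \prod_(s <- rev (iota 1 t)) bX s.
Definition pU (t : nat) : A := \prod_(s <- iota 1 t) bU s.
(** The part of [v_b] made from the first [t] blocks. The factors [bX 1] and [bU 1] are 1, since
    [b_1^0 = 0] and no root precedes the first block, so the products may start at 1. *)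
Definition vt (t : nat) : A := locked (pX t * pU t).
(** The factors of [v_b] to the right of [vt t]: they commute with the generators on the first [t]
    blocks and supply the roots missing from the order relation. *)
Definition zt (t : nat) : A := \prod_(s <- iota t.+1 (p - t)) bU s.

Lemma bXdef t : bX t =
  Fm (rts (iota 1 t.-1)) (bt b t) * tprod T (cw 0 (bt b t) (Sb t.-1)).
Proof. by rewrite /bX -lock. Qed.

Lemma vtdef t : vt t = pX t * pU t.
Proof. by rewrite /vt -lock. Qed.

Lemma pXS t : pX t.+1 = bX t.+1 * pX t.
Proof. by rewrite /pX iota1S rev_cat big_cat /= big_seq1. Qed.

Lemma pUS t : pU t.+1 = pU t * bU t.+1.
Proof. by rewrite /pU iota1S big_cat /= big_seq1. Qed.

Lemma vtS t : vt t.+1 = bX t.+1 * vt t * bU t.+1.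
Proof. by rewrite !vtdef pXS pUS !mulrA. Qed.

Lemma vt0 : vt 0 = 1.
Proof. by rewrite vtdef /pX /pU /= !big_nil mulr1. Qed.

Lemma vt_tail s : (s <= p)%N ->
  vt p = \prod_(k <- rev (iota s.+1 (p - s))) bX k * (vt s * zt s).
Proof.
move=> sp; rewrite !vtdef /pX /pU /zt; have {1 2}-> : p = (s + (p - s))%N by lia.
by rewrite !iotaD rev_cat !big_cat /= add1n !mulrA.
Qed.

Lemma zt_p : zt p = 1.
Proof. by rewrite /zt subnn big_nil. Qed.

Lemma ztS t : (t < p)%N -> zt t = bU t.+1 * zt t.+1.
Proof.
move=> h; rewrite /zt; have -> : (p - t = (p - t.+1).+1)%N by lia.
by rewrite /= big_cons.
Qed.

Lemma bU_central s t : (t < s <= p)%N -> central_upto T (Sb t) (bU s).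
Proof.
move=> h i hi; apply/commr_sym/(comm_TFm hT hq).
- by apply: leq_trans hi (Sb_n _); lia.
- by apply: Sb_n; lia.
have : (Sb t <= Sb s.-1)%N by apply: Sb_mono; lia.
lia.
Qed.

Lemma zt_central t : (t <= p)%N -> central_upto T (Sb t) (zt t).
Proof.
move=> h i hi; apply/commr_sym/commr_prod_seq => s; rewrite mem_iota => hs.
by apply/commr_sym/(bU_central (t := t)) => //; lia.
Qed.

Lemma in_gens_tprod k s : all (fun i => i < k)%N s -> in_gens T k (tprod T s).
Proof. by move=> /allP h; apply: in_gens_prod => i /h; apply: in_gensT. Qed.

Lemma in_gensFmW rs k l : (k <= l)%N -> in_gens T l (Fm rs k).
Proof. by move=> kl; apply: (in_gensW kl); apply: in_gensFm. Qed.

Lemma in_gens_bX t : (0 < t)%N -> in_gens T (Sb t) (bX t).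
Proof.
move=> t0; rewrite bXdef; apply: in_gensM.
  by apply: in_gensFmW; rewrite (Sb_pred _ t0); lia.
by apply: in_gens_tprod; apply/allP => i /mem_cw; rewrite (Sb_pred _ t0); lia.
Qed.

Lemma in_gens_pX t : in_gens T (Sb t) (pX t).
Proof.
apply: in_gens_prod => s; rewrite mem_rev mem_iota => hs.
by apply: (@in_gensW _ _ _ (Sb s)); [apply: Sb_mono; lia | apply: in_gens_bX; lia].
Qed.

Lemma in_gens_vt t : in_gens T (Sb t) (vt t).
Proof.
rewrite vtdef; apply: in_gensM; first exact: in_gens_pX.
apply: in_gens_prod => s; rewrite mem_iota => hs.
by apply: in_gensFmW; apply: Sb_mono; lia.
Qed.

Lemma in_gens_vtW s t : (s <= t)%N -> in_gens T (Sb t) (vt s).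
Proof. by move=> st; apply: (in_gensW (Sb_mono b st)); apply: in_gens_vt. Qed.

Lemma tprod_cw k c a : (k + c + a <= n)%N ->
  Tw T (wprod (k + c + a) (cw k c a)) = tprod T (cw k c a).
Proof.
move=> h; apply: (affTw_word (affine_sub hT h)).
exact: rword_cw.
Qed.

Lemma Fm_recl' rs k : (0 < k <= n)%N ->
  exists2 r, Fm rs k = r * ev rs (T 0%N) & comm (T 0%N) r.
Proof. by case/andP=> *; apply: (Fm_recl hT). Qed.

(** Downward induction from the order relation of the whole algebra at [t = p]. As [Sb t > 0], the
    product [bU t.+1] has a factor at the first strand, and its roots are exactly those by which the
    two lists differ. *)
Lemma order_zt t : (t <= p)%N -> (0 < Sb t)%N ->
  ev (rts (iota 1 t)) (T 0%N) * zt t = 0.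
Proof.
move=> tp; rewrite -(subKn tp); elim: (p - t)%N => [|k IH].
  rewrite subn0 zt_p mulr1 Sb_p => n0; case: hA => h _ _ _ _.
  exact: h.
have [kp|kp] := ltnP k p; last first.
  by have -> : (p - k.+1 = p - k)%N by lia.
move=> h; set t' := (p - k.+1)%N in h *.
have e : (p - k = t'.+1)%N by rewrite /t'; lia.
have t'p : (t' < p)%N by rewrite /t'; lia.
have [r er cr] : exists2 r, bU t'.+1 = r * ev (rt t'.+1) (T 0%N) & comm (T 0%N) r.
  by apply: Fm_recl'; rewrite h Sb_n // ltnW.
rewrite ztS // er -mulrA mulrA (ev_intertw (y := r) _ cr) -mulrA mulrA -!mulrA (mulrA (ev _ _)).
rewrite -ev_cat; have -> : rts (iota 1 t') ++ rt t'.+1 = rts (iota 1 t'.+1).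
  by rewrite iota1S rts_cat rts1.
by rewrite -e IH ?mulr0 // e SbS; lia.
Qed.

Lemma AK_affine_sub m : (m <= n)%N -> affine q m T.
Proof. exact: affine_sub hT _. Qed.

Section BlockStep.
Variable t : nat.
Hypothesis tp : (t < p)%N.
Let c := bt b t.+1.
Let a := Sb t.
Let Sm : Sb t.+1 = (c + a)%N. Proof. by rewrite SbS addnC. Qed.
Let ca : (c + a <= n)%N. Proof. by rewrite -Sm; apply: Sb_n. Qed.

Lemma bXE : bX t.+1 = Fm (rts (iota 1 t)) c * Tw T (wprod (c + a) (cw 0 c a)).
Proof. by rewrite bXdef [Tw _ _](@tprod_cw 0 c a). Qed.

Lemma order_step : (0 < c + a)%N ->
  ev (rts (iota 1 t)) (T 0%N) * ev (rt t.+1) (T 0%N) * zt t.+1 = 0.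
Proof.
move=> h; rewrite -ev_cat.
have -> : rts (iota 1 t) ++ rt t.+1 = rts (iota 1 t.+1).
  by rewrite iota1S rts_cat rts1.
by apply: order_zt => //; rewrite Sm.
Qed.

Lemma bX_J x : (x < c + a)%N ->
  J x * (bX t.+1 * bU t.+1 * zt t.+1) = bX t.+1 * bU t.+1 * zt t.+1 * J (wact (cw 0 c a) x).
Proof.
move=> hx; rewrite bXE; apply: (twoblocks_J hq (AK_affine_sub ca) erefl) => //.
  by rewrite -Sm; apply: zt_central.
exact: order_step.
Qed.

Lemma bX_T i : (0 < i < c + a)%N -> i != c ->
  T i * (bX t.+1 * bU t.+1 * zt t.+1) =
  bX t.+1 * bU t.+1 * zt t.+1 * T (if (i < c)%N then i + a else i - c)%N.
Proof.
move=> hi ic; rewrite bXE; apply: (twoblocks_T hq (AK_affine_sub ca) erefl) => //.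
  by rewrite -Sm; apply: zt_central.
exact: order_step.
Qed.

Lemma vtzE : vt t.+1 * zt t.+1 = bX t.+1 * bU t.+1 * zt t.+1 * vt t.
Proof.
have c1 : bU t.+1 * vt t = vt t * bU t.+1.
  by apply: in_gens_vt; apply: bU_central; rewrite ltnSn.
have c2 : zt t.+1 * vt t = vt t * zt t.+1.
  by apply: (in_gens_vtW (leqnSn t)); apply: zt_central.
by rewrite vtS -(mulrA _ (zt _)) c2 mulrA -(mulrA _ (bU _) (vt t)) c1 mulrA.
Qed.

(** Chains a relation for the outermost pair of blocks with one for [vt t * zt t]; the condition on
    [Y'] lets it pass [zt t], which must be brought next to [vt t]. *)
Lemma vt_zt_step Y Y' Y'' : in_gens T (Sb t) Y' ->
  Y * (bX t.+1 * bU t.+1 * zt t.+1) = bX t.+1 * bU t.+1 * zt t.+1 * Y' ->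
  Y' * (vt t * zt t) = vt t * zt t * Y'' ->
  Y * (vt t.+1 * zt t.+1) = vt t.+1 * zt t.+1 * Y''.
Proof.
move=> gY' e1 e2; rewrite vtzE mulrA e1.
have -> : bX t.+1 * bU t.+1 * zt t.+1 = bX t.+1 * zt t by rewrite (ztS tp) mulrA.
have zc := zt_central (ltnW tp).
have c1 : zt t * vt t = vt t * zt t by apply: in_gens_vt zc.
have c2 : zt t * Y' = Y' * zt t by apply: gY' zc.
have -> : bX t.+1 * zt t * Y' * vt t = bX t.+1 * (zt t * Y' * vt t) by rewrite !mulrA.
by rewrite c2 -(mulrA Y') c1 e2 -c1 !mulrA.
Qed.
End BlockStep.

(** On the right the blocks stand in the order 1, ..., t, on the left in reverse order, so block [s]
    starts there at [Sb t - Sb s]. The newest block is in front on the left, and its Jucys-Murphy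
    elements on the right commute with [vt t]. *)
Lemma vt_zt_J t s j : (0 < s <= t)%N -> (t <= p)%N -> (j < bt b s)%N ->
  J (Sb t - Sb s + j) * (vt t * zt t) = vt t * zt t * J (Sb s.-1 + j).
Proof.
elim: t => [|t IH] st tp hj; first by lia.
have [est|nst] := eqVneq s t.+1.
  subst s; rewrite subnn add0n vtzE // mulrA bX_J //; last by lia.
  rewrite -!mulrA; do 3!congr (_ * _).
  have -> : wact (cw 0 (bt b t.+1) (Sb t)) j = (Sb t + j)%N by rewrite wact_cw ifT; lia.
  apply: in_gens_vt => i hi; apply: (central_J hT); last by lia.
  by have := Sb_n tp; rewrite SbS; lia.
have h1 : (Sb s = Sb s.-1 + bt b s)%N by apply: Sb_pred; lia.
have h2 : (Sb s <= Sb t)%N by apply: Sb_mono; lia.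
apply: (vt_zt_step tp (Y' := J (Sb t - Sb s + j))); last by apply: IH; lia.
  by apply: in_gensJ; lia.
rewrite SbS bX_J //; last by lia.
have -> // : wact (cw 0 (bt b t.+1) (Sb t)) (Sb t + bt b t.+1 - Sb s + j) = (Sb t - Sb s + j)%N.
by rewrite wact_cw; if_lia.
Qed.

Lemma vt_zt_T t s i : (0 < s <= t)%N -> (t <= p)%N -> (0 < i < bt b s)%N ->
  T (Sb t - Sb s + i)%N * (vt t * zt t) = vt t * zt t * T (Sb s.-1 + i)%N.
Proof.
elim: t => [|t IH] st tp hi; first by lia.
have [est|nst] := eqVneq s t.+1.
  subst s; rewrite subnn add0n vtzE // mulrA bX_T //; try lia.
  rewrite -!mulrA; do 3!congr (_ * _); rewrite ifT; last by lia.
  rewrite addnC; apply: in_gens_vt => k hk; apply/commr_sym/(Tcomm hT).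
  - by have := Sb_n tp; rewrite SbS; lia.
  - by have := Sb_n tp; rewrite SbS; lia.
  by lia.
have h1 : (Sb s = Sb s.-1 + bt b s)%N by apply: Sb_pred; lia.
have h2 : (Sb s <= Sb t)%N by apply: Sb_mono; lia.
apply: (vt_zt_step tp (Y' := T (Sb t - Sb s + i)%N)); last by apply: IH; lia.
  by apply: in_gensT; lia.
rewrite SbS bX_T //; try lia.
by rewrite ifF; [congr (_ * T _)|]; lia.
Qed.

Local Notation v := (vt p).

Lemma v_J s j : (0 < s <= p)%N -> (j < bt b s)%N ->
  J (bsum b s.+1 p + j) * v = v * J (Sb s.-1 + j).
Proof.
move=> sp hj; have := vt_zt_J sp (leqnn p) hj.
have s_p : (s <= p)%N by lia.
by rewrite zt_p !mulr1 (bsum_tail _ s_p).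
Qed.

Lemma v_T s i : (0 < s <= p)%N -> (0 < i < bt b s)%N ->
  T (bsum b s.+1 p + i)%N * v = v * T (Sb s.-1 + i)%N.
Proof.
move=> sp hi; have := vt_zt_T sp (leqnn p) hi.
have s_p : (s <= p)%N by lia.
by rewrite zt_p !mulr1 (bsum_tail _ s_p).
Qed.

(** Moved to the left across [vt s * zt s], the relation arrives at the first strand. There its
    roots join those of index below [s] contained in [bX s], and [zt s] kills the complete list. *)
Lemma v_order s : (0 < s <= p)%N -> (0 < bt b s)%N -> v * ev (rt s) (J (Sb s.-1)) = 0.
Proof.
move=> sp hs; have s0 : (0 < s)%N by lia.
rewrite (vt_tail (s := s)); last by lia.
rewrite -mulrA; have := vt_zt_J (t := s) (s := s) (j := 0) _ _ hs.
rewrite subnn !addn0 leqnn s0 => /(_ erefl _)/ev_intertw <-; last by lia.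
rewrite [X in _ * X](_ : _ = 0) ?mulr0 //.
case: s s0 sp hs => // s _ sp hs.
have sp' : (s.+1 <= p)%N by lia.
have [r er cr] : exists2 r, Fm (rts (iota 1 s)) (bt b s.+1) = r * ev (rts (iota 1 s)) (T 0%N) & comm (T 0%N) r.
  by apply: Fm_recl'; have := Sb_n sp'; rewrite SbS; lia.
set w := tprod T (cw 0 (bt b s.+1) (Sb s)) * vt s * bU s.+1.
have gw : in_gens T (Sb s.+1) w.
  apply: in_gensM; first apply: in_gensM.
  - by apply: in_gens_tprod; apply/allP => i /mem_cw; rewrite SbS; lia.
  - exact: in_gens_vtW.
  by apply: in_gensFmW; apply: Sb_mono.
have -> : vt s.+1 * zt s.+1 = r * ev (rts (iota 1 s)) (T 0%N) * zt s.+1 * w.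
  have zw : zt s.+1 * w = w * zt s.+1 by apply: gw (zt_central sp').
  by rewrite -(mulrA _ (zt _)) zw vtS bXdef er /w !mulrA.
have e : ev (rt s.+1) (T 0%N) * ev (rts (iota 1 s)) (T 0%N) * zt s.+1 = 0.
  rewrite -ev_cat (ev_perm (rs2 := rts (iota 1 s.+1))); last first.
    by rewrite iota1S rts_cat rts1 perm_catC.
  by apply: order_zt; rewrite ?SbS //; lia.
rewrite !mulrA (ev_intertw (y := r) _ cr) -(mulrA r) -(mulrA r) e.
by rewrite mulr0 !mul0r.
Qed.

(** * The factorisation of [v_b T_b] *)

Definition bD (t : nat) : A := tprod T (cw (Sb t.-1) (bt b t) (n - Sb t)).
Definition pD (t : nat) : A := \prod_(s <- rev (iota 1 t)) bD s.

Lemma pDS t : pD t.+1 = bD t.+1 * pD t.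
Proof. by rewrite /pD iota1S rev_cat big_cat /= big_seq1. Qed.

Lemma YtE t : (0 < t <= p)%N -> Yt p n eps q Q b T t =
  Fm (rts (iota 1 t.-1 ++ iota t.+1 (p - t))) (bt b t) * tprod T (cw 0 (bt b t) (n - bt b t)).
Proof.
move=> tp; have ht : (bt b t <= n)%N.
  have := Sb_n (proj2 (andP tp)); rewrite Sb_pred; lia.
rewrite /Yt Lij1 Iset_compl // /Tab /wab wkE; last by lia.
by rewrite (affTw_word hT) //; apply: rword_cw; lia.
Qed.

(** The middle factor supplies the roots of index above [t], which occur in each of [Y_1, ..., Y_t]
    but not in [vt t]; it is trivial for [t = p]. *)
Lemma vt_pD t : (t <= p)%N ->
  vt t * Fm (rts (iota t.+1 (p - t))) (Sb t) * pD t =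
  \prod_(s <- rev (iota 1 t)) Yt p n eps q Q b T s.
Proof.
elim: t => [|t IH] tp.
  by rewrite Sb0 vt0 FmE /pD /= !big_nil !mulr1.
rewrite iota1S rev_cat big_cat /= big_seq1 -IH; last by lia.
set c := bt b t.+1; set a := Sb t; set R' := rts (iota t.+2 _).
have Sm : Sb t.+1 = (c + a)%N by rewrite SbS addnC.
have ca : (c + a <= n)%N by rewrite -Sm; apply: Sb_n.
have split k : Fm R' (k + a) = Fm R' k * \prod_(k <= j < k + a) ev R' (J j).
  by rewrite FmE (big_cat_nat (n := k)) //= leq_addr.
set w := tprod T (cw 0 c a).
have bXe : bX t.+1 = Fm (rts (iota 1 t)) c * w by rewrite bXdef.
have gv : in_gens T a (vt t) by exact: in_gens_vt.
have gX : in_gens T (c + a) (bX t.+1 * bU t.+1 * vt t).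
  rewrite -Sm; apply: in_gensM; last exact: in_gens_vtW.
  by apply: in_gensM; [apply: in_gens_bX | apply: in_gensFmW; apply: Sb_mono].
have c1 : vt t * bU t.+1 = bU t.+1 * vt t.
  by symmetry; apply: gv; apply: bU_central; rewrite ltnSn.
have cen : central_upto T (c + a) (Fm R' (c + a)).
  move=> i hi; apply/commr_sym/(comm_TFm hT hq) => //; lia.
(* The factors of [Fm R'] at the first [c] strands join those of [bX t.+1] to form the root list of
   [Y_(t+1)]. The other [a] move to the right by the two-block relation, with [z = 1] because now
   [f] and [g] contain all roots. *)
have key : Fm R' (c + a) * (bX t.+1 * bU t.+1) =
    Fm (rts (iota 1 t) ++ R') c * w * bU t.+1 * Fm R' a.
  have ew : w = Tw T (wprod (c + a) (cw 0 c a)) by rewrite [RHS](@tprod_cw 0 c a).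
  have tb j : (c <= j < c + a)%N ->
      J j * (Fm (rts (iota 1 t) ++ R') c * w * bU t.+1) =
      Fm (rts (iota 1 t) ++ R') c * w * bU t.+1 * J (j - c).
    move=> hj; have := twoblocks_J hq (AK_affine_sub ca) (c := c) (a := a)
      (f := rts (iota 1 t) ++ R') (g := rt t.+1) (z := 1) erefl.
    rewrite -ew !mulr1 => /(_ _ _ j) ->; rewrite ?mulr1 //; try lia.
    - by rewrite wact_cw ifF ?ifT //; lia.
    - by move=> i _; apply/commr_sym/commr1.
    move=> h; rewrite -ev_cat (ev_perm (rs2 := rts (iota 1 p))).
      by have := order_zt (leqnn p); rewrite zt_p mulr1; apply; rewrite Sb_p; lia.
    have -> : iota 1 p = iota 1 t.+1 ++ iota t.+2 (p - t.+1).
      by rewrite -[t.+2]add1n -iotaD subnKC.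
    by rewrite iota1S !rts_cat rts1 -!catA perm_cat2l perm_catC.
  have cF : \prod_(c <= j < c + a) ev R' (J j) * Fm R' c = Fm R' c * \prod_(c <= j < c + a) ev R' (J j).
    symmetry; apply: commr_prod_seq => j; rewrite mem_index_iota => hj.
    by apply/comm_ev/commr_sym/(comm_FmJ hT); lia.
  have cT : \prod_(c <= j < c + a) ev R' (J j) * (Fm (rts (iota 1 t) ++ R') c * w * bU t.+1) =
      Fm (rts (iota 1 t) ++ R') c * w * bU t.+1 * Fm R' a.
    have -> : \prod_(c <= j < c + a) ev R' (J j) = \prod_(0 <= j < a) ev R' (J (j + c)).
      by rewrite -{1}(add0n c) big_addn addKn.
    apply: prod_intertw => j hj.
    by apply: ev_intertw; rewrite tb ?addnK //; lia.
  have cF' : Fm R' c * Fm (rts (iota 1 t)) c = Fm (rts (iota 1 t)) c * Fm R' c.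
    by apply: (comm_FmFm hT); lia.
  rewrite -cT split bXe (Fm_cat hT); last by lia.
  by rewrite -cF' !mulrA cF.
have cw' : vt t.+1 * Fm R' (Sb t.+1) * pD t.+1 =
    Fm R' (c + a) * (bX t.+1 * bU t.+1) * vt t * pD t.+1.
  rewrite vtS Sm; congr (_ * _); rewrite -(mulrA (bX _)) c1 mulrA.
  by rewrite -[RHS]mulrA; symmetry; apply: gX cen.
have gD : comm (bD t.+1) (vt t * Fm (rts (iota t.+1 (p - t))) a).
  have cD : central_upto T a (bD t.+1).
    move=> i hi; apply/commr_sym; apply: commr_prod_seq => j /mem_cw.
    by rewrite /= -/a -/c Sm => hj; apply: (Tcomm hT); lia.
  by apply: commrM; [apply: gv | apply: in_gensFm].
have eF : bU t.+1 * Fm R' a = Fm (rts (iota t.+1 (p - t))) a.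
  have -> : (p - t = (p - t.+1).+1)%N by lia.
  by rewrite /= -cat1s rts_cat rts1 (Fm_cat hT) //; lia.
rewrite cw' key pDS YtE; last by lia.
have eR : rts (iota 1 t.+1.-1 ++ iota t.+2 (p - t.+1)) = rts (iota 1 t) ++ R'.
  by rewrite rts_cat.
(* The [c] strands pass first the [a] earlier strands and then the remaining ones. *)
have ew : tprod T (cw 0 c (n - c)) = w * bD t.+1.
  have -> : (n - c = a + (n - Sb t.+1))%N by lia.
  by rewrite cwD add0n tprod_cat.
rewrite eR ew -!mulrA; congr (_ * (_ * _)).
set Z := Fm (rts (iota t.+1 (p - t))) a in eF gD *.
have cZ : Z * vt t = vt t * Z.
  by apply: gv => i hi; apply/commr_sym/(comm_TFm hT hq); lia.
by rewrite (mulrA (bU _)) eF (mulrA Z (vt t)) cZ (mulrA _ (bD _)) -gD !mulrA.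
Qed.

Lemma Fm_nil k : Fm [::] k = 1.
Proof. by rewrite FmE big1 // => i _; rewrite /ev big_nil. Qed.

Lemma vbE : vb p n eps q Q b T = vt p.
Proof.
have e1 : pX p = \prod_(s <- rev (iota 2 p.-1)) bX s.
  rewrite /pX; have -> : p = p.-1.+1 by lia.
  rewrite /= rev_cons -cats1 big_cat /= big_seq1 bXdef /= Sb0 cw0.
  by rewrite /tprod big_nil Fm_nil !mulr1.
have e2 : pU p = \prod_(s <- iota 2 p.-1) bU s.
  have -> : pU p = bU 1 * \prod_(s <- iota 2 p.-1) bU s.
    by rewrite /pU -[in LHS](prednK (ltnW p1)) /= big_cons.
  by rewrite /bU [Sb _]Sb0 Fm0 mul1r.
rewrite vtdef e1 e2 /vb; congr (_ * _); rewrite !big_seq; apply: eq_bigr => s.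
  rewrite mem_rev mem_iota => hs; rewrite Lij1 Iset_low; last by lia.
  rewrite bXdef /Tab /wab; congr (_ * _).
  have h : (0 + bt b s + Sb s.-1 <= n)%N.
    have sp : (s <= p)%N by lia.
    by have := Sb_n sp; rewrite Sb_pred; lia.
  by rewrite wkE // (affTw_word hT) //; apply: rword_cw.
by rewrite mem_iota => hs; rewrite Lij1 Iset1 ?rts1 //; lia.
Qed.

Lemma vt_pD_p : vt p * pD p = Yprod p n eps q Q b T.
Proof.
rewrite /Yprod -vt_pD //.
by rewrite subnn Fm_nil mulr1.
Qed.

End Setup.

(** * The permutation [w_b] *)

Section ShiftWord.
Local Open Scope nat_scope.

Lemma wact_shift k s x : all (fun i => 0 < i) s ->
  wact [seq i + k | i <- s] (x + k) = wact s x + k.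
Proof.
elim: s x => [|i s IH] x //= /andP[i0 hs]; rewrite -IH //; congr wact.
by sw_lia.
Qed.

Lemma vword_pos m s : vword m s -> all (fun i => 0 < i) s.
Proof. by apply: sub_all => i /andP[]. Qed.

Lemma rword_shift m n k s : k + m <= n -> rword m s -> rword n [seq i + k | i <- s].
Proof.
move=> h; elim: s => [|i s IH]; first by rewrite /rword /= !len1.
rewrite /= !rword_cons => /and3P[hi rs lt]; have rs' := IH rs.
rewrite rs' !pn_wprod ?(rword_vword rs') //=.
move: lt; rewrite !pn_wprod ?(rword_vword rs) // => lt.
have e : (i + k).-1 = i.-1 + k by lia.
rewrite e !wact_shift ?(vword_pos (rword_vword rs)) //; lia.
Qed.
End ShiftWord.

Section Wb.
Local Open Scope nat_scope.
Variables (p n : nat) (b : seq nat).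
Hypothesis p1 : 1 < p.
Hypothesis hb : size b = p.
Hypothesis hbn : sumn b = n.
Local Notation Sb := (bsum b 1).

(** The first [k] blocks are sent to the end in reverse order and the other strands move down by
    [Sb k]. A factor for block [p] would be trivial, so [wb] stops at [p - 1]. *)
Definition wbp (k : nat) : 'S_n :=
  (\prod_(t <- rev (iota 1 k)) wk n (Sb t.-1) (bt b t) (bsum b t.+1 p))%g.

Lemma wbp0 : wbp 0 = 1%g.
Proof. by rewrite /wbp big_nil. Qed.

Lemma wbpS k : wbp k.+1 = (wk n (Sb k) (bt b k.+1) (bsum b k.+2 p) * wbp k)%g.
Proof. by rewrite /wbp iota1S rev_cat big_cat /= big_seq1. Qed.

Lemma pn_wk k x : k < p -> pn (wk n (Sb k) (bt b k.+1) (bsum b k.+2 p)) x =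
  wact (cw (Sb k) (bt b k.+1) (n - Sb k.+1)) x.
Proof.
move=> kp; have := Sb_n hb hbn kp; have := SbS b k => e h.
have -> : bsum b k.+2 p = n - Sb k.+1 by rewrite (bsum_tail _ kp) (Sb_p hb hbn).
by rewrite wkE ?pn_wprod ?vword_cw //; lia.
Qed.

Lemma pn_wbp_ge k x : k <= p -> Sb k <= x < n -> pn (wbp k) x = x - Sb k.
Proof.
elim: k x => [|k IH] x kp hx.
  by rewrite /wbp big_nil pn1 Sb0 subn0.
have e := SbS b k; have h := Sb_n hb hbn kp.
rewrite wbpS pnM pn_wk // wact_cw ifF; last by lia.
rewrite ifT; last by lia.
by rewrite IH; lia.
Qed.

Lemma pn_wbp_block k s j : 0 < s <= k -> k <= p -> j < bt b s ->
  pn (wbp k) (Sb s.-1 + j) = n - Sb s + j.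
Proof.
elim: k => [|k IH] sk kp hj; first by lia.
have e := SbS b k; have h := Sb_n hb hbn kp.
rewrite wbpS pnM pn_wk // wact_cw.
have [es|ns] := eqVneq s k.+1.
  subst s; rewrite ifT; last by rewrite /=; lia.
  by rewrite pn_wbp_ge /=; lia.
have h1 : Sb s = Sb s.-1 + bt b s by apply: Sb_pred; lia.
have h2 : Sb s <= Sb k by apply: Sb_mono; lia.
by rewrite ifF ?ifF ?IH //; lia.
Qed.

Lemma pn_wb_block s j : 0 < s <= p -> j < bt b s ->
  pn (wb p n b) (Sb s.-1 + j) = bsum b s.+1 p + j.
Proof.
move=> sp hj; have s_p : s <= p by lia.
rewrite -/(wbp p.-1) (bsum_tail _ s_p) (Sb_p hb hbn).
have h1 : Sb s = Sb s.-1 + bt b s by apply: Sb_pred; lia.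
have h2 : Sb s <= n by apply: (Sb_n hb hbn); lia.
have [es|ns] := eqVneq s p; last by apply: pn_wbp_block; lia.
have e : Sb s.-1 = Sb p.-1 by rewrite es.
have e2 : Sb s = n by rewrite es (Sb_p hb hbn).
by rewrite pn_wbp_ge -?e; lia.
Qed.

(** On each block [w_b] is a translation, so conjugation turns simple reflections inside a block
    into simple reflections, letter by letter. *)
Lemma xconjE (t : 'I_p) (x : 'S_(bo b t)) :
  xconj p n b t x = wprod n [seq i + bsum b t.+2 p | i <- redword (bo b t) x].
Proof.
have [/rword_vword vx _] := redwordP x.
rewrite /xconj /xshift; elim: (redword _ _) vx => [|i s IH] /=.
  by rewrite mulg1 mulVg.
case/andP=> hi /IH <-; rewrite !mulgA; congr (_ * _ * _)%g.
have tp : t < p by [].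
have bnd : bsum b t.+2 p + bt b t.+1 <= n.
  rewrite (bsum_tail _ tp) (Sb_p hb hbn); have := Sb_n hb hbn tp; have := SbS b t; lia.
have hi' : 0 < i < bt b t.+1 by exact: hi.
have bnd2 : Sb t + bt b t.+1 <= n by rewrite -SbS; apply: (Sb_n hb hbn).
apply: pn_ext => y hy; rewrite -(pnKV (wb p n b) y); set z := pn _^-1%g y.
apply: (@pn_inj _ (wb p n b)); rewrite !pnM pnKV pnK !pn_sgen; [|lia|lia].
have e1 : pn (wb p n b) (i + Sb t) = i + bsum b t.+2 p.
  by rewrite addnC (@pn_wb_block t.+1) // 1?addnC //; lia.
have e2 : pn (wb p n b) (i + Sb t).-1 = (i + bsum b t.+2 p).-1.
  have -> : (i + Sb t).-1 = Sb t + i.-1 by lia.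
  rewrite (@pn_wb_block t.+1) //; lia.
have [->|n1] := eqVneq z (i + Sb t).-1; first by rewrite e2 !sw_pred e1.
have [->|n2] := eqVneq z (i + Sb t); first by rewrite e1 !sw_self ?e2 //; lia.
rewrite !sw_out //; first by rewrite -e2; apply: contra_neq n1 => /pn_inj.
by rewrite -e1; apply: contra_neq n2 => /pn_inj.
Qed.
Definition bk (s : nat) : nat := bsum b s.+1 p.

Lemma bk_bound s : (0 < s <= p) -> (bk s + bt b s <= n).
Proof.
move=> hs; have s_p : (s <= p) by lia.
rewrite /bk (bsum_tail _ s_p) (Sb_p hb hbn).
have s0 : (0 < s) by lia.
by have := Sb_n hb hbn s_p; have := Sb_pred b s0; lia.
Qed.

Lemma bk_disjoint s s' : (0 < s < s') -> (s' <= p) -> (bk s' + bt b s' <= bk s).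
Proof.
move=> hs hs'; have s_p : (s <= p) by lia.
rewrite /bk (bsum_tail _ s_p) (bsum_tail _ hs') (Sb_p hb hbn).
have s0 : (0 < s') by lia.
have := Sb_n hb hbn hs'; have := Sb_pred b s0.
have : (Sb s <= Sb s'.-1) by apply: Sb_mono; lia.
lia.
Qed.

Lemma bk_disjoint' s s' : (0 < s <= p) -> (0 < s' <= p) -> s != s' ->
  (bk s' + bt b s' <= bk s) \/ (bk s + bt b s <= bk s').
Proof.
move=> hs hs' ns; case: (ltngtP s s') => h; last by rewrite h eqxx in ns.
  by left; apply: bk_disjoint; lia.
by right; apply: bk_disjoint; lia.
Qed.

End Wb.

(** * Commuting shifted copies of the block generators *)

Section InGens.
Variables (R : comUnitRingType) (A : algType R) (q : R).

Lemma in_gens_Tw m (U : nat -> A) (w : 'S_m) : in_gens U m (Tw U w).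
Proof.
apply: in_gens_prod => i hi; apply: in_gensT.
by have [/rword_vword/allP/(_ _ hi) ? _] := redwordP w; lia.
Qed.

Lemma in_gens_AK m d (U : nat -> A) x : in_gens U m (AK_bas q d m U x).
Proof.
apply: in_gensM; last exact: in_gens_Tw.
move=> y hy; apply: commr_prod_seq => j _.
apply: commrX; have g : in_gens U m (JM q U j) by apply: in_gensJ.
exact: g.
Qed.

End InGens.

Section ShiftedGens.
Variables (R : comUnitRingType) (A : algType R) (n : nat) (q : R) (T : nat -> A).
Hypothesis hq : q \is a GRing.unit.
Hypothesis hT : affine q n T.
Local Notation J := (JM q T).

(* the generators of the copy of [H_{d,c}] acting on the strands [k+1, ..., k+c] *)
Definition shg (k i : nat) : A := if i == 0%N then J k else T (k + i)%N.

Lemma JM_shg k j : JM q (shg k) j = J (k + j).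
Proof.
elim: j => [|j IH]; first by rewrite addn0.
by rewrite /= IH /shg /= addnS.
Qed.

Lemma shg_affine k c : (k + c <= n)%N -> affine q c (shg k).
Proof.
move=> bd; split.
- case=> // i hi; case: hT => h _ _ _; rewrite /shg /=; apply: h; lia.
- move=> h; rewrite /shg /= addn1.
  (* The four-term relation of the shifted copy expresses that two consecutive Jucys-Murphy elements
     commute. *)
  have c1 : comm (J k) (T k.+1 * J k * T k.+1).
    have -> : T k.+1 * J k * T k.+1 = q *: J k.+1.
      by rewrite JS scalerA mulrV // scale1r.
    by apply/commrZ/(JJ hT); lia.
  by move: c1; rewrite /comm !mulrA.
- case=> // i _ hi; rewrite /shg /= !addnS; apply: (Tbraid hT); lia.
case=> [|i] j hi hj ij; rewrite /shg /=.
  rewrite ifN; last by lia.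
  by apply/commr_sym/(TJ_comm hT); lia.
by rewrite ifN; [apply: (Tcomm hT)|]; lia.
Qed.

Lemma shg_comm k c k' c' i j : (k + c <= n)%N -> (k' + c' <= n)%N ->
  (k' + c' <= k)%N \/ (k + c <= k')%N -> (i < c)%N -> (j < c')%N ->
  comm (shg k i) (shg k' j).
Proof.
move=> b1 b2 d hi hj; rewrite /shg; case: eqP => i0; case: eqP => j0.
- by apply: (JJ hT); lia.
- by apply/commr_sym/(TJ_comm hT); lia.
- by apply: (TJ_comm hT); lia.
have [h|h] : (k' + j < k + i)%N \/ (k + i < k' + j)%N by lia.
  by apply/commr_sym/(Tcomm hT); lia.
by apply: (Tcomm hT); lia.
Qed.

Lemma Tw_shg k c (x : 'S_c) : (k + c <= n)%N ->
  Tw (shg k) x = Tw T (wprod n [seq (i + k)%N | i <- redword c x]).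
Proof.
move=> h; have [rx _] := redwordP x; rewrite (affTw_word hT); last exact: rword_shift rx.
rewrite /tprod big_map /Tw; apply: eq_big_seq => i hi.
have /rword_vword/allP/(_ _ hi) hi' := rx.
by rewrite /shg ifN 1?addnC //; lia.
Qed.

End ShiftedGens.

Section Gens.
Variables (R : comUnitRingType) (A : algType R).
Variables (p n : nat) (eps q : R) (Q : seq R) (b : seq nat) (T : nat -> A).
Hypothesis p1 : (1 < p)%N.
Hypothesis hb : size b = p.
Hypothesis hbn : sumn b = n.
Hypothesis hq : q \is a GRing.unit.
Hypothesis hT : affine q n T.
Local Notation J := (JM q T).
Local Notation Sb := (bsum b 1).

Lemma TbE : Tb p n b T = pD n b T p.
Proof.
have -> : pD n b T p = pD n b T p.-1.
  have {1}-> : p = p.-1.+1 by lia.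
  rewrite pDS /bD prednK ?(Sb_p hb hbn) ?subnn ?cw0; last by lia.
  by rewrite /tprod big_nil mul1r.
rewrite /Tb -[wb p n b]/(wbp p n b p.-1); have : (p.-1 <= p)%N by lia.
elim: p.-1 => [|k IH] kp; first by rewrite wbp0 (affTw1 hT) /pD big_nil.
have e := SbS b k; have h := Sb_n hb hbn kp.
(* Lengths add: the new factor inverts only positions from [Sb k] on, where [wbp k] is a
   translation. *)
rewrite wbpS (affTwM hT) => [|x y hxy]; last first.
  rewrite !(pn_wk p1 hb hbn) // !wact_cw => hlt.
  by rewrite !(pn_wbp_ge p1 hb hbn); move: hlt; try lia; if_lia.
rewrite pDS IH; last by lia.
congr (_ * _); rewrite /bD.
have -> : bsum b k.+2 p = (n - Sb k.+1)%N by rewrite (bsum_tail _ kp) (Sb_p hb hbn).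
by rewrite wkE ?(affTw_word hT) //; [apply: rword_cw|]; rewrite /=; lia.
Qed.

Definition tg (s : nat) : nat -> A := shg q T (bk p b s).

Lemma tg_comm s s' i j : (0 < s <= p)%N -> (0 < s' <= p)%N -> s != s' ->
  (i < bt b s)%N -> (j < bt b s')%N -> comm (tg s i) (tg s' j).
Proof.
move=> hs hs' ns.
by apply: (shg_comm hq hT (bk_bound p1 hb hbn hs) (bk_bound p1 hb hbn hs')); apply: (bk_disjoint' p1 hb hbn).
Qed.

Lemma Tw_tg (t : 'I_p) (x : 'S_(bo b t)) :
  Tw (tg t.+1) x = Tw T (xconj p n b t x).
Proof.
rewrite (xconjE p1 hb hbn) (Tw_shg hq hT) //; apply: (bk_bound p1 hb hbn (s := t.+1)).
exact: ltn_ord.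
Qed.

Lemma prod_mul_comm (I : eqType) (s : seq I) (F G : I -> A) : uniq s ->
  (forall i j, i != j -> comm (G i) (F j)) ->
  \prod_(i <- s) (F i * G i) = (\prod_(i <- s) F i) * \prod_(i <- s) G i.
Proof.
move=> + h; elim: s => [|i s IH] /=; first by rewrite !big_nil mulr1.
case/andP=> his us; rewrite !big_cons IH // -!mulrA; congr (_ * _).
rewrite !mulrA; congr (_ * _); apply: commr_prod_seq => j hj; apply: h.
by apply: contraNneq his => ->.
Qed.

(** Distinct blocks commute, so powers and permutations can be sorted block by block. This gives
    [Theta_bas] the form of [Hdb_bas], with [tg] in place of [G]. *)
Lemma Theta_basE d (x : Hdb_index p d b) :
  Theta_bas p d n q b T x = \prod_(t < p) AK_bas q d (bo b t) (tg t.+1) (x t).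
Proof.
rewrite /Theta_bas /AK_bas prod_mul_comm; first last.
- move=> s t nst; have us : in_gens (tg s.+1) (bt b s.+1) (Tw (tg s.+1) (x s).2).
    exact: in_gens_Tw.
  apply/commr_sym/us => i hi; apply/commr_sym; apply: commr_prod_seq => j _.
  apply: commrX; have hj : (j < bt b t.+1)%N by exact: ltn_ord.
  have g : in_gens (tg t.+1) (bt b t.+1) (JM q (tg t.+1) j) by apply: in_gensJ.
  apply: g => k hk.
  by apply: tg_comm => //; exact: ltn_ord.
- exact: index_enum_uniq.
congr (_ * _).
  apply: eq_bigr => t _; apply: eq_bigr => j _.
  by rewrite /Ljm /= JM_shg addnS.
by apply: eq_bigr => t _; rewrite Tw_tg.
Qed.
End Gens.

(** * The action of [H_{d,b}] on [v_b H_{r,n}] *)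

Section Transfer.
Variables (R : comUnitRingType) (E A : algType R) (f : {lrmorphism E -> A}).
Variables (q : R) (U : nat -> E).

Lemma map_JM k : f (JM q U k) = JM q (f \o U) k.
Proof. by elim: k => //= k IH; rewrite linearZ /= !rmorphM /= IH. Qed.

Lemma map_Tw m (w : 'S_m) : f (Tw U w) = Tw (f \o U) w.
Proof. by rewrite /Tw rmorph_prod. Qed.

Lemma map_AK d m x : f (AK_bas q d m U x) = AK_bas q d m (f \o U) x.
Proof.
rewrite /AK_bas rmorphM /= map_Tw rmorph_prod; congr (_ * _).
by apply: eq_bigr => j _; rewrite rmorphXn /= /Ljm map_JM.
Qed.

Lemma map_ev rs x : f (ev rs x) = ev rs (f x).
Proof.
by rewrite /ev rmorph_prod; apply: eq_bigr => r _; rewrite rmorphB /= linearZ /= rmorph1.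
Qed.
End Transfer.

Section ShiftedAction.
Variables (R : comUnitRingType) (A : algType R) (p n : nat).
Variables (eps q : R) (Q : seq R) (b : seq nat) (T : nat -> A).
Hypothesis p1 : (1 < p)%N.
Hypothesis hb : size b = p.
Hypothesis hbn : sumn b = n.
Hypothesis hq : q \is a GRing.unit.
Hypothesis hA : AK_rel q (Qr p eps Q) n T.
Local Notation v := (vt eps q Q b T p).

Definition tg' (s : nat) : nat -> A := shg q T (bsum b 1 s.-1).

Lemma tg_v s i : (0 < s <= p)%N -> (i < bt b s)%N -> tg p q b T s i * v = v * tg' s i.
Proof.
move=> hs hi; rewrite /tg /tg' /shg; case: eqP => i0.
  have h : (0 < bt b s)%N by lia.
  by have := v_J p1 hb hbn hq hA hs h; rewrite !addn0.
by apply: (v_T p1 hb hbn hq hA hs); lia.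
Qed.

End ShiftedAction.

Lemma Tw_1 (A : pzRingType) (U : nat -> A) m : Tw U (1%g : 'S_m) = 1.
Proof.
rewrite /Tw; have [/andP[_ /eqP hs] e] := redwordP (1%g : 'S_m).
by move: hs; rewrite e len1 => /size0nil ->; rewrite big_nil.
Qed.

Section Action.
Variables (R : comUnitRingType) (p d n : nat).
Hypothesis p1 : (1 < p)%N.
Hypothesis d0 : (0 < d)%N.
Variables (eps q : R) (Q : seq R).
Hypothesis hQ : size Q = d.
Hypothesis hq : q \is a GRing.unit.
Variable b : seq nat.
Hypothesis hb : size b = p.
Hypothesis hbn : sumn b = n.
Variables (A : algType R) (T : nat -> A).
Hypothesis hA : AK_rel q (Qr p eps Q) n T.
Variables (B : algType R) (G : nat -> nat -> B).
Hypothesis hB : is_Hdb p d eps q Q b G.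
Variable Theta : B -> A.
Hypothesis hTlin : forall (a : R) x y, Theta (a *: x + y) = a *: Theta x + Theta y.
Hypothesis hTbas : forall x, Theta (Hdb_bas p d q b G x) = Theta_bas p d n q b T x.

Let hT : affine q n T := AK_affine hA.
Local Notation v := (vt eps q Q b T p).
Local Notation E := (B * A)%type.
Local Notation tg' := (tg' q b T).
Local Notation tg_v := (tg_v p1 hb hbn hq hA).

(** Pairing the generators lets one straightening computation run in [B] and in [A] at once, so both
    components receive the same coefficients. *)
Definition pg (s i : nat) : E := (G s i, tg p q b T s i).

Let pfst : {lrmorphism E -> B} := fst.
Let psnd : {lrmorphism E -> A} := snd.

Lemma pairP (x y : E) : pfst x = pfst y -> psnd x = psnd y -> x = y.
Proof. exact: injective_projections. Qed.

Lemma ev1 rs (x : E) : (ev rs x).1 = ev rs x.1.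
Proof. exact: (map_ev pfst). Qed.

Lemma ev2 rs (x : E) : (ev rs x).2 = ev rs x.2.
Proof. exact: (map_ev psnd). Qed.

Lemma fst_prod (I : Type) (s : seq I) (F : I -> E) :
  (\prod_(i <- s) F i).1 = \prod_(i <- s) (F i).1.
Proof. exact: (rmorph_prod pfst). Qed.

Lemma snd_prod (I : Type) (s : seq I) (F : I -> E) :
  (\prod_(i <- s) F i).2 = \prod_(i <- s) (F i).2.
Proof. exact: (rmorph_prod psnd). Qed.

Lemma fst_AK s m x : (AK_bas q d m (pg s) x).1 = AK_bas q d m (G s) x.
Proof. exact: (map_AK pfst). Qed.

Lemma snd_AK s m x : (AK_bas q d m (pg s) x).2 = AK_bas q d m (tg p q b T s) x.
Proof. exact: (map_AK psnd). Qed.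

Lemma factor_affine s : (0 < s <= p)%N -> affine q (bt b s) (G s).
Proof. by case: hB => h _ _ /h[_ h1 h2 h3 h4]; split. Qed.

Lemma pg_affine s : (0 < s <= p)%N -> affine q (bt b s) (pg s).
Proof.
move=> hs; have [b1 b2 b3 b4] := factor_affine hs.
have [a1 a2 a3 a4] := shg_affine hq hT (bk_bound p1 hb hbn hs).
split.
- by move=> i hi; apply: pairP; [exact: b1 _ hi | exact: a1 _ hi].
- by move=> h; apply: pairP; [exact: b2 h | exact: a2 h].
- by move=> i h h'; apply: pairP; [exact: b3 _ h h' | exact: a3 _ h h'].
by move=> i j h h' h2; apply: pairP; [exact: b4 _ _ h h' h2 | exact: a4 _ _ h h' h2].
Qed.

Lemma pg_comm s s' i j : (0 < s <= p)%N -> (0 < s' <= p)%N -> s != s' ->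
  (i < bt b s)%N -> (j < bt b s')%N -> comm (pg s i) (pg s' j).
Proof.
move=> hs hs' ns hi hj; apply: pairP; rewrite !rmorphM.
  by case: hB => _ h _; apply: h.
exact: (tg_comm p1 hb hbn hq hT).
Qed.

(** The order relation of a tensor factor holds throughout [B], but for [tg] it is known on [v A],
    by [v_order]; hence only the second component is restricted. *)
Definition inV (e : E) : Prop := exists y, e.2 = v * y.

Lemma inV_pg s i u : (0 < s <= p)%N -> (i < bt b s)%N -> inV u -> inV (pg s i * u).
Proof.
by move=> hs hi [y ey]; exists (tg' s i * y); rewrite /= ey mulrA tg_v // mulrA.
Qed.

Lemma inV_Z (a : R) u : inV u -> inV (a *: u).
Proof. by case=> y ey; exists (a *: y); rewrite /= ey -scalerAr. Qed.

Lemma inV_order s u : (0 < s <= p)%N -> (0 < bt b s)%N -> inV u ->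
  ev (rt eps Q s) (pg s 0) * u = 0.
Proof.
move=> hs h [y ey]; apply: pairP.
  change ((ev (rt eps Q s) (pg s 0)).1 * u.1 = 0); rewrite ev1.
  by case: hB => h1 _ _; have [h2 _ _ _ _] := h1 _ hs; rewrite [ev _ _]h2 ?mul0r.
change ((ev (rt eps Q s) (pg s 0)).2 * u.2 = 0); rewrite ev2 ey mulrA.
rewrite (ev_intertw (rt eps Q s) (tg_v hs h)).
by rewrite [tg' s 0]/= (v_order p1 hb hbn hq hA) ?mul0r.
Qed.

Lemma inV_AK (t : 'I_p) y u : inV u -> inV (AK_bas q d (bo b t) (pg t.+1) y * u).
Proof.
have ht : (0 < t.+1 <= p)%N by exact: ltn_ord.
move=> hu; rewrite -mulrA; apply: V_prod; last first.
  by apply: (V_Tw hq) => // i w hi; apply: inV_pg.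
move=> j w _; apply: (V_Jexp hq (m := bt b t.+1)) => //.
- by move=> i z hi; apply: inV_pg.
- exact: inV_Z.
exact: (ltn_ord j).
Qed.

Definition u0 : E := (1, v).

(** The span of these vectors is the graph of [h |-> Theta h * v] ([graph_lspan], [lspan_bas_vec]).
    Its stability under [pg s i] is compatibility of [Theta] with that generator. *)
Definition bas_vec (e : E) : Prop := exists2 h : 'I_p -> E,
  (forall t : 'I_p, exists y, h t = AK_bas q d (bo b t) (pg t.+1) y) &
  e = (\prod_(t < p) h t) * u0.

Lemma bas_vec_gen (s : 'I_p) i e : (i < bt b s.+1)%N -> bas_vec e ->
  lspan bas_vec (pg s.+1 i * e).
Proof.
move=> hi [h hh ->]; have hs : (0 < s.+1 <= p)%N by exact: ltn_ord.
have us := index_enum_uniq 'I_p; have ms := mem_index_enum s.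
have [l1 [l2 el]] : exists l1 l2, index_enum 'I_p = l1 ++ s :: l2.
  by case/splitPr: ms => l1 l2; exists l1, l2.
rewrite el in us *; clear ms.
have hb_ord t : (0 < (t : 'I_p).+1 <= p)%N by exact: ltn_ord.
have cl : comm (pg s.+1 i) (\prod_(t <- l1) h t).
  apply: commr_prod_seq => t ht; have [y ->] := hh t.
  have nst : s != t.
    apply/eqP => est; move: us; rewrite cat_uniq => /and3P[_ /hasPn h2 _].
    by move/negP: (h2 s (mem_head _ _)); apply; rewrite est.
  have g : in_gens (pg t.+1) (bt b t.+1) (AK_bas q d (bo b t) (pg t.+1) y).
    exact: in_gens_AK.
  by apply: g => j hj; apply: pg_comm.
set tail := \prod_(t <- l2) h t * u0.
have Vt : inV tail.
  rewrite /tail; elim: (l2) => [|t l IH].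
    by rewrite big_nil mul1r; exists 1; rewrite mulr1.
  rewrite big_cons -mulrA; have [y ->] := hh t.
  exact: inV_AK.
(* The generator commutes with the factors before [s], and those after [s] form the vector on which
   the straightening in block [s] takes place. *)
rewrite big_cat big_cons /= -!mulrA -/tail (mulrA (pg _ _)) cl -mulrA.
have sz : size (rt eps Q s.+1) = d by rewrite size_map.
apply: (@span_mull _ _ (std q (bt b s.+1) (pg s.+1) d tail)); last first.
  rewrite -sz; apply: (std_T hq (pg_affine hs) (V := inV)) => //.
  - by move=> j u hj; apply: inV_pg.
  - exact: inV_Z.
  - by move=> u h0; apply: inV_order.
  by rewrite sz; have [y ->] := hh s; apply: AK_std.
move=> _ /(stdE d0)[y ->]; apply: span_in.
exists (fun t => if t == s then AK_bas q d (bo b s) (pg s.+1) y else h t).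
  by move=> t; case: eqP => [->|_]; [exists y | exact: hh].
have [/= nl1 nl2] : s \notin l1 /\ s \notin l2.
  move: us; rewrite cat_uniq => /and3P[_ /hasPn h2 /= /andP[n2 _]]; split=> //.
  by apply: (h2 s); rewrite mem_head.
have ext l : s \notin l ->
    \prod_(t <- l) (if t == s then AK_bas q d (bo b s) (pg s.+1) y else h t) = \prod_(t <- l) h t.
  by move=> nl; apply: eq_big_seq => t ht; rewrite ifN //; apply: contraNneq nl => <-.
by rewrite el big_cat big_cons /= eqxx !ext // /tail !mulrA.
Qed.

Lemma bas_vec_fun e : bas_vec e -> exists x : Hdb_index p d b,
  e = (Hdb_bas p d q b G x, Theta_bas p d n q b T x * v).
Proof.
case=> h /fin_all_exists[y hy] ->.
exists [ffun t => y t]; rewrite (Theta_basE p1 hb hbn hq hT).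
rewrite /Hdb_bas; apply: pairP.
  rewrite -[LHS]/((\prod_(t < p) h t).1 * 1) mulr1 fst_prod.
  by apply: eq_bigr => t _; rewrite hy ffunE fst_AK.
rewrite -[LHS]/((\prod_(t < p) h t).2 * v) snd_prod.
by congr (_ * _); apply: eq_bigr => t _; rewrite hy ffunE snd_AK.
Qed.

Lemma bas_vec_bas x : bas_vec (Hdb_bas p d q b G x, Theta_bas p d n q b T x * v).
Proof.
exists (fun t => AK_bas q d (bo b t) (pg t.+1) (x t)); first by move=> t; exists (x t).
rewrite (Theta_basE p1 hb hbn hq hT) /Hdb_bas; apply: pairP.
  rewrite -[RHS]/((\prod_(t < p) AK_bas q d (bo b t) (pg t.+1) (x t)).1 * 1) mulr1 fst_prod.
  by apply: eq_bigr => t _; rewrite fst_AK.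
rewrite -[RHS]/((\prod_(t < p) AK_bas q d (bo b t) (pg t.+1) (x t)).2 * v) snd_prod.
by congr (_ * _); apply: eq_bigr => t _; rewrite snd_AK.
Qed.

Lemma Theta0 : Theta 0 = 0.
Proof.
by apply: (addrI (Theta 0)); have := hTlin 1 0 0; rewrite !scale1r !addr0.
Qed.

Lemma lspan_bas_vec e : lspan bas_vec e -> e.2 = Theta e.1 * v.
Proof.
elim=> [|a x y /bas_vec_fun[i ->] _ IH]; first by rewrite /= Theta0 mul0r.
by rewrite /= hTlin mulrDl -scalerAl hTbas IH.
Qed.

Lemma Hdb_expand (h : B) : exists c : {ffun Hdb_index p d b -> R},
  h = \sum_i c i *: Hdb_bas p d q b G i.
Proof. by case: hB => _ _ /(_ h)[c [e _]]; exists c. Qed.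

Lemma Theta_sum (I : Type) (s : seq I) (c : I -> R) (F : I -> B) :
  Theta (\sum_(i <- s) c i *: F i) = \sum_(i <- s) c i *: Theta (F i).
Proof.
elim: s => [|i s IH]; first by rewrite !big_nil Theta0.
by rewrite !big_cons hTlin IH.
Qed.

Lemma graph_lspan h : lspan bas_vec (h, Theta h * v).
Proof.
have [c ->] := Hdb_expand h.
have -> : (\sum_i c i *: Hdb_bas p d q b G i,
           Theta (\sum_i c i *: Hdb_bas p d q b G i) * v) =
  \sum_i c i *: ((Hdb_bas p d q b G i, Theta_bas p d n q b T i * v) : E).
  apply: pairP; rewrite raddf_sum /=; first by apply: eq_bigr.
  rewrite Theta_sum mulr_suml; apply: eq_bigr => i _.
  by rewrite hTbas -scalerAl.
by apply: span_sum => i; apply/spanZ/span_in/bas_vec_bas.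
Qed.

(** This property is stable under products and scalars, so it spreads from the paired generators to
    all standard elements. *)
Definition good (e : E) : Prop :=
  forall h, Theta (e.1 * h) * v = e.2 * (Theta h * v).

Lemma good_pg (s : 'I_p) i : (i < bt b s.+1)%N -> good (pg s.+1 i).
Proof.
move=> hi h.
have : lspan bas_vec (pg s.+1 i * (h, Theta h * v)).
  by apply: span_mull (graph_lspan h) => e; apply: bas_vec_gen.
by move/lspan_bas_vec => /= <-.
Qed.

Lemma goodM x y : good x -> good y -> good (x * y).
Proof. by move=> hx hy h; rewrite /= -!mulrA hx hy. Qed.

Lemma good1 : good 1.
Proof. by move=> h; rewrite /= !mul1r. Qed.

Lemma goodZ (a : R) x : good x -> good (a *: x).
Proof.
move=> hx h; rewrite /= -!scalerAl -hx -[a *: (_ * h)]addr0 hTlin Theta0 addr0.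
by rewrite scalerAl.
Qed.

Lemma good_prod (I : eqType) (s : seq I) (F : I -> E) :
  (forall i, i \in s -> good (F i)) -> good (\prod_(i <- s) F i).
Proof.
move=> h; rewrite big_seq; elim/big_ind: _ => //; [exact: good1 | exact: goodM].
Qed.

Lemma good_AK (t : 'I_p) y : good (AK_bas q d (bo b t) (pg t.+1) y).
Proof.
apply: goodM; apply: good_prod => i hi.
  have gJ k : (k < bt b t.+1)%N -> good (JM q (pg t.+1) k).
    elim: k => [|k IH] hk; first exact: good_pg.
    rewrite JS; apply/goodZ/goodM; last exact: good_pg.
    by apply: goodM; [apply: good_pg | apply: IH; apply: ltnW].
  elim: (nat_of_ord (y.1 i)) => [|k IH]; first by rewrite expr0; apply: good1.
  by rewrite exprS; apply: goodM => //; apply: gJ; apply: ltn_ord.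
by have [/rword_vword/allP/(_ _ hi)/andP[_ hi'] _] := redwordP y.2; apply: good_pg.
Qed.

Lemma Theta_mul h1 h2 : Theta (h1 * h2) * v = Theta h1 * (Theta h2 * v).
Proof.
have [c ->] := Hdb_expand h1.
rewrite mulr_suml Theta_sum mulr_suml.
have -> : \sum_i c i *: Hdb_bas p d q b G i * h2 = \sum_i c i *: (Hdb_bas p d q b G i * h2).
  by apply: eq_bigr => i _; rewrite scalerAl.
rewrite Theta_sum mulr_suml; apply: eq_bigr => x _.
rewrite -!scalerAl; congr (_ *: _).
have g : good (\prod_(t < p) AK_bas q d (bo b t) (pg t.+1) (x t)).
  by apply: good_prod => t _; apply: good_AK.
have := g h2; rewrite hTbas (Theta_basE p1 hb hbn hq hT).
have -> : (\prod_(t < p) AK_bas q d (bo b t) (pg t.+1) (x t)).1 = Hdb_bas p d q b G x.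
  by rewrite fst_prod; apply: eq_bigr => t _; rewrite fst_AK.
move=> ->; congr (_ * _); rewrite snd_prod; apply: eq_bigr => t _.
by rewrite snd_AK.
Qed.

Lemma Theta1_v : Theta 1 * v = v.
Proof.
pose x0 : Hdb_index p d b := [ffun t => ([ffun=> Ordinal d0], 1%g)].
have AK1 (C : algType R) (U : nat -> C) (t : 'I_p) : AK_bas q d (bo b t) U (x0 t) = 1.
  rewrite ffunE /AK_bas /= Tw_1 mulr1 big1 // => j _.
  by rewrite ffunE expr0.
have <- : Hdb_bas p d q b G x0 = 1 by apply: big1 => t _; apply: AK1.
rewrite hTbas (Theta_basE p1 hb hbn hq hT) big1 ?mul1r // => t _.
exact: AK1.
Qed.

Lemma Theta_vA h : exists y, Theta h * v = v * y.
Proof.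
have: lspan inV (h, Theta h * v).
  apply: span_mono (graph_lspan h) => e [g hg ->].
  elim: (index_enum _) => [|t l IH]; first by rewrite big_nil mul1r; exists 1; rewrite mulr1.
  by rewrite big_cons -mulrA; have [y ->] := hg t; apply: inV_AK.
move eu : (h, Theta h * v) => u su; have -> : Theta h * v = u.2 by rewrite -eu.
elim: su {eu} => [|a x y [z ez] _ [w ew]]; first by exists 0; rewrite mulr0.
by exists (a *: z + w); rewrite /= ez ew mulrDr scalerAr.
Qed.
End Action.

(** * Leading terms *)

Definition bounded (n r : nat) (a : nat -> nat) : Prop :=
  forall j, (j < n)%N -> (a j < r)%N.

Lemma wact_lt n s x : vword n s -> (wact s x < n)%N = (x < n)%N.
Proof. by move=> hs; rewrite -(pn_wprod x hs) pn_lt. Qed.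

Lemma bounded_wact n r s a : vword n s -> bounded n r a -> bounded n r (a \o wact s).
Proof. by move=> hs ha j hj; apply: ha; rewrite wact_lt. Qed.

Section Leading.
Variables (R : comUnitRingType) (A : algType R) (n : nat) (q : R) (T : nat -> A).
Hypothesis hq : q \is a GRing.unit.
Hypothesis hT : affine q n T.
Variable r : nat.
Local Notation J := (JM q T).
Local Notation Mon := (Mon q T).

Local Notation bounded := (bounded n r).

Definition dominated (a l : nat -> nat) : Prop :=
  (forall j, (j < n)%N -> (a j <= l j)%N) /\ (exists2 j, (j < n)%N & (a j < l j)%N).

Definition terms (N : 'S_n -> Prop) (z : A) : Prop :=
  exists a (u : 'S_n), [/\ bounded a, N u & z = Mon n a * Tw T u].

(** [C] will be a coset of the block stabiliser and [N] its complement among the permutations that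
    can occur. Exponents are compared only in [C]; in [N] the reduction of overflowing powers leaves
    no control over them. *)
Definition low (N C : 'S_n -> Prop) (l : nat -> nat) (z : A) : Prop :=
  exists a (u : 'S_n), [/\ bounded a, N u \/ C u /\ dominated a l & z = Mon n a * Tw T u].

Definition expands N C l (w : 'S_n) x : Prop :=
  exists2 z, lspan (low N C l) z & x = Mon n l * Tw T w + z.

Lemma terms_low N C l z : terms N z -> low N C l z.
Proof. by case=> a [u [ha hu ->]]; exists a, u; split=> //; left. Qed.

Lemma expands_ext N C l l' w x : (forall j, (j < n)%N -> l j = l' j) ->
  expands N C l w x -> expands N C l' w x.
Proof.
move=> e [z hz ->]; exists z; last by rewrite (eq_Mon _ _ e).
apply: span_mono hz => _ [a [u [ha hu ->]]]; exists a, u; split=> //.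
case: hu => [|[hC [h1 [j hj h2]]]]; [by left | right; split=> //; split].
  by move=> i hi; rewrite -e // h1.
by exists j; rewrite -?e.
Qed.

Definition incr (i m : nat) (l : nat -> nat) : nat -> nat :=
  fun j => if j == i then (l j + m)%N else l j.

Section Multiply.
Variables (N C : 'S_n -> Prop) (i : nat).
Hypothesis hi : (i < n)%N.
Hypothesis hN : forall a u, bounded a -> N u -> lspan (terms N) (J i * (Mon n a * Tw T u)).

(** In [C] no power overflows, because exponents there stay at most [(l i).+1 < r]; in [N] this is
    left to [hN]. The multiple by [c] of the old leading term is dominated by the new one. *)
Lemma expands_J l w x (c : R) : bounded l -> ((l i).+1 < r)%N -> C w ->
  expands N C l w x -> expands N C (incr i 1 l) w ((J i - c%:A) * x).
Proof.
move=> bl li Cw [z hz ->].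
have le_incr j : (l j <= incr i 1 l j)%N by rewrite /incr; case: eqP => _; lia.
have JMi a : J i * Mon n a = Mon n (incr i 1 a).
  rewrite (JMon hq hT) //; apply: eq_Mon => j hj; rewrite /incr.
  by case: eqP => _; rewrite ?addn1.
exists (- c *: (Mon n l * Tw T w) + (J i * z - c *: z)); last first.
  by rewrite mulrDr mulrBl mulr_algl mulrA JMi scaleNr mulrBl mulr_algl !addrA.
apply: spanD.
  apply/spanZ/span_in; exists l, w; split=> //; right; split=> //; split=> //.
  by exists i => //; rewrite /incr eqxx addn1.
apply: spanB; last first.
  apply: spanZ; apply: span_mono hz => _ [a [u [ha hu ->]]]; exists a, u; split=> //.
  case: hu => [|[hC [h1 [j hj h2]]]]; [by left | right; split=> //; split].
    by move=> k hk; apply: leq_trans (le_incr k); apply: h1.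
  by exists j => //; apply: leq_trans (le_incr j).
apply: span_mull hz => _ [a [u [ha hu ->]]].
case: hu => [Nu|[hC [h1 [j hj h2]]]].
  by apply: span_mono (hN ha Nu) => y; apply: terms_low.
apply: span_in; exists (incr i 1 a), u; rewrite mulrA JMi; split=> //.
  by move=> k hk; rewrite /incr; case: eqP => [->|_]; [have := h1 i hi; lia | apply: ha].
right; split=> //; split; first by move=> k hk; have := h1 k hk; rewrite /incr; case: eqP => _; lia.
by exists j => //; rewrite /incr; case: eqP => _; lia.
Qed.

Lemma expands_ev l w x (rs : seq R) : bounded l -> (l i + size rs < r)%N -> C w ->
  expands N C l w x -> expands N C (incr i (size rs) l) w (ev rs (J i) * x).
Proof.
move=> bl li Cw h; elim: rs li => [|c rs IH] /= li.
  rewrite /ev big_nil mul1r; apply: expands_ext h => j _.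
  by rewrite /incr; case: eqP => // _; rewrite addn0.
have li' : (l i + size rs < r)%N by lia.
rewrite ev_cons -mulrA; apply: (@expands_ext _ _ (incr i 1 (incr i (size rs) l))).
  by move=> j _; rewrite /incr; case: eqP => // _; lia.
apply: expands_J (IH li') => //.
  by move=> j hj; rewrite /incr; case: eqP => [->//|_]; apply: bl.
by rewrite /incr eqxx; lia.
Qed.
End Multiply.

Lemma expands_Fm N C l w x (rs : seq R) c : (c <= n)%N ->
  (forall i, (i < c)%N -> forall a u, bounded a -> N u -> lspan (terms N) (J i * (Mon n a * Tw T u))) ->
  bounded l -> (forall i, (i < c)%N -> (l i + size rs < r)%N) -> C w ->
  expands N C l w x ->
  expands N C (fun j => if (j < c)%N then (l j + size rs)%N else l j) w (Fm q T rs c * x).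
Proof.
elim: c l x => [|c IH] l x cn hN bl hl Cw h; first by rewrite Fm0 mul1r.
rewrite FmS -mulrA.
apply: (@expands_ext _ _ (fun j => if (j < c)%N then (incr c (size rs) l j + size rs)%N else incr c (size rs) l j)).
  by move=> j _; rewrite /incr ltnS; case: (ltngtP j c).
apply: IH => //; first by lia.
- by move=> i hi; apply: hN; lia.
- move=> j hj; rewrite /incr; case: eqP => [->|_]; [exact: hl | exact: bl].
- move=> j hj; rewrite /incr; case: eqP => [?|_]; [lia | apply: hl; lia].
by apply: expands_ev => //; [apply: hN | apply: hl].
Qed.

(* Modulo [terms N] exponents of [J_i], [i < c], can be reduced below [r] inside the first [c] strands. *)
Section Overflow.
Variables (Qs : seq R) (c : nat) (N : 'S_n -> Prop).
Hypothesis hQs : size Qs = r.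
Hypothesis hord : (0 < n)%N -> ev Qs (T 0%N) = 0.
Hypothesis cn : (c <= n)%N.
Hypothesis hNs : forall i u, (0 < i < c)%N -> N u -> N (sgen n i * u)%g.

Lemma std_J i z : (i < c)%N -> std q c T r 1 z -> lspan (std q c T r 1) (J i * z).
Proof.
have st k y : (k < c)%N -> lspan (std q c T r 1) y -> lspan (std q c T r 1) (T k * y).
  move=> hk; apply: span_mull => w; rewrite -hQs.
  apply: (std_T hq (affine_sub hT cn) (V := fun _ => True)) => //.
  by move=> u c0 _; rewrite hord ?mul0r //; apply: leq_trans cn.
move=> hi hz; have: lspan (std q c T r 1) z by apply: span_in.
elim: i hi z {hz} => [|i IH] hi z hz; first exact: st.
rewrite JS -scalerAl -!mulrA; apply/spanZ/st => //; apply: IH; first by lia.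
exact: st.
Qed.

Lemma tprod_Tw s u : all (fun i => 0 < i < c)%N s -> N u ->
  lspan (fun z => exists2 u', N u' & z = Tw T u') (tprod T s * Tw T u).
Proof.
move=> + Nu; elim: s => [|i s IH] /=.
  by rewrite /tprod big_nil mul1r => _; apply: span_in; exists u.
case/andP=> hi hs; rewrite tprod_cons -mulrA; apply: span_mull (IH hs) => _ [u' Nu' ->].
have hin : (0 < i < n)%N by lia.
have [->|->] := TTw hT u' hin; first by apply: span_in; exists (sgen n i * u')%g => //; apply: hNs.
apply: spanD; apply/spanZ/span_in; last by exists u'.
by exists (sgen n i * u')%g => //; apply: hNs.
Qed.

Lemma overflow i a u : (i < c)%N -> bounded a -> N u ->
  lspan (terms N) (J i * (Mon n a * Tw T u)).
Proof.
move=> hi ha Nu.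
have split a' : Mon n a' = Mon c a' * \prod_(c <= j < n) J j ^+ a' j.
  by rewrite MonE (big_cat_nat (n := c)).
have s0 : std q c T r 1 (Mon c a).
  exists a, 1%g; rewrite (affTw1 (affine_sub hT cn)) !mulr1; split=> // j hj.
  by apply: ha; lia.
rewrite split -!mulrA mulrA.
set M := \prod_(c <= j < n) _.
apply: span_mulr (std_J hi s0) => _ [a' [y [ha' ->]]].
rewrite mulr1 -mulrA.
have cM : Tw T y * M = M * Tw T y.
  symmetry; apply: in_gens_Tw => j hj; apply/commr_sym; apply: commr_prod_seq => k.
  rewrite mem_index_iota => hk; apply/commrX/commr_sym/(central_J hT); lia.
have -> : Mon c a' * (Tw T y * (M * Tw T u)) =
    Mon n (fun j => if (j < c)%N then a' j else a j) * (Tw T y * Tw T u).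
  rewrite (mulrA (Tw T y)) cM split !mulrA; congr (_ * _ * _ * _).
    by apply: eq_Mon => j ->.
  by apply: eq_big_nat => j hj; rewrite ifN //; lia.
have ry : all (fun k => 0 < k < c)%N (redword c y) by have [/rword_vword ? _] := redwordP y.
apply: span_mull (tprod_Tw ry Nu) => _ [u' Nu' ->]; apply: span_in.
eexists; exists u'; split=> // j hj; case: ifP => h; [exact: ha' | exact: ha].
Qed.

End Overflow.

Lemma TMonTw i a w k (K : 'S_n -> Prop) : (0 < i < n)%N -> bounded a ->
  (forall u, K u -> K (sgen n i * u)%g) -> K w -> (len w < k)%N ->
  lspan (fun z => exists b u, [/\ bounded b, (len (u : 'S_n) < k.+1)%N, K u & z = Mon n b * Tw T u])
    (T i * (Mon n a * Tw T w)).
Proof.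
move=> hi ha hK Kw lw; have [z hz e] := TMon hq hT hi ha.
rewrite mulrA e mulrDl -mulrA; apply: spanD; last first.
  apply: span_mulr hz => _ [b hb ->]; apply: span_in; exists b, w; split=> //; lia.
have hsw : bounded (a \o sw i).
  by move=> j hj; apply: ha; move: hj hi; sw_lia.
have l1 := leq_len_sgen w i.
have [->|->] := TTw hT w hi.
  by apply: span_in; exists (a \o sw i), (sgen n i * w)%g; split=> //; [lia | exact: hK].
rewrite mulrDr -!scalerAr; apply: spanD; apply/spanZ/span_in.
  by exists (a \o sw i), (sgen n i * w)%g; split=> //; [lia | exact: hK].
by exists (a \o sw i), w; split=> //; lia.
Qed.

(** A correction loses at least one letter of [s]. Its shorter permutation is what later puts it
    outside the coset, through [coset_len]. *)
Lemma tprod_Mon s a (K : 'S_n -> Prop) : rword n s -> bounded a -> K 1%g ->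
  (forall i u, i \in s -> K u -> K (sgen n i * u)%g) ->
  exists2 z, lspan (fun z => exists b u,
      [/\ bounded b, (len (u : 'S_n) < size s)%N, K u & z = Mon n b * Tw T u]) z
    & tprod T s * Mon n a = Mon n (a \o wact s) * tprod T s + z.
Proof.
move=> + ha K1; elim: s => [|i s IH] rs hK.
  by exists 0; [apply: span0 | rewrite /tprod big_nil mul1r mulr1 addr0].
move: (rs); rewrite rword_cons => /and3P[hi rs' _].
have [|z hz e] := IH rs'; first by move=> j u hj; apply: hK; rewrite inE hj orbT.
have hs := rword_vword rs'.
have Kl l : {subset l <= i :: s} -> K (wprod n l).
  elim: l => [|j l IHl] hl //=; apply: hK; first by apply: hl; rewrite mem_head.
  by apply: IHl => k hk; apply: hl; rewrite inE hk orbT.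
have Ks : K (wprod n s) by apply: Kl => j hj; rewrite inE hj orbT.
have [z1 hz1 e1] := TMon hq hT hi (bounded_wact hs ha).
exists (z1 * tprod T s + T i * z); last first.
  by rewrite tprod_cons -mulrA e mulrDr mulrA e1 mulrDl addrA mulrA.
apply: spanD.
  apply: span_mulr hz1 => _ [b hb ->]; apply: span_in; exists b, (wprod n s).
  rewrite (affTw_word hT rs'); split=> //=.
  by case/andP: rs' => _ /eqP <-.
apply: span_mull hz => _ [b [u [hb hl Ku ->]]] /=.
apply: TMonTw => // w Kw; apply: hK => //; exact: mem_head.
Qed.

(** The second hypothesis places [u] in the parabolic subgroup generated by the [s_i] with [D i]:
    all descents of [u] satisfy [D], and removing one preserves the hypothesis. *)
Lemma Tw_mul_span (D : nat -> Prop) (K : 'S_n -> Prop) (u y : 'S_n) :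
  (forall i w, (0 < i < n)%N -> D i -> K w -> K (w * sgen n i)%g) ->
  (forall i, (0 < i < n)%N -> ~ D i -> forall x, (pn u x < i)%N = (x < i)%N) ->
  K y -> lspan (fun z => exists2 w, K w & z = Tw T (w : 'S_n)) (Tw T y * Tw T u).
Proof.
move=> hK; elim: {u}_.+1 {-2}u (ltnSn (len u)) y => // k IH u hk y hD Ky.
have [->|/descent[i hi hd]] := eqVneq u 1%g.
  by rewrite (affTw1 hT) mulr1; apply: span_in; exists y.
have Di : D i.
  case: (excluded_middle_informative (D i)) => // nD; exfalso.
  have h1 := hD i hi nD i; have h2 := hD i hi nD i.-1; lia.
pose u' := (sgen n i * u)%g.
have lu : (len u' < k)%N by move: hk; rewrite (len_sgen_gt hi hd).
have Tu : Tw T u = T i * Tw T u'.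
  rewrite -(affTwS hT) // /u' ?sgenKl // !pn_sgenM // sw_pred sw_self //; lia.
have hD' j : (0 < j < n)%N -> ~ D j -> forall x, (pn u' x < j)%N = (x < j)%N.
  move=> hj nDj x; rewrite /u' pn_sgenM // hD //.
  have : i != j by apply/eqP => e; apply: nDj; rewrite -e.
  by move: hj hi; sw_lia.
rewrite Tu mulrA; have [->|->] := TwT hT y hi.
  by apply: IH => //; apply: hK.
rewrite mulrDl -!scalerAl; apply: spanD; apply: spanZ; last exact: IH.
by apply: IH => //; apply: hK.
Qed.
End Leading.

(** * Block stabilisers and their cosets *)

Section Blocks.
Local Open Scope nat_scope.
Variables (p n : nat) (b : seq nat).
Hypothesis p1 : 1 < p.
Hypothesis hb : size b = p.
Hypothesis hbn : sumn b = n.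
Local Notation Sb := (bsum b 1).

(* 0-based, unlike [bt] *)
Definition blk (k : nat) : nat := find (fun t => k < Sb t.+1) (iota 0 p).

Lemma blkP k : k < n -> blk k < p /\ Sb (blk k) <= k < Sb (blk k).+1.
Proof.
move=> kn; have hs : has (fun t => k < Sb t.+1) (iota 0 p).
  apply/hasP; exists p.-1; first by rewrite mem_iota; lia.
  by rewrite prednK ?(Sb_p hb hbn) //; lia.
have lt : blk k < p by rewrite -[X in _ < X](size_iota 0) -has_find.
split=> //; have := nth_find 0 hs; rewrite nth_iota // add0n -/(blk k) => ->.
rewrite andbT; case e : (blk k) => [|m]; first by rewrite Sb0.
have hm : m < blk k by rewrite e.
have := before_find 0 hm; rewrite nth_iota ?add0n; last by lia.
by move=> /negbT; rewrite -leqNgt.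
Qed.

Lemma blk_side t k : t <= p -> k < n -> (k < Sb t) = (blk k < t).
Proof.
move=> tp /blkP[h1 h2]; apply/idP/idP => h.
  rewrite ltnNge; apply/negP => h3; have := Sb_mono b h3; lia.
have := Sb_mono b h; lia.
Qed.

Lemma blk_eq t k : t < p -> Sb t <= k < Sb t.+1 -> blk k = t.
Proof.
move=> tp hk; have kn : k < n by have := Sb_n hb hbn tp; lia.
have h1 := blk_side (ltnW tp) kn; have h2 := blk_side tp kn; lia.
Qed.

Definition om (k : nat) : seq nat := cw 0 (bt b k.+1) (Sb k).

(** The permutation underlying [bX k], ..., [bX 1], hence the one carried by the leading term. *)
Fixpoint Wp (k : nat) : 'S_n :=
  if k is k'.+1 then (wprod n (om k') * Wp k')%g else 1%g.

Lemma om_bound k : k < p -> 0 + bt b k.+1 + Sb k <= n.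
Proof. by move=> kp; have := Sb_n hb hbn kp; rewrite SbS; lia. Qed.

Lemma rword_om k : k < p -> rword n (om k).
Proof. by move=> /om_bound; apply: rword_cw. Qed.

Lemma pn_om k x : k < p -> pn (wprod n (om k)) x =
  if x < bt b k.+1 then x + Sb k else if x < Sb k.+1 then x - bt b k.+1 else x.
Proof.
move=> kp; rewrite pn_wprod ?(rword_vword (rword_om kp)) // wact_cw SbS.
by if_lia.
Qed.

(** Such a [u] permutes the strands of the first [k] blocks among themselves and keeps every later
    block. *)
Definition sides (k : nat) (u : 'S_n) : Prop :=
  forall s, k <= s <= p -> forall x, (pn u x < Sb s) = (x < Sb s).
(** As products act from left to right, this means [u = Wp k * y] with [y] preserving each block. *)
Definition coset (k : nat) (u : 'S_n) : Prop :=
  forall x, x < n -> blk (pn u x) = blk (pn (Wp k) x).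
Definition inC (k : nat) (u : 'S_n) : Prop := sides k u /\ coset k u.
Definition outC (k : nat) (u : 'S_n) : Prop := sides k u /\ ~ coset k u.

Lemma sides_om k : k < p -> sides k.+1 (wprod n (om k)).
Proof.
move=> kp s hs x; rewrite pn_om //; have := SbS b k.
have : Sb k.+1 <= Sb s by apply: Sb_mono; lia.
by if_lia.
Qed.

Lemma sidesM k u w : sides k u -> sides k w -> sides k (u * w)%g.
Proof. by move=> hu hw s hs x; rewrite pnM hw // hu. Qed.

Lemma sidesW k l u : k <= l -> sides k u -> sides l u.
Proof. by move=> kl hu s hs; apply: hu; lia. Qed.

Lemma sides1 k : sides k 1%g.
Proof. by move=> s _ x; rewrite pn1. Qed.

Lemma sides_sgen k i : 0 < i < n -> (forall s, k <= s <= p -> i != Sb s) ->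
  sides k (sgen n i).
Proof. by move=> hi h s hs x; rewrite pn_sgen //; have := h s hs; sw_lia. Qed.

Lemma sides_Wp k : k <= p -> sides k (Wp k).
Proof.
elim: k => [|k IH] kp /=; first exact: sides1.
apply: sidesM; first exact: sides_om.
by apply: (sidesW (leqnSn k)); apply: IH; lia.
Qed.

Lemma Wp_ge k x : k <= p -> Sb k <= x -> pn (Wp k) x = x.
Proof.
elim: k x => [|k IH] x kp hx /=; first by rewrite pn1.
have := SbS b k => e; rewrite pnM pn_om //.
by rewrite !ifN ?IH //; lia.
Qed.

Lemma WpS k x : pn (Wp k.+1) x = pn (Wp k) (pn (wprod n (om k)) x).
Proof. by rewrite /= pnM. Qed.

Lemma Wp_block k x : k < p -> x < n -> (blk (pn (Wp k.+1) x) == k) = (x < bt b k.+1).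
Proof.
move=> kp xn; have e := SbS b k; have bd := om_bound kp.
rewrite WpS; set y := pn (wprod _ _) x.
have yn : y < n by rewrite pn_lt.
have hs := sides_Wp (ltnW kp); have hS : Sb k <= n by lia.
have [hx|hx] := ltnP x (bt b k.+1).
  have ey : y = x + Sb k by rewrite /y pn_om // hx.
  rewrite Wp_ge; [|lia|lia]; apply/eqP; apply: blk_eq => //; lia.
have [hx2|hx2] := ltnP x (Sb k.+1).
  have ey : y = x - bt b k.+1 by rewrite /y pn_om // ifN ?hx2 // -leqNgt.
  have h1 : pn (Wp k) y < Sb k by rewrite hs; lia.
  have h2 : pn (Wp k) y < n by lia.
  by have := blk_side (ltnW kp) h2; lia.
have ey : y = x by rewrite /y pn_om // !ifN // -leqNgt.
rewrite ey Wp_ge; [|lia|lia].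
by have := blk_side kp xn; lia.
Qed.

Lemma coset_om k u : k < p -> coset k.+1 (wprod n (om k) * u)%g <-> coset k u.
Proof.
move=> kp; split=> h x xn; last by rewrite WpS pnM h // pn_lt.
have := h (pn (wprod n (om k))^-1%g x); rewrite pn_lt => /(_ xn).
by rewrite WpS pnM pnKV.
Qed.

Lemma inC_om k u : k < p -> inC k u -> inC k.+1 (wprod n (om k) * u)%g.
Proof.
move=> kp [hs hc]; split; last exact/coset_om.
by apply: sidesM; [apply: sides_om | apply: sidesW hs].
Qed.

Lemma outC_om k u : k < p -> outC k u -> outC k.+1 (wprod n (om k) * u)%g.
Proof.
move=> kp [hs hc]; split; last by move/(coset_om u kp).
by apply: sidesM; [apply: sides_om | apply: sidesW hs].
Qed.

(** In the coset the first [b_(k+1)] strands end at or above [Sb k] and the next [Sb k] strands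
    below it; [y] inherits this, so all these pairs cross. *)
Lemma coset_len k (u y : 'S_n) : k < p -> coset k.+1 u ->
  (forall x, (pn u x < Sb k) = (pn y x < Sb k)) -> Sb k * bt b k.+1 <= len y.
Proof.
move=> kp hc hy; have bd := om_bound kp.
rewrite mulnC; have key x : x < n -> (pn y x < Sb k) = (pn (wprod n (om k)) x < Sb k).
  move=> xn; rewrite -hy (blk_side (ltnW kp)) ?pn_lt // hc // -(blk_side (ltnW kp)) ?pn_lt //.
  by rewrite WpS (sides_Wp (ltnW kp)) //; lia.
apply: leq_len_cross => [|x hx|x hx]; first by lia.
  by rewrite leqNgt key ?pn_om //; [rewrite hx|]; lia.
rewrite key ?pn_om //; last by lia.
by rewrite SbS; if_lia.
Qed.

(** [Wp k.+1] sends the first [b_(k+1)] strands to one block, so permuting them does not change the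
    coset. This is the stability that [overflow] requires. *)
Lemma outC_sgen k i u : k < p -> 0 < i < bt b k.+1 -> outC k.+1 u ->
  outC k.+1 (sgen n i * u)%g.
Proof.
move=> kp hi [hs hc]; have bd := om_bound kp.
have hin : 0 < i < n by lia.
split.
  apply: sidesM hs; apply: sides_sgen => // s hs; have e := SbS b k.
  by have : Sb k.+1 <= Sb s by [apply: Sb_mono; lia]; lia.
move=> h; apply: hc => x xn.
have sx : sw i x < n by move: xn hin; sw_lia.
have := h (sw i x) sx; rewrite pn_sgenM // swK; last by lia.
move=> ->; have [hx|hx] := ltnP x (bt b k.+1).
  have hx' : sw i x < bt b k.+1 by move: hi hx; sw_lia.
  have := Wp_block kp xn; have := Wp_block kp sx.
  by rewrite hx hx' => /eqP -> /eqP ->.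
by rewrite sw_out //; lia.
Qed.
End Blocks.

(** * Leading terms through one factor of [v_b] *)

Section Stages.
Variables (R : comUnitRingType) (A : algType R) (p d n : nat).
Variables (eps q : R) (Q : seq R) (b : seq nat) (T : nat -> A).
Hypothesis p1 : (1 < p)%N.
Hypothesis hQ : size Q = d.
Hypothesis hb : size b = p.
Hypothesis hbn : sumn b = n.
Hypothesis hq : q \is a GRing.unit.
Hypothesis hA : AK_rel q (Qr p eps Q) n T.
Let hT : affine q n T := AK_affine hA.
Local Notation J := (JM q T).
Local Notation Mon := (Mon q T).
Local Notation Sb := (bsum b 1).
Local Notation r := (p * d)%N.
Local Notation om := (om b).
Local Notation Wp := (Wp n b).
Local Notation inC := (@inC p n b).
Local Notation outC := (@outC p n b).
Local Notation expands := (expands q T r).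
Local Notation terms := (terms q T r).
Local Notation blk := (blk p b).

Lemma size_rts l : size (rts eps Q l) = (size l * d)%N.
Proof.
elim: l => //= s l IH; rewrite /rts /= size_cat size_map hQ -/(rts eps Q l) IH.
by rewrite mulSn.
Qed.

Section Step.
Variable k : nat.
Hypothesis kp : (k < p)%N.
Let w := wprod n (om k).

Let tw : tprod T (om k) = Tw T w.
Proof. by rewrite (affTw_word hT) //; apply: (rword_om p1 hb hbn). Qed.

Lemma Tw_om_mul u : sides p b k u -> tprod T (om k) * Tw T u = Tw T (w * u)%g.
Proof.
move=> hs; rewrite tw (affTwM hT) // => x y hxy.
have e := SbS b k.
have hk z : (pn u z < Sb k)%N = (z < Sb k)%N by apply: hs; lia.
rewrite /w !(pn_om p1 hb hbn _ kp) => hlt.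
have h1 : (x < bt b k.+1)%N by move: hlt; if_lia.
have h2 : (bt b k.+1 <= y < Sb k.+1)%N by move: hlt; if_lia.
have := hk (x + Sb k)%N; have := hk (y - bt b k.+1)%N.
by rewrite h1 ifN ?ifT; lia.
Qed.

(** A correction starts with [T_y] for [y] shorter than the block exchange. Multiplying by [T_u]
    does not change which strands end below [Sb k], so by [coset_len] no permutation obtained lies
    in the coset. *)
Lemma om_term a u : bounded n r a -> sides p b k u ->
  exists2 z, lspan (terms (outC k.+1)) z &
    tprod T (om k) * (Mon n a * Tw T u) = Mon n (a \o wact (om k)) * Tw T (w * u)%g + z.
Proof.
move=> ha hs; have rw := rword_om p1 hb hbn kp.
have K1 : sides p b k.+1 (1%g : 'S_n) by apply: sides1.
have hK i (y : 'S_n) : i \in om k -> sides p b k.+1 y -> sides p b k.+1 (sgen n i * y)%g.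
  move=> /mem_cw hi; have bd := om_bound p1 hb hbn kp; apply: sidesM.
  apply: (sides_sgen p1 hb hbn); first by lia.
  move=> s hs'; have : (Sb k.+1 <= Sb s)%N by apply: Sb_mono; lia.
  by rewrite SbS; lia.
have [z hz e] := tprod_Mon hq hT rw ha K1 hK.
exists (z * Tw T u); last by rewrite mulrA e mulrDl -mulrA Tw_om_mul.
apply: span_mulr hz => _ [a' [y [ha' hl hy ->]]]; rewrite -mulrA.
pose K (u' : 'S_n) := (forall x, (pn u' x < Sb k)%N = (pn y x < Sb k)%N) /\ sides p b k.+1 u'.
(* By [sides], [u] lies in the parabolic subgroup omitting the block boundaries from [Sb k] on. *)
pose D i := forall s, (k <= s <= p)%N -> i != Sb s.
have Kok : lspan (fun z => exists2 u', K u' & z = Tw T u') (Tw T y * Tw T u).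
  apply: (Tw_mul_span hq hT (D := D)) => //.
    move=> i u' hi Di [h1 h2]; split.
      move=> x; rewrite pnM pn_sgen // -h1.
      by have := Di k; rewrite leqnn (ltnW kp) => /(_ erefl); move: hi; sw_lia.
    apply: sidesM => //; apply: (sides_sgen p1 hb hbn) => // s hs'; apply: Di; lia.
  move=> i hi nD x; have [s hs' es] : exists2 s, (k <= s <= p)%N & i = Sb s.
    case: (excluded_middle_informative (exists2 s, (k <= s <= p)%N & i = Sb s)) => // h.
    exfalso; apply: nD => s hs'; apply/eqP => es; apply: h.
    by exists s.
  by rewrite es hs.
apply: span_mull Kok => _ [u' [h1 h2] ->]; apply: span_in; exists a', u'; split=> //.
split=> // hc; have := coset_len p1 hb hbn kp hc h1.
by move: hl; rewrite size_cw; lia.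
Qed.

Lemma expands_om l w0 x : inC k w0 -> bounded n r l ->
  expands (outC k) (inC k) l w0 x ->
  expands (outC k.+1) (inC k.+1) (l \o wact (om k)) (w * w0)%g (tprod T (om k) * x).
Proof.
move=> C0 bl [z hz ->].
have [z1 hz1 e1] := om_term bl (proj1 C0).
exists (z1 + tprod T (om k) * z); last by rewrite mulrDr e1 addrA.
apply: spanD; first by apply: span_mono hz1 => y; apply: terms_low.
apply: span_mull hz => _ [a [u [ha hu ->]]].
have hs : sides p b k u by case: hu => [[]//|[[]]].
have [z2 hz2 ->] := om_term ha hs.
apply: spanD; last by apply: span_mono hz2 => y; apply: terms_low.
have ba : bounded n r (a \o wact (om k)).
  by apply: bounded_wact => //; exact: (rword_vword (rword_om p1 hb hbn kp)).
have actn j : (wact (om k) j < n)%N = (j < n)%N.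
  by rewrite -(pn_wprod j (rword_vword (rword_om p1 hb hbn kp))) pn_lt.
apply: span_in; exists (a \o wact (om k)), (w * u)%g; split=> //.
case: hu => [hu|[hC [h1 [j hj h2]]]]; first by left; apply: (outC_om p1 hb hbn).
right; split; first by apply: (inC_om p1 hb hbn).
split=> [i hi /=|]; first by apply: h1; rewrite actn.
have [j' ej] : exists j', wact (om k) j' = j.
  exists (pn w^-1%g j); rewrite -(pn_wprod _ (rword_vword (rword_om p1 hb hbn kp))).
  exact: pnKV.
by exists j'; rewrite /= ?ej // -actn ej.
Qed.

Lemma expands_bX l w0 x : inC k w0 -> bounded n r l ->
  (forall j, (j < bt b k.+1)%N -> (l (wact (om k) j) + k * d < r)%N) ->
  expands (outC k) (inC k) l w0 x ->
  expands (outC k.+1) (inC k.+1)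
    (fun j => if (j < bt b k.+1)%N then (l (wact (om k) j) + k * d)%N else l (wact (om k) j))
    (w * w0)%g (bX eps q Q b T k.+1 * x).
Proof.
move=> C0 bl hl /(expands_om C0 bl) h; have bd := om_bound p1 hb hbn kp.
rewrite bXdef -mulrA.
have szr : size (rts eps Q (iota 1 k)) = (k * d)%N by rewrite size_rts size_iota.
rewrite -szr; apply: (expands_Fm hq hT) => //; first by lia.
- move=> i hi a u ha hu.
  apply: (overflow hq hT (Qs := Qr p eps Q) (c := bt b k.+1)) => //; last 1 first.
  + by move=> j u' hj; apply: (outC_sgen p1 hb hbn).
  + by rewrite -[Qr _ _ _]/(rts eps Q (iota 1 p)) size_rts size_iota.
  + by case: hA.
  by lia.
- by apply: bounded_wact => //; exact: (rword_vword (rword_om p1 hb hbn kp)).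
- by move=> i hi; rewrite szr; apply: hl.
by apply: (inC_om p1 hb hbn).
Qed.
End Step.
End Stages.

(** * Linear independence from leading terms *)

Section Independence.
Variables (R : comUnitRingType) (A : algType R) (n : nat) (q : R) (T : nat -> A) (r : nat).
Hypothesis r0 : (0 < r)%N.
Hypothesis hbasis : is_basis (AK_bas q r n T).
Local Notation Mon := (Mon q T).
Local Notation idx := ({ffun 'I_n -> 'I_r} * 'S_n)%type.

Definition exps (a : nat -> nat) : {ffun 'I_n -> 'I_r} :=
  [ffun j : 'I_n => insubd (Ordinal r0) (a j)].

Lemma Mon_AK a (u : 'S_n) : bounded n r a ->
  Mon n a * Tw T u = AK_bas q r n T (exps a, u).
Proof.
move=> ha; congr (_ * _); rewrite MonE big_mkord; apply: eq_bigr => j _.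
by rewrite ffunE val_insubd ha.
Qed.

Lemma exps_inj a a' : bounded n r a -> bounded n r a' -> exps a = exps a' ->
  forall j, (j < n)%N -> a j = a' j.
Proof.
move=> ha ha' /ffunP h j hj; have := congr1 val (h (Ordinal hj)).
by rewrite !ffunE !val_insubd /= ha ?ha'.
Qed.

Lemma basis_coef : exists cf : A -> idx -> R,
  [/\ forall (a : R) x y i, cf (a *: x + y) i = a * cf x i + cf y i
    & forall i j, cf (AK_bas q r n T i) j = (i == j)%:R].
Proof.
pose P (y : A) (c : {ffun idx -> R}) := y = \sum_i c i *: AK_bas q r n T i.
pose cf y : {ffun idx -> R} := epsilon (inhabits [ffun=> 0]) (P y).
have cfP y : P y (cf y).
  by apply: epsilon_spec; have [c [e _]] := hbasis y; exists c.
have cfU y c : P y c -> cf y = c.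
  move=> h; have [c0 [_ u]] := hbasis y.
  by rewrite -(u _ h) -(u _ (cfP y)).
exists (fun y i => cf y i); split=> [a x y i|i j].
  rewrite (cfU _ [ffun i => a * cf x i + cf y i]) ?ffunE //.
  rewrite /P {1}(cfP x) {1}(cfP y) scaler_sumr -big_split; apply: eq_bigr => k _.
  by rewrite ffunE scalerDl scalerA.
rewrite (cfU _ [ffun j => (i == j)%:R]) ?ffunE //.
rewrite /P (bigD1 i) //= ffunE eqxx scale1r big1 ?addr0 // => k nk.
by rewrite ffunE eq_sym (negbTE nk) scale0r.
Qed.

(** Among the indices with nonzero coefficient take one of maximal total degree and compare
    coefficients at its leading basis element. Terms in [N] have the wrong permutation, and a
    dominated term of another index would give that index larger degree. *)
Lemma leading_indep (I : finType) (l : I -> nat -> nat) (w : I -> 'S_n) (e : I -> A)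
    (N C : 'S_n -> Prop) (c : I -> R) :
  (forall x, bounded n r (l x)) -> (forall x, C (w x)) -> (forall u, N u -> ~ C u) ->
  (forall x y, (forall j, (j < n)%N -> l x j = l y j) -> w x = w y -> x = y) ->
  (forall x, expands q T r N C (l x) (w x) (e x)) ->
  \sum_x c x *: e x = 0 -> forall x, c x = 0.
Proof.
move=> bl Cw NC inj he hsum x0; apply/eqP/negPn/negP => cx0.
case: (@arg_maxnP I x0 (fun x => c x != 0) (fun x => (\sum_(j < n) l x j)%N) cx0) => x cx maxx.
have [cf [cfD cfB]] := basis_coef.
have cf0 i : cf 0 i = 0.
  by apply: (addrI (cf 0 i)); have := cfD 1 0 0 i; rewrite scale1r mul1r addr0 => <-; rewrite addr0.
have cfS (F : I -> A) i : cf (\sum_y c y *: F y) i = \sum_y c y * cf (F y) i.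
  elim: (index_enum I) => [|y s IH]; first by rewrite !big_nil cf0.
  by rewrite !big_cons cfD IH.
pose i0 := (exps (l x), w x).
have cflow y z : c y != 0 -> lspan (low q T r N C (l y)) z -> cf z i0 = 0.
  move=> cy; elim=> [|a u v [a' [u' [ha' hu ->]]] _ IH]; first exact: cf0.
  rewrite cfD IH addr0 Mon_AK // cfB.
  case: eqP => [[ea eu]|_]; last by rewrite mulr0.
  exfalso; case: hu => [hN|[_ [h1 [j hj h2]]]].
    by apply: (NC u') => //; rewrite eu.
  have := exps_inj ha' (bl x) ea => el.
  have : (\sum_(j < n) l y j <= \sum_(j < n) l x j)%N := maxx y cy; rewrite leqNgt => /negP; apply.
  have hlt k : (k < n)%N -> (l x k <= l y k)%N by move=> hk; rewrite -el // h1.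
  rewrite (bigD1 (Ordinal hj)) //= [X in (_ < X)%N](bigD1 (Ordinal hj)) //=.
  rewrite -addSn leq_add //; first by rewrite -el.
  by apply: leq_sum => k _; apply: hlt.
have := congr1 (fun z => cf z i0) hsum; rewrite cfS cf0 (bigD1 x) //= big1 => [|y nyx].
  case: (he x) => z hz ->; rewrite -[Mon n (l x) * _]scale1r cfD mul1r (cflow x z) // Mon_AK // cfB eqxx.
  by rewrite !addr0 mulr1 => /eqP; apply/negP.
have [->|cy] := eqVneq (c y) 0; first by rewrite mul0r.
case: (he y) => z hz ->; rewrite -[Mon n (l y) * _]scale1r cfD mul1r (cflow y z) // Mon_AK // cfB.
case: eqP => [[ea eu]|_]; last by rewrite addr0 mulr0.
by case/eqP: nyx; apply: inj => // j hj; apply: exps_inj hj.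
Qed.
End Independence.

Section Exponents.
Variables (p d n : nat) (b : seq nat) (a : nat -> nat).
Hypothesis p1 : (1 < p)%N.
Hypothesis hb : size b = p.
Hypothesis hbn : sumn b = n.
Hypothesis ha : bounded n d a.
Local Notation Sb := (bsum b 1).
Local Notation blk := (blk p b).

Definition cnt (l : seq nat) (j : nat) : nat := count (fun s => (j < Sb s.-1)%N) l.

(** A strand of block [t], counted from 0, gains [d] from each of the [p - 1 - t] factors [bU] that
    reach it and [t d] from its own [bX]: together [d (p - 1)], so exponents stay below [p d]. The
    parameter [k] counts the factors [bX] already applied. *)
Definition lexp (k j : nat) : nat :=
  a j + d * cnt (iota 2 p.-1) j + (if (blk j < k)%N then d * blk j else 0).

Lemma cnt_bound j : (j < n)%N -> (cnt (iota 2 p.-1) j + blk j <= p.-1)%N.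
Proof.
move=> hj; have [h1 /andP[h2 h3]] := blkP p1 hb hbn hj.
suff h k : (cnt (iota 2 k) j <= k - blk j)%N by have := h p.-1; lia.
elim: k => // k IH.
have -> : cnt (iota 2 k.+1) j = (cnt (iota 2 k) j + (j < Sb k.+1))%N.
  by rewrite /cnt -[k.+1 in LHS]addn1 iotaD count_cat /= addn0.
have : (j < Sb k.+1)%N -> (blk j < k.+1)%N.
  move=> hk; rewrite ltnNge; apply/negP => hkb; have := Sb_mono b hkb; lia.
case: (j < Sb k.+1)%N => [/(_ erefl)|_]; lia.
Qed.

Lemma lexp_bound k j : (j < n)%N -> (lexp k j < p * d)%N.
Proof.
move=> hj; rewrite /lexp; have := cnt_bound hj; have := ha hj.
case: ifP => _; nia.
Qed.

End Exponents.

Section Faithful.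
Variables (R : comUnitRingType) (A : algType R) (p d n : nat).
Variables (eps q : R) (Q : seq R) (b : seq nat) (T : nat -> A).
Hypothesis p1 : (1 < p)%N.
Hypothesis d0 : (0 < d)%N.
Hypothesis hQ : size Q = d.
Hypothesis hb : size b = p.
Hypothesis hbn : sumn b = n.
Hypothesis hq : q \is a GRing.unit.
Hypothesis hA : AK_rel q (Qr p eps Q) n T.
Let hT : affine q n T := AK_affine hA.
Local Notation J := (JM q T).
Local Notation Mon := (Mon q T).
Local Notation Sb := (bsum b 1).
Local Notation r := (p * d)%N.
Local Notation Wp := (Wp n b).
Local Notation inC := (@inC p n b).
Local Notation outC := (@outC p n b).
Local Notation blk := (blk p b).
Local Notation v := (vt eps q Q b T p).

Section LeadingTerm.
Variables (a : nat -> nat) (X : 'S_n).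
Hypothesis ha : bounded n d a.
Hypothesis hX : inC 0 X.
Local Notation cnt := (cnt b).
Local Notation lexp := (lexp p d b a).

(** Only polynomials in the Jucys-Murphy elements act and no power overflows, so the class [N] can
    be empty. *)
Lemma expands_bU l : (size l <= p.-1)%N -> all (fun s => s <= p)%N l ->
  expands q T r (fun _ => False) (inC 0) (fun j => a j + d * cnt l j)%N X
    (\prod_(s <- l) bU eps q Q b T s * (Mon n a * Tw T X)).
Proof.
elim: l => [|s l IH] /= hl.
  move=> _; exists 0; first exact: span0.
  rewrite big_nil mul1r addr0; congr (_ * _); apply: eq_Mon => j _.
  by rewrite /cnt /= muln0 addn0.
case/andP=> hs hal; rewrite big_cons -mulrA.
have szr : size (rt eps Q s) = d by rewrite size_map.
have sn : (Sb s.-1 <= n)%N by apply: (Sb_n hb hbn); lia.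
have bnd j : (j < n)%N -> (a j + d * cnt l j + d < r)%N.
  move=> /ha hj; have : (cnt l j <= size l)%N by exact: count_size.
  nia.
apply: (@expands_ext _ _ _ _ _ _ _ _
  (fun j => if (j < Sb s.-1)%N then (a j + d * cnt l j + size (rt eps Q s))%N else (a j + d * cnt l j)%N)).
  by move=> j _; rewrite szr /cnt /=; case: ifP => _; rewrite ?mulnDr ?muln1 ?add0n; lia.
apply: (expands_Fm hq hT) => //.
- by move=> j hj; have := bnd j hj; lia.
- by move=> j hj; rewrite szr; apply: bnd; lia.
by apply: IH => //; lia.
Qed.

Lemma inC_Wp k : (k <= p)%N -> inC k (Wp k * X)%g.
Proof.
elim: k => [|k IH] kp /=; first by rewrite mul1g.
by rewrite -mulgA; apply: (inC_om p1 hb hbn) => //; apply: IH; apply: ltnW.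
Qed.

(** Exponents are recorded by the position of a strand at the right end, where the blocks are in
    order; [pn (Wp k)] translates positions at the left end. *)
Lemma expands_pX k : (k <= p)%N ->
  expands q T r (outC k) (inC k) (fun j => lexp k (pn (Wp k) j)) (Wp k * X)%g
    (pX eps q Q b T k * (pU eps q Q b T p * (Mon n a * Tw T X))).
Proof.
elim: k => [|k IH] kp.
  have -> : pU eps q Q b T p = \prod_(s <- iota 2 p.-1) bU eps q Q b T s.
    have -> : pU eps q Q b T p = bU eps q Q b T 1 * \prod_(s <- iota 2 p.-1) bU eps q Q b T s.
      by rewrite /pU -[in LHS](prednK (ltnW p1)) /= big_cons.
    by rewrite /bU [Sb _]Sb0 Fm0 mul1r.
  rewrite /pX big_nil mul1r /= mul1g.
  have [||z hz ->] := @expands_bU (iota 2 p.-1).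
  - by rewrite size_iota.
  - by apply/allP => s; rewrite mem_iota; lia.
  exists z; last by congr (_ * _ + _); apply: eq_Mon => j _; rewrite pn1 /lexp addn0.
  apply: span_mono hz => _ [a' [u [ha' [//|[hC [h1 [j hj h2]]]] ->]]].
  exists a', u; split=> //; right; split=> //; split.
    by move=> i hi; rewrite pn1 /lexp addn0; apply: h1.
  by exists j => //; rewrite pn1 /lexp addn0.
rewrite pXS -mulrA.
have Wn j : (pn (Wp k.+1) j < n)%N = (j < n)%N by rewrite pn_lt.
have eW j : pn (Wp k.+1) j = pn (Wp k) (wact (om b k) j).
  by rewrite WpS (pn_wprod _ (rword_vword (rword_om p1 hb hbn kp))).
have eE j : (j < n)%N -> lexp k.+1 (pn (Wp k.+1) j) =
    if (j < bt b k.+1)%N then (lexp k (pn (Wp k) (wact (om b k) j)) + k * d)%N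
    else lexp k (pn (Wp k) (wact (om b k) j)).
  move=> hj; rewrite -(Wp_block p1 hb hbn kp hj) -eW /lexp ltnS.
  by case: (ltngtP (blk _) k) => [?|?|->] //; rewrite addn0 [(k * d)%N]mulnC.
have := expands_bX p1 hQ hb hbn hq hA kp (inC_Wp (ltnW kp)) _ _ (IH (ltnW kp)).
rewrite mulgA -/(Wp k.+1) => h.
apply: (@expands_ext _ _ _ _ _ _ _ _
  (fun j => if (j < bt b k.+1)%N then (lexp k (pn (Wp k) (wact (om b k) j)) + k * d)%N
    else lexp k (pn (Wp k) (wact (om b k) j)))).
  by move=> j hj; rewrite eE.
apply: h.
  by move=> j hj; apply: (lexp_bound p1 hb hbn ha); rewrite pn_lt.
move=> j hj; have bd := om_bound p1 hb hbn kp.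
have jn : (j < n)%N by lia.
by have := eE j jn; rewrite hj => <-; apply: (lexp_bound p1 hb hbn ha); rewrite Wn.
Qed.

Lemma expands_v : expands q T r (outC p) (inC p) (fun j => lexp p (pn (Wp p) j))
  (Wp p * X)%g (v * (Mon n a * Tw T X)).
Proof. by rewrite vtdef -mulrA; apply: expands_pX. Qed.
End LeadingTerm.
End Faithful.

(** * Standard elements of the tensor product in global coordinates *)

Section BlockPerm.
Variables (p d n : nat) (b : seq nat).
Hypothesis p1 : (1 < p)%N.
Hypothesis hb : size b = p.
Hypothesis hbn : sumn b = n.
Local Notation Sb := (bsum b 1).
Local Notation blk := (blk p b).
Variable x : Hdb_index p d b.

(** Exponents indexed by global strands; for [k < n] both partial lookups succeed, so the default 0
    concerns only positions beyond the last strand. *)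
Definition pos_exp (k : nat) : nat :=
  if insub (blk k) : option 'I_p is Some t then
    if insub (k - Sb t)%N : option 'I_(bo b t) is Some j then (x t).1 j else 0%N
  else 0%N.

Lemma pos_exp_lt k : (0 < d)%N -> (pos_exp k < d)%N.
Proof. by move=> d0; rewrite /pos_exp; case: insub => // t; case: insub => // j. Qed.

Lemma bo_bound (t : 'I_p) : (Sb t + bo b t <= n)%N.
Proof.
have h : (Sb t + bt b t.+1 <= n)%N by rewrite -SbS; apply: (Sb_n hb hbn).
exact: h.
Qed.

Lemma blk_pos (t : 'I_p) (j : 'I_(bo b t)) : blk (Sb t + j) = t.
Proof.
apply: (blk_eq p1 hb hbn) => //; rewrite SbS leq_addr ltn_add2l /=.
exact: ltn_ord.
Qed.

Lemma pos_expE (t : 'I_p) (j : 'I_(bo b t)) : pos_exp (Sb t + j) = (x t).1 j.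
Proof. by rewrite /pos_exp blk_pos valK addKn valK. Qed.

Definition block_word (t : nat) : seq nat :=
  if insub t : option 'I_p is Some t' then
    [seq (i + Sb t)%N | i <- redword (bo b t') (x t').2] else [::].

Fixpoint block_perm (k : nat) : 'S_n :=
  if k is k'.+1 then (block_perm k' * wprod n (block_word k'))%g else 1%g.

Lemma block_wordE (t : 'I_p) :
  block_word t = [seq (i + Sb t)%N | i <- redword (bo b t) (x t).2].
Proof. by rewrite /block_word valK. Qed.

Lemma rword_block (t : 'I_p) : rword n (block_word t).
Proof.
by rewrite block_wordE; have [rw _] := redwordP (x t).2; apply: rword_shift (bo_bound t) rw.
Qed.

Lemma wact_below s k y : all (fun i => 0 < i)%N s -> (y < k)%N ->
  wact [seq (i + k)%N | i <- s] y = y.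
Proof.
move=> hs hy; elim: s hs => //= i s IH /andP[i0 hs]; rewrite sw_out ?IH //; lia.
Qed.

Lemma pn_block_below (t : 'I_p) y : (y < Sb t)%N -> pn (wprod n (block_word t)) y = y.
Proof.
move=> hy; rewrite pn_wprod ?(rword_vword (rword_block t)) // block_wordE wact_below //.
by have [/rword_vword/vword_pos] := redwordP (x t).2.
Qed.

Lemma pn_block_shift (t : 'I_p) y :
  pn (wprod n (block_word t)) (Sb t + y) = (Sb t + pn (x t).2 y)%N.
Proof.
rewrite pn_wprod ?(rword_vword (rword_block t)) // block_wordE addnC.
have [/rword_vword rw e] := redwordP (x t).2.
by rewrite wact_shift ?(vword_pos rw) // -(pn_wprod _ rw) e addnC.
Qed.

Lemma block_perm_ge k y : (k <= p)%N -> (Sb k <= y)%N -> pn (block_perm k) y = y.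
Proof.
elim: k y => [|k IH] y kp hy /=; first by rewrite pn1.
have e := SbS b k; rewrite pnM IH; [|lia|lia].
have -> : y = (Sb (Ordinal kp) + (y - Sb k))%N by rewrite /=; lia.
rewrite (@pn_block_shift (Ordinal kp)) pn_ge //.
by rewrite -[bo _ _]/(bt b k.+1); lia.
Qed.

Lemma block_perm_lt k y : (k <= p)%N -> (y < Sb k)%N -> (pn (block_perm k) y < Sb k)%N.
Proof.
move=> kp hy; rewrite ltnNge; apply/negP => h.
have := block_perm_ge kp h => /pn_inj; lia.
Qed.

Lemma block_permE k (t : 'I_p) (j : 'I_(bo b t)) : (t < k)%N -> (k <= p)%N ->
  pn (block_perm k) (Sb t + j) = (Sb t + (x t).2 j)%N.
Proof.
have hj : (j < bt b t.+1)%N by exact: ltn_ord.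
have hj2 : ((x t).2 j < bt b t.+1)%N by exact: (ltn_ord ((x t).2 j)).
elim: k => // k IH tk kp; rewrite /= pnM; have e := SbS b t.
have [etk|ntk] := eqVneq (t : nat) k.
  have eS : Sb t = Sb k by rewrite etk.
  rewrite block_perm_ge; [|lia|lia].
  by rewrite -etk pn_block_shift pnE.
have hm : (Sb t.+1 <= Sb k)%N by apply: Sb_mono; lia.
rewrite IH; [|lia|lia].
apply: (@pn_block_below (Ordinal kp)); rewrite /=.
by apply: leq_trans hm; rewrite e ltn_add2l.
Qed.

Lemma inC_block_perm : inC p b 0 (block_perm p).
Proof.
have key y : (y < n)%N -> blk (pn (block_perm p) y) = blk y.
  move=> hy; have [h1 /andP[h2 h3]] := blkP p1 hb hbn hy.
  pose t := Ordinal h1; move: h3; rewrite SbS => h3.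
  have hj : (y - Sb t < bo b t)%N by rewrite -[bo b t]/(bt b (blk y).+1) /=; lia.
  have -> : y = (Sb t + Ordinal hj)%N by rewrite /=; lia.
  by rewrite (block_permE (k := p) (t := t)) ?ltn_ord ?leqnn // !blk_pos.
split=> [s hs y|y hy]; last by rewrite key //= pn1.
have [hy|hy] := ltnP y n; last by rewrite pn_ge.
by rewrite !(blk_side p1 hb hbn) ?pn_lt ?key.
Qed.
End BlockPerm.

Section StandardForm.
Variables (R : comUnitRingType) (A : algType R) (p d n : nat).
Variables (q : R) (b : seq nat) (T : nat -> A).
Hypothesis p1 : (1 < p)%N.
Hypothesis hb : size b = p.
Hypothesis hbn : sumn b = n.
Hypothesis hq : q \is a GRing.unit.
Hypothesis hT : affine q n T.
Local Notation J := (JM q T).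
Local Notation Mon := (Mon q T).
Local Notation Sb := (bsum b 1).
Variable x : Hdb_index p d b.
Local Notation pos_exp := (pos_exp x).
Local Notation block_word := (block_word x).
Local Notation block_perm := (block_perm n x).
Local Notation bo_bound := (bo_bound hb hbn).

Lemma Mon_blocks (a : nat -> nat) k : Mon (Sb k) a =
  \prod_(0 <= t < k) \prod_(0 <= j < bt b t.+1) J (Sb t + j) ^+ a (Sb t + j)%N.
Proof.
elim: k => [|k IH]; first by rewrite Sb0 MonE !big_nil.
rewrite big_nat_recr //= -IH MonE (big_cat_nat (n := Sb k)) //=; last by apply: Sb_mono.
congr (_ * _); rewrite SbS -{1}(add0n (Sb k)) big_addn addKn.
by apply: eq_bigr => j _; rewrite addnC.
Qed.

Lemma Mon_pos_exp : Mon n pos_exp =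
  \prod_(t < p) \prod_(j < bo b t) Ljm q (shg q T (Sb t)) j.+1 ^+ (x t).1 j.
Proof.
rewrite -(Sb_p hb hbn) Mon_blocks big_mkord; apply: eq_bigr => t _.
rewrite big_mkord; apply: eq_bigr => j _.
by rewrite /Ljm /= JM_shg (pos_expE p1 hb hbn x j).
Qed.

Lemma Tw_block_perm k : (k <= p)%N ->
  Tw T (block_perm k) = \prod_(0 <= t < k) Tw T (wprod n (block_word t)).
Proof.
elim: k => [|k IH] kp /=; first by rewrite (affTw1 hT) big_nil.
rewrite big_nat_recr //= -IH; last exact: ltnW.
rewrite (affTwM hT) // => y z hyz hlt.
have kp' := ltnW kp.
have hz : (z < Sb k)%N.
  rewrite ltnNge; apply/negP => h; move: hlt; rewrite (block_perm_ge p1 hb hbn x kp' h).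
  have [hy|hy] := ltnP y (Sb k); first by have := block_perm_lt p1 hb hbn x kp' hy; lia.
  by rewrite (block_perm_ge p1 hb hbn x kp' hy); lia.
have hy : (y < Sb k)%N by lia.
have := block_perm_lt p1 hb hbn x kp' hy; have := block_perm_lt p1 hb hbn x kp' hz => h1 h2.
by rewrite !(@pn_block_below _ _ _ _ p1 hb hbn x (Ordinal kp)).
Qed.

(** Gathers the blocks into one monomial times one [T_w], the shape for which leading terms are
    computed. *)
Lemma standard_form :
  \prod_(t < p) AK_bas q d (bo b t) (shg q T (Sb t)) (x t) =
  Mon n pos_exp * Tw T (block_perm p).
Proof.
rewrite Mon_pos_exp Tw_block_perm // big_mkord /AK_bas prod_mul_comm.
- congr (_ * _); apply: eq_bigr => t _; rewrite (Tw_shg hq hT (x t).2 (bo_bound t)).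
  by rewrite block_wordE.
- exact: index_enum_uniq.
move=> s t nst; have us : in_gens (shg q T (Sb s)) (bo b s) (Tw (shg q T (Sb s)) (x s).2).
  exact: in_gens_Tw.
apply/commr_sym/us => i hi; apply/commr_sym; apply: commr_prod_seq => j _; apply: commrX.
have g : in_gens (shg q T (Sb t)) (bo b t) (JM q (shg q T (Sb t)) j) by apply: in_gensJ.
apply: g => k hk; apply: (shg_comm hq hT (bo_bound s) (bo_bound t)) => //.
have nst' : (s : nat) != t by [].
have es : (Sb s.+1 = Sb s + bo b s)%N by apply: SbS.
have et : (Sb t.+1 = Sb t + bo b t)%N by apply: SbS.
have [lt|lt] : (s < t)%N \/ (t < s)%N by lia.
  by right; have := Sb_mono b lt; lia.
by left; have := Sb_mono b lt; lia.
Qed.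

End StandardForm.

Lemma standard_inj p d n b (x y : Hdb_index p d b) :
  (1 < p)%N -> size b = p -> sumn b = n ->
  (forall k, (k < n)%N -> pos_exp x k = pos_exp y k) ->
  block_perm n x p = block_perm n y p -> x = y.
Proof.
move=> p1 hb hbn he hw; apply/ffunP => t.
have jn (j : 'I_(bo b t)) : (bsum b 1 t + j < n)%N.
  by have := bo_bound hb hbn t; have := ltn_ord j; lia.
rewrite [LHS]surjective_pairing [RHS]surjective_pairing; congr (_, _).
  apply/ffunP => j; apply: val_inj => /=.
  by rewrite -!(pos_expE p1 hb hbn) he.
apply/permP => j; apply: val_inj => /=; apply: (@addnI (bsum b 1 t)).
rewrite -(block_permE p1 hb hbn x j (ltn_ord t) (leqnn p)).
by rewrite -(block_permE p1 hb hbn y j (ltn_ord t) (leqnn p)) hw.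
Qed.

Section Faithful.
Variables (R : comUnitRingType) (p d n : nat).
Hypothesis p1 : (1 < p)%N.
Hypothesis d0 : (0 < d)%N.
Variables (eps q : R) (Q : seq R).
Hypothesis hQ : size Q = d.
Hypothesis hq : q \is a GRing.unit.
Variable b : seq nat.
Hypothesis hb : size b = p.
Hypothesis hbn : sumn b = n.
Variables (A : algType R) (T : nat -> A).
Hypothesis hA : AK_rel q (Qr p eps Q) n T.
Hypothesis hbasis : is_basis (AK_bas q (p * d) n T).
Local Notation v := (vt eps q Q b T p).
Local Notation tg := (tg p q b T).
Local Notation tg' := (tg' q b T).

Lemma intertw_prod (I : eqType) (s : seq I) (F F' : I -> A) :
  (forall i, i \in s -> F i * v = v * F' i) ->
  (\prod_(i <- s) F i) * v = v * \prod_(i <- s) F' i.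
Proof.
elim: s => [|i s IH] h; first by rewrite !big_nil mul1r mulr1.
rewrite !big_cons -mulrA IH => [|j hj]; last by apply: h; rewrite inE hj orbT.
by rewrite mulrA h ?mem_head // mulrA.
Qed.

Lemma intertw_AK (t : 'I_p) y :
  AK_bas q d (bo b t) (tg t.+1) y * v = v * AK_bas q d (bo b t) (tg' t.+1) y.
Proof.
have ht : (0 < t.+1 <= p)%N by exact: ltn_ord.
have hg i : (i < bt b t.+1)%N -> tg t.+1 i * v = v * tg' t.+1 i.
  exact: (tg_v p1 hb hbn hq hA ht).
have hw : Tw (tg t.+1) y.2 * v = v * Tw (tg' t.+1) y.2.
  apply: intertw_prod => i hi; apply: hg.
  by have [/rword_vword/allP/(_ _ hi)/andP[_ hi'] _] := redwordP y.2.
rewrite -mulrA hw !mulrA; congr (_ * _); apply: intertw_prod => j _.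
have hJ : JM q (tg t.+1) j * v = v * JM q (tg' t.+1) j.
  have hj : (j < bt b t.+1)%N by exact: ltn_ord.
  elim: (nat_of_ord j) hj => [|k IH] hk; first exact: hg.
  rewrite !JS -scalerAl -scalerAr -!mulrA hg // (mulrA (JM _ _ _)) IH; last exact: ltnW.
  by rewrite !mulrA hg.
rewrite /Ljm /=; elim: (nat_of_ord (y.1 j)) => [|k IH]; first by rewrite !expr0 mul1r mulr1.
by rewrite !exprS -mulrA IH !mulrA hJ.
Qed.

(** Moving to the right of [v] puts the blocks back into their natural order, so the factor there is
    a standard element. *)
Lemma Theta_bas_v x : Theta_bas p d n q b T x * v =
  v * (Mon q T n (pos_exp x) * Tw T (block_perm n x p)).
Proof.
have hT := AK_affine hA.
rewrite (Theta_basE p1 hb hbn hq hT) -(standard_form p1 hb hbn hq hT).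
by apply: intertw_prod => t _; apply: intertw_AK.
Qed.

Lemma Theta_bas_indep (c : Hdb_index p d b -> R) :
  \sum_x c x *: (Theta_bas p d n q b T x * v) = 0 -> forall x, c x = 0.
Proof.
have r0 : (0 < p * d)%N by rewrite muln_gt0 d0 (ltnW p1).
have hX (x : Hdb_index p d b) := inC_block_perm p1 hb hbn x.
have ha (x : Hdb_index p d b) : bounded n d (pos_exp x) by move=> j _; apply: pos_exp_lt.
apply: (leading_indep r0 hbasis
  (l := fun x j => lexp p d b (pos_exp x) p (pn (Wp n b p) j))
  (w := fun x => (Wp n b p * block_perm n x p)%g)
  (N := @outC p n b p) (C := @inC p n b p)).
- move=> x j hj; apply: (lexp_bound p1 hb hbn (ha x)); by rewrite pn_lt.
- by move=> x; apply: (inC_Wp p1 hb hbn (hX x)).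
- by move=> u [_ h1] [_ h2].
(* The terms that [lexp] adds to [pos_exp] depend only on the strand and cancel; [Wp p] is a common
   left factor of the permutations. *)
- move=> x y hl /mulgI hw; apply: (standard_inj p1 hb hbn _ hw) => k hk.
  have := hl (pn (Wp n b p)^-1%g k); rewrite pn_lt hk pnKV => /(_ erefl).
  by rewrite /lexp -!addnA => /addIn.
move=> x; rewrite Theta_bas_v; exact: (expands_v p1 d0 hQ hb hbn hq hA (ha x) (hX x)).
Qed.
End Faithful.

(** * The idempotent and the isomorphism *)

Unset Implicit Arguments.

Theorem theorem2p17
  (R : comUnitRingType) (p d n : nat)
  (hp : (1 < p)%N) (hd : (0 < d)%N) (hn : (3 <= n)%N)
  (eps q : R) (Q : seq R) (hQ : size Q = d)
  (heps : p.-primitive_root eps)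
  (hq : q \is a GRing.unit)
  (hQu : all (fun x => x \is a GRing.unit) Q)
  (* Q is (eps,q)-separated *)
  (hsep : \prod_(Qi <- Q) \prod_(Qj <- Q) \prod_(k < (n + n).-1)
            \prod_(1 <= t < p) (Qi - eps ^+ t * q ^ (k%:Z - (n.-1)%:Z) * Qj)
          \is a GRing.unit)
  (* b in Comp_{p,n} *)
  (b : seq nat) (hb : size b = p) (hbn : sumn b = n)
  (* H_{r,n} = H_{r,n}(eps Q_1,...,eps^p Q_d), r = p d *)
  (A : algType R) (T : nat -> A) (hA : is_AK q (Qr p eps Q) n T)
  (* H_{d,b} *)
  (B : algType R) (G : nat -> nat -> B) (hB : is_Hdb p d eps q Q b G)
  (* the R-linear map hat Theta_b, given on the standard basis *)
  (Theta : B -> A)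
  (hTlin : forall (a : R) (x y : B), Theta (a *: x + y) = a *: Theta x + Theta y)
  (hTbas : forall x, Theta (Hdb_bas p d q b G x) = Theta_bas p d n q b T x)
  (* z_b and its inverse *)
  (z zi : B)
  (hz : Theta z * vb p n eps q Q b T = Yprod p n eps q Q b T * vb p n eps q Q b T)
  (hzi : z * zi = 1 /\ zi * z = 1) :
  let v := vb p n eps q Q b T in
  let e := Theta zi * v * Tb p n b T in
  let phi := fun h : B => Theta h * e in
  [/\ (* (a) *)
      e * e = e
      /\ ((forall x : A, exists y : A, v * x = e * y)
          /\ (forall y : A, exists x : A, e * y = v * x)),
      (* (b) *)
      (exists h : B, phi h = e)
      /\ (forall h : B, e * phi h = phi h /\ phi h * e = phi h)
      /\ (forall (a : R) (h1 h2 : B), exists h : B, phi h = a *: phi h1 + phi h2)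
      /\ (forall h1 h2 : B, exists h : B, phi h = phi h1 * phi h2)
    & (* (c) *)
      [/\ forall (a : R) (h1 h2 : B), phi (a *: h1 + h2) = a *: phi h1 + phi h2,
          forall h1 h2 : B, phi (h1 * h2) = phi h1 * phi h2,
          phi 1 = e
        & forall h1 h2 : B, phi h1 = phi h2 -> h1 = h2]].
Proof.
move=> v e phi.
have hr : size (Qr p eps Q) = (p * d)%N.
  by rewrite -[Qr _ _ _]/(rts eps Q (iota 1 p)) (size_rts _ hQ) size_iota.
case: hA => hrel; rewrite hr => hbasis.
have hT := AK_affine hrel.
have evb : v = vt eps q Q b T p by apply: (vbE hp hb hbn hq hrel).
have Tmul h1 h2 : Theta (h1 * h2) * v = Theta h1 * (Theta h2 * v).
  by rewrite evb; apply: (Theta_mul hp hd hQ hq hb hbn hrel hB hTlin hTbas).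
have T1 : Theta 1 * v = v by rewrite evb; apply: (Theta1_v hp hd hq hb hbn hrel hTbas).
have TvA h : exists y, Theta h * v = v * y.
  by rewrite evb; apply: (Theta_vA hp hq hb hbn hrel hB hTlin hTbas).
have vTv : v * Tb p n b T * v = Theta z * v.
  by rewrite hz -/v (TbE hp hb hbn hq hT) {1}evb (vt_pD_p hp hb hbn hq hrel).
have [zzi ziz] := hzi.
clearbody v.
have ev_v : e * v = v.
  by rewrite /e -!mulrA (mulrA v) vTv -Tmul ziz T1.
have e_fix h : e * (Theta h * v) = Theta h * v.
  by have [y ->] := TvA h; rewrite mulrA ev_v.
have phiE h : phi h = Theta h * (Theta zi * v) * Tb p n b T by rewrite /phi /e !mulrA.
have vTzi : v * Tb p n b T * (Theta zi * v) = v.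
  by have [y ey] := TvA zi; rewrite ey mulrA vTv -mulrA -ey -Tmul zzi T1.
have phi_lin (a : R) h1 h2 : phi (a *: h1 + h2) = a *: phi h1 + phi h2.
  by rewrite /phi hTlin mulrDl scalerAl.
(* [phi h] is [Theta (h * zi) * v * T_b], hence lies in [v A], on which [e] acts as the identity. *)
have e_phi h : e * phi h = phi h.
  by rewrite phiE -!Tmul (mulrA e) e_fix.
have phi_mul h1 h2 : phi (h1 * h2) = phi h1 * phi h2.
  have -> : phi h1 * phi h2 = Theta h1 * (e * phi h2) by rewrite {1}/phi mulrA.
  have key : Theta (h1 * h2) * (Theta zi * v) = Theta h1 * (Theta h2 * (Theta zi * v)).
    by rewrite -!Tmul mulrA.
  by rewrite e_phi !phiE key !mulrA.
have phi1 : phi 1 = e by rewrite phiE -Tmul mul1r /e.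
have e_idem : e * e = e by rewrite -{2 3}phi1 e_phi.
have phi_e h : phi h * e = phi h by rewrite -{1}phi1 -phi_mul mulr1.
have phi_inj h1 h2 : phi h1 = phi h2 -> h1 = h2.
  move=> eh; apply/eqP; rewrite -subr_eq0; apply/eqP; set h := h1 - h2.
  have hv : Theta h * v = 0.
    have ph : phi h = 0 by rewrite /h -scaleN1r addrC phi_lin eh scaleN1r addrC subrr.
    (* Right multiplication by [v] removes [e], because [e v = v], and leaves [Theta h * v], to
       which the independence result applies. *)
    have := congr1 (fun y => y * v) ph; rewrite mul0r /phi -mulrA ev_v.
    by [].
  have [c ec] := Hdb_expand hB h.
  have h0 : forall x, c x = 0.
    apply: (Theta_bas_indep hp hd hQ hq hb hbn hrel hbasis).
    rewrite -evb; apply: (etrans _ hv); rewrite ec (Theta_sum hTlin) mulr_suml.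
    by apply: eq_bigr => x _; rewrite hTbas scalerAl.
  by rewrite ec big1 // => x _; rewrite h0 scale0r.
split.
- split=> //; split=> [x|y]; first by exists (v * x); rewrite mulrA ev_v.
  have [w ew] := TvA zi; exists (w * Tb p n b T * y).
  by rewrite /e ew !mulrA.
- split; first by exists 1.
  split; first by move=> h; split.
  split=> [a h1 h2|h1 h2]; first by exists (a *: h1 + h2).
  by exists (h1 * h2).
by split.
Qed.
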